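(* Let $\xi$ be a Lévy process starting from $0$ with Laplace exponent $\psi$, and let $(X,(\mathbb Q_a)_{a>0})$ be the associated positive self-similar Markov process of index $1$, with clock $T^{(X)}(t)=\int_0^t\frac{ds}{X_s}$. Assume that $\operatorname{dom}\psi=(m_-,m_+)\ni 0$ and that $\psi'(0)>0$. Set $$m_0=\inf\{\theta:\psi'(\theta)>0\},\qquad \tau_+=\frac1{\psi'(m_+)},\qquad \tau_0=\frac1{\psi'(m_0)},\qquad \Delta=(\tau_+,\tau_0),$$ where $1/\psi'(\pm\infty):=\lim_{m\to\pm\infty}m/\psi(m)$. Let $\bar\Delta$ be the closure of $\Delta$, and let $$\mathcal I(x)=\sup_{m\in(m_0,m_+)}\{m-x\psi(m)\}.$$ Let $a>0$. 1. For every $x\in\bar\Delta$, $$\lim_{\varepsilon\to0}\lim_{t\to\infty}\frac1{\log t}\log\mathbb Q_a\left(\frac{T^{(X)}(t)}{\log t}\in[x-\varepsilon,x+\varepsilon]\right)=-\mathcal I(x).$$ 2. Moreover, $$\lim_{A\to\infty}\limsup_{t\to\infty}\frac1{\log t}\log\mathbb Q_a\left(\frac{T^{(X)}(t)}{\log t}>A\right)=-\infty .$$ 3. If either $\Delta=(0,\infty)$, or the complement of $\bar\Delta$ is exponentially negligible, i.e. $$\forall\varepsilon>0\qquad \limsup_{t\to\infty}\frac1{\log t}\log\mathbb Q_a\left(\inf_{x\in\bar\Delta}\left|x-\frac{T^{(X)}(t)}{\log t}\right|>\varepsilon\right)=-\infty ,$$ then the family of distributions of $T^{(X)}(t)/\log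 t$ under $\mathbb Q_a$ satisfies, as $t\to\infty$, the large deviation principle on $[0,\infty)$ at scale (speed) $\log t$ with good rate function $$\widetilde{\mathcal I}(x)=\begin{cases}\mathcal I(x)&\text{if }x\in\bar\Delta,\\ \infty&\text{otherwise.}\end{cases}$$
   Context: Laplace exponent: $\mathbb E\exp(m\xi_t)=\exp(t\psi(m))$; $\operatorname{dom}\psi$ is the set of $m\in\mathbb R$ where $\psi(m)<\infty$, taken open by convention (i.e. its interior), so $-\infty\le m_-<0<m_+\le\infty$. The infimum defining $m_0$ is over $\theta\in\operatorname{dom}\psi$. Values of $\psi$ and $\psi'$ at the endpoints $m_+$, $m_0$ are understood as limits from within $(m_0,m_+)$, with $1/0=\infty$ and $1/\infty=0$; when the endpoint is infinite, $1/\psi'(\pm\infty)$ is defined by the limit in the statement. A positive self-similar Markov process (pssMp) of index $1$ is a $[0,\infty)$-valued càdlàg strong Markov process $(X,(\mathbb Q_a)_{a>0})$, where $\mathbb Q_a$ is the law of $X$ started at $a$, such that for all $a,b>0$ the law of $(bX_{b^{-1}t})_{t\ge0}$ under $\mathbb Q_a$ equals the law of $(X_t)_{t\ge 0}$ under $\mathbb Q_{ba}$. Lamperti correspondence (index $1$): let $\xi$ be a real Lévy process with $\xi_0=0$ under a probability $\mathbb P$, with $\limsup_{t\to\infty}\xi_t=\infty$ (automatic here since $\mathbb E\xi_1=\psi'(0)>0$). Put $\mathcal A^{(\xi)}(t)=\int_0^t e^{\xi_s}\,ds$ and $\tau^{(\xi)}(t)=\inf\{u\ge0:\mathcal A^{(\xi)}(u)\ge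 t\}$. For $a>0$, $\mathbb Q_a$ is the law under $\mathbb P$ of $X_t=a\exp(\xi_{\tau^{(\xi)}(t/a)})$, $t\ge0$. Then $(X,(\mathbb Q_a)_{a>0})$ is a pssMp of index $1$ which never reaches $0$, the one associated with $\xi$. One has $\tau^{(\xi)}(t)=T^{(X)}(tX_0)$ for all $t\ge0$. *)

(* Defs.v *)
From HB Require Import structures.
From mathcomp Require Import all_boot all_order all_algebra.
From mathcomp Require Import all_classical all_reals all_analysis.

Set Implicit Arguments.
Unset Strict Implicit.
Unset Printing Implicit Defensive.

Import Order.TTheory GRing.Theory Num.Theory.
Import numFieldTopology.Exports numFieldNormedType.Exports.

Local Open Scope classical_set_scope.
Local Open Scope ring_scope.

(* Processes and paths are indexed by all of [R]; only times [t >= 0] matter. *)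

Section levy_process.
Context {d : measure_display} {T : measurableType d} {R : realType}.
Variables (P : probability T R) (xi : R -> {RV P >-> R}).

Definition cadlag (w : R -> R) : Prop :=
  (forall t, 0 <= t -> w s @[s --> t^'+] --> w t) /\
  (forall t, 0 < t -> cvg (w s @[s --> t^'-])).

Definition increment (s t : R) (w : T) : R := xi t w - xi s w.

(* The product rule over all of [0, n) gives independence of every
   subfamily, by taking [B i = setT]. *)
Definition independent_increments : Prop :=
  forall (n : nat) (t : nat -> R) (B : nat -> set R),
    0 <= t 0%N -> (forall i, t i <= t i.+1) ->
    (forall i, measurable (B i)) ->
    P (\bigcap_(i < n) (increment (t i) (t i.+1) @^-1` B i)) =
    (\prod_(i < n) P (increment (t i) (t i.+1) @^-1` B i))%E.

Definition stationary_increments : Prop :=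
  forall (s t : R) (B : set R), 0 <= s -> s <= t -> measurable B ->
    P (increment s t @^-1` B) = P (increment 0 (t - s) @^-1` B).

Definition levy_from_zero : Prop :=
  [/\ forall w, xi 0 w = 0,
      forall w, cadlag (xi ^~ w),
      independent_increments
    & stationary_increments].

(* [psi m = +oo] exactly when the exponential moments of order [m] at positive
   times are infinite. *)
Definition laplace_exponent (psi : R -> \bar R) : Prop :=
  forall m t : R, 0 <= t ->
    ('E_P[fun w => expR (m * xi t w)] = expeR (t%:E * psi m))%E.

End levy_process.

Section lamperti.
Context {R : realType}.
Local Notation mu := (@lebesgue_measure R).

Definition exp_functional (w : R -> R) (t : R) : R :=
  \int[mu]_(s in `[0, t]) expR (w s).

(* The real-valued [inf] of the empty set is 0. For a Levy path with
   limsup +oo, the set below is nonempty for every [t], so that convention only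
   concerns a null set of paths. *)
Definition lamperti_time (w : R -> R) (t : R) : R :=
  inf [set u | 0 <= u /\ t <= exp_functional w u].

Definition lamperti (a : R) (w : R -> R) (t : R) : R :=
  a * expR (w (lamperti_time w (t / a))).

Definition pssmp_clock (x : R -> R) (t : R) : R :=
  \int[mu]_(s in `[0, t]) (x s)^-1.

Definition scaled_clock (x : R -> R) (t : R) : R := pssmp_clock x t / ln t.

End lamperti.

(* The measure on path space that the Lamperti transform induces for the
   process started at [a]. *)
Definition pssmp_law {d : measure_display} {T : measurableType d}
    {R : realType} (P : probability T R) (xi : R -> {RV P >-> R}) (a : R)
    (S : set (R -> R)) : \bar R :=
  P [set w | S (lamperti a (xi ^~ w))].

Section rate.
Context {R : realType}.
Variables (psi : R -> \bar R) (mp : \bar R).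

Definition dom : set R := [set m | (psi m < +oo)%E]°.

Definition dpsi (m : R) : R := derive1 (fine \o psi) m.

Definition m_zero : \bar R :=
  ereal_inf [set m%:E | m in [set m | dom m /\ 0 < dpsi m]].

(* 1 / psi'(m_+), where [mp] is m_+; the inverse is the one of [\bar R], with
   [0^-1 = +oo] and [+oo^-1 = 0]. *)
Definition tau_plus : \bar R :=
  if mp is r%:E then (lim ((dpsi m)%:E @[m --> r^'-]))^-1%E
  else lim ((m / fine (psi m))%:E @[m --> +oo]).

Definition tau_zero : \bar R :=
  if m_zero is r%:E then (lim ((dpsi m)%:E @[m --> r^'+]))^-1%E
  else lim ((m / fine (psi m))%:E @[m --> -oo]).

Definition Delta : set R := [set x | (tau_plus < x%:E < tau_zero)%E].

Definition rate (x : R) : \bar R :=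
  ereal_sup [set (m - x * fine (psi m))%:E |
             m in [set m | (m_zero < m%:E < mp)%E]].

Definition rate_ext (x : R) : \bar R :=
  if x \in closure Delta then rate x else +oo%E.

End rate.

Section large_deviations.
Context {R : realType}.

(* [lne 0 = -oo]. *)
Definition log_decay (s : R) (p : \bar R) : \bar R := ((s^-1)%:E * lne p)%E.

Definition limsup_pinfty (f : R -> \bar R) : \bar R :=
  limf_esup f (pinfty_nbhs R).

Definition liminf_pinfty (f : R -> \bar R) : \bar R :=
  limf_einf f (pinfty_nbhs R).

(* Compactness of the level sets gives lower semicontinuity on [E]. *)
Definition good_rate_function (E : set R) (I : R -> \bar R) : Prop :=
  (forall x, E x -> (0 <= I x)%E) /\
  (forall c : R, compact (E `&` [set x | (I x <= c%:E)%E])).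

(* Large deviation principle on the subspace [E] of [R], as [t] tends to +oo,
   for the laws [nu t] with speed [s t]; the relatively closed (open) subsets
   of [E] are the traces on [E] of closed (open) sets. *)
Definition LDP_good (E : set R) (s : R -> R) (nu : R -> set R -> \bar R)
    (I : R -> \bar R) : Prop :=
  [/\ good_rate_function E I,
      forall F : set R, closed F ->
        (limsup_pinfty (fun t => log_decay (s t) (nu t (F `&` E)))
         <= - ereal_inf [set I x | x in F `&` E])%E
    & forall G : set R, open G ->
        (- ereal_inf [set I x | x in G `&` E]
         <= liminf_pinfty (fun t => log_decay (s t) (nu t (G `&` E))))%E].

End large_deviations.

(* Main.v *)
(* Writing t = e^h and A(u) for the exponential functional of xi, the Lamperti
   clock of X at time t is the inverse of A at t / a, so that the clock exceeds
   y h exactly when A(y h) < e^h / a.  Upper bounds come from the Chernoff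
   inequality with exponent m: for m < 0 from the convexity of x^m, for m > 0
   from the maximal inequality for exp(m xi), sampled on dyadic grids.  The same
   two estimates, applied under the exponential tilt exp(m xi_S), show that for
   psi'(m) < 1/y (resp. > 1/y) the event {A(y h) < e^h / a} (resp. its
   complement) and the event {xi_S ~ psi'(m) S}, S = y h, have overwhelming
   tilted probability, which gives the Cramer lower bounds.  On Delta the
   equation psi'(m) = 1/y is solvable, and there the two bounds agree. *)
Require Import Defs.
From HB Require Import structures.
From mathcomp Require Import all_boot all_order all_algebra.
From mathcomp Require Import all_classical all_reals all_analysis.
From mathcomp Require Import measurable_realfun ring lra.
Import Order.TTheory GRing.Theory Num.Theory.
Import numFieldTopology.Exports numFieldNormedType.Exports.
Set Implicit Arguments.
Unset Strict Implicit.
Unset Printing Implicit Defensive.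
Local Open Scope classical_set_scope.
Local Open Scope ring_scope.

(** * Cadlag paths *)

(** The tilted law is never built as a measure: the tilted mass of [E] is the integral of exp(m
    xi_S) over [E], to be compared with the total exp(S psi(m)). Exceptional events are shown to
    carry at most a quarter of it, which replaces convergence in probability; tilt 0 gives the plain
    Chernoff bounds.

    The obstacle is that psi'(m) = 1/x may fail to be solvable at an end x of the closure of Delta,
    and that the tilted estimates need a strict inequality between y psi'(m) and 1. For fixed
    epsilon a window is governed by its end y nearest to the typical value 1/psi'(0). If that end is
    not x-dependent trivial (rate 0), it lies strictly between x and the typical value or at the
    latter, so psi'(m) = 1/y' is solved for some y' slightly beyond y, away from 1/psi'(0). The
    passage epsilon -> 0 then uses only monotonicity and lower semicontinuity of the rate, and
    nothing about x itself.

    Paths with bounded A give the clock a default value; they form a null set because psi is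
    negative somewhere to the left of 0. *)

Section right_continuity.
Context {R : realType}.

(** The process is the pointwise limit of its samples at the next point of a grid of mesh 1/(n+1),
    and each sample is constant in time on the cells of the grid. The [+ 1] in [q] puts the sampling
    point strictly to the right of [s], as [s^'+] excludes [s]. *)
Lemma measurable_uncurry_right_continuous d (T : measurableType d)
    (X : R -> T -> R) :
  (forall s, measurable_fun setT (X s)) ->
  (forall w s, X s' w @[s' --> s^'+] --> X s w) ->
  measurable_fun setT (fun p : R * T => X p.1 p.2).
Proof.
move=> mX rX.
pose q (n : nat) (k : int) : R := (k%:~R + 1) / n.+1%:R.
pose h (n : nat) (p : R * T) := X (q n (Num.floor (p.1 * n.+1%:R))) p.2.
have n0 n : 0 < n.+1%:R :> R by rewrite ltr0n.
apply: (@measurable_fun_cvg _ _ _ _ h).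
- move=> n _ B mB; rewrite setTI.
  have -> : h n @^-1` B = \bigcup_(k : int)
      (((fun s : R => s * n.+1%:R) @^-1` `[k%:~R, k%:~R + 1[) `*`
       (X (q n k) @^-1` B)).
    apply/seteqP; split=> [[s w]/= Bh|[s w] [k _] /= [ks Bh]].
      exists (Num.floor (s * n.+1%:R)) => //; split => //=.
      by rewrite in_itv/= -[X in _ < _ + X]/(1%:~R) -intrD floor_itv.
    rewrite /h/=; move: ks; rewrite in_itv/= -[X in _ < _ + X]/(1%:~R) -intrD.
    by move/floor_def => ->.
  apply: countable_bigcupT_measurable => // k; apply: measurableX.
    rewrite -[X in measurable X]setTI.
    have mf : measurable_fun setT (fun s : R => s * n.+1%:R).
      exact: measurable_funM.
    by apply: mf => //; exact: measurable_itv.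
  by rewrite -[X in measurable X]setTI; exact: mX.
- move=> [s w] _ /=.
  apply: (@cvg_comp _ _ _ (fun n => q n (Num.floor (s * n.+1%:R))) (X ^~ w)
     \oo (s^'+) _ _ (rX w s)).
  move=> A [e /= e0 eA].
  have := @near_infty_natSinv_lt R (PosNum e0); apply: filterS => n /= ne.
  have /andP[l1 l2] : (Num.floor (s * n.+1%:R))%:~R <= s * n.+1%:R <
     (Num.floor (s * n.+1%:R) + 1)%:~R by rewrite floor_itv.
  rewrite intrD in l2.
  have sq : s < q n (Num.floor (s * n.+1%:R)) by rewrite /q ltr_pdivlMr.
  apply: eA => //=; rewrite distrC gtr0_norm ?subr_gt0//.
  apply: le_lt_trans ne; rewrite lerBlDl /q mulrDl mul1r lerD2r.
  by rewrite ler_pdivrMr.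
Qed.

Lemma right_continuous_measurable (f : R -> R) :
  (forall s, f s' @[s' --> s^'+] --> f s) -> measurable_fun setT f.
Proof.
move=> rf.
have mf := @measurable_uncurry_right_continuous _ R (fun s _ => f s)
  (fun s => measurable_cst _) (fun _ => rf).
have mp : measurable_fun setT (fun s : R => (s, s)).
  exact: measurable_fun_pair.
exact: (measurableT_comp mf mp).
Qed.

Lemma nondecreasing_in_measurable (D : set R) (f : R -> R) : is_interval D ->
  (forall x y, D x -> D y -> x <= y -> f x <= f y) -> measurable_fun D f.
Proof.
move=> iD f_nd.
apply: (measurability (@RGenCInfty.G R)) => [|/= _ [_] [r] -> <-].
  exact: RGenCInfty.measurableE.
apply: is_interval_measurable => s t [Ds fs] [Dt ft] u /andP[su ut].
have Du : D u by apply: (iD s t) => //; rewrite su ut.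
split => //=; move: fs ft; rewrite /= !in_itv/= !andbT => fs ft.
by rewrite (le_trans fs)// f_nd.
Qed.

(* Extending a cadlag path by its value at 0 makes it right-continuous
   everywhere. *)
Lemma cadlag_max0 (w : R -> R) s : cadlag w ->
  (w \o Num.max 0) s' @[s' --> s^'+] --> (w \o Num.max 0) s.
Proof.
move=> [rw _]; have [s0|s0] := leP 0 s.
  rewrite [X in _ --> X](_ : _ = w s) /=; last by rewrite max_r.
  apply: cvg_trans (rw s s0); apply: near_eq_cvg; near=> x => /=.
  by rewrite max_r// (le_trans s0)//; near: x; exact: nbhs_right_ge.
rewrite [X in _ --> X](_ : _ = w 0) /=; last by rewrite max_l// ltW.
apply: cvg_near_cst; near=> x => /=.
by rewrite max_l//; near: x; exact: nbhs_right_le.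
Unshelve. all: by end_near. Qed.

Lemma cadlag_locally_bounded (w : R -> R) (x : R) : cadlag w -> 0 <= x ->
  exists M : R, \forall s \near x, 0 <= s -> `|w s| <= M.
Proof.
move=> [rw lw] x0.
have [e1 /= e10 r1] : \forall s \near x^'+, `|w s| <= `|w x| + 1.
  have /cvgrPdist_le/(_ _ ltr01) := rw _ x0; apply: filterS => s.
  by rewrite distrC -lerBlDl; apply: le_trans; exact: lerB_dist.
have [M [e2 /= e20 r2]] : exists M, \forall s \near x^'-, 0 <= s -> `|w s| <= M.
  move: x0; rewrite le_eqVlt => /predU1P[<-|x0].
    by exists 0; exists 1 => //= s _ s0 /le_lt_trans/(_ s0); rewrite ltxx.
  have /cvg_ex[l /cvgrPdist_le/(_ _ ltr01) H] := lw _ x0; exists (`|l| + 1).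
  apply: filterS H => s; rewrite distrC -lerBlDl => H _; apply: le_trans H.
  exact: lerB_dist.
exists (Num.max (`|w x| + 1) M); exists (Num.min e1 e2) => /=; first by rewrite lt_min e10.
move=> s /=; rewrite lt_min => /andP[s1 s2] s0.
rewrite le_max; have [->|sx] := eqVneq s x; first by rewrite lerDl ler01.
have [xs|xs] := ltP x s; first by rewrite r1.
by apply/orP; right; apply: r2 => //; rewrite lt_neqAle sx.
Qed.

(** Compactness of the segment, in its near-covering form with the bound [M] as a parameter tending
    to [+oo], makes the local bounds uniform. *)
Lemma cadlag_bounded (w : R -> R) t : cadlag w ->
  exists M, forall s, 0 <= s <= t -> `|w s| <= M.
Proof.
move=> cw.
have /compact_near_coveringP/near_covering_withinP/(_ R (pinfty_nbhs R)
  (fun M s => `|w s| <= M) _) := @segment_compact R 0 t.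
move=> H; suff [M [_ MP]] : \forall M \near pinfty_nbhs R, `[0, t] `<=` (fun s => `|w s| <= M).
  exists (M + 1) => s st; apply: (MP (M + 1)); first by rewrite ltrDl.
  by rewrite /= in_itv.
apply: H => x /=; rewrite in_itv/= => /andP[x0 _].
have [M Ms] := cadlag_locally_bounded cw x0.
exists ([set s | 0 <= s -> `|w s| <= M], [set N | M <= N]); first split => //.
  by apply: nbhs_pinfty_ge; exact: num_real.
move=> [s N] /= [sM MN]; rewrite in_itv/= => /andP[s0 _].
exact: le_trans (sM s0) MN.
Qed.

End right_continuity.

(** * Integrals over intervals and functions with vanishing right derivative *)

Section interval_integral.
Context {R : realType}.
Notation mu := (@lebesgue_measure R).
Implicit Types (f : R -> R) (u v c L : R).

Lemma bounded_itv_integrable f (i : interval R) c : (mu [set` i] < +oo)%E ->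
  measurable_fun [set` i] f -> (forall s, s \in i -> `|f s| <= c) ->
  mu.-integrable [set` i] (EFin \o f).
Proof.
move=> fi mf fb; apply: measurable_bounded_integrable => //.
exists c; split; first exact: num_real.
by move=> N cN s /= si; apply: le_trans (ltW cN); exact: fb.
Qed.

Lemma itvcc_finite u v : (mu `[u, v] < +oo)%E.
Proof. by rewrite lebesgue_measure_itv/=; case: ifPn => // _; rewrite -EFinB ltry. Qed.

Lemma itvoc_finite u v : (mu `]u, v] < +oo)%E.
Proof. by rewrite lebesgue_measure_itv/=; case: ifPn => // _; rewrite -EFinB ltry. Qed.

Lemma Rintegral_itvoc_cst u v c : u <= v ->
  \int[mu]_(s in `]u, v]) c = c * (v - u).
Proof.
move=> uv; rewrite Rintegral_cst//= lebesgue_measure_itv/= lte_fin.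
move: uv; rewrite le_eqVlt => /predU1P[->|->]; last by [].
by rewrite ltxx subrr.
Qed.

Lemma Rintegral_itv_diff_bounds f u v c1 c2 : 0 <= u <= v ->
  mu.-integrable `[0, v] (EFin \o f) ->
  (forall s, u < s <= v -> c1 <= f s <= c2) ->
  c1 * (v - u) <= \int[mu]_(s in `[0, v]) f s - \int[mu]_(s in `[0, u]) f s
    <= c2 * (v - u).
Proof.
move=> /andP[u0 uv] fi fb.
have E : `[0, v]%classic = `[0, u] `|` `]u, v] :> set R.
  by rewrite (@itv_bndbnd_setU _ _ _ (BRight u)) ?bnd_simp.
rewrite E Rintegral_setU//; last 2 first.
  by rewrite -E.
  apply/disj_set2P; rewrite -subset0 => s /=; rewrite !in_itv/=.
  by move=> [/andP[_ su] /andP[us _]]; move: (lt_le_trans us su); rewrite ltxx.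
have fi' : mu.-integrable `]u, v] (EFin \o f).
  by apply: integrableS fi => //; rewrite E; exact: subsetUr.
have ci c : mu.-integrable (`]u, v] : set R) (EFin \o cst c).
  apply: (@bounded_itv_integrable _ _ `|c|) => //; exact: itvoc_finite.
rewrite addrAC subrr add0r -!Rintegral_itvoc_cst//; apply/andP; split.
  by apply: le_Rintegral => //; [exact: ci|move=> s /=; rewrite in_itv/= => /fb/andP[]].
by apply: le_Rintegral => //; [exact: ci|move=> s /=; rewrite in_itv/= => /fb/andP[]].
Qed.

(** Cadlag paths yield right derivatives only, so the two-sided mean value theorem does not apply.
    For each slope [e] the bound [|G v| <= e * v] is pushed to the right up to [U]: the Lipschitz
    hypothesis carries it to the supremum of the good points, the right derivative carries it
    beyond. *)
Lemma right_derivative0_cst (G : R -> R) U L : 0 <= U -> 0 <= L -> G 0 = 0 ->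
  (forall u v, 0 <= u -> u <= v -> v <= U -> `|G v - G u| <= L * (v - u)) ->
  (forall u e, 0 <= u -> u < U -> 0 < e -> exists2 d, 0 < d &
    forall v, u < v -> v < u + d -> v <= U -> `|G v - G u| <= e * (v - u)) ->
  G U = 0.
Proof.
move=> U0 L0 G0 GL Gr.
suff H e : 0 < e -> `|G U| <= e * U.
  apply/eqP; rewrite -normr_le0; apply/ler_addgt0Pr => e e0; rewrite add0r.
  have U1 : 0 < U + 1 by rewrite ltr_pwDr.
  apply: le_trans (H (e / (U + 1)) _) _; first by rewrite divr_gt0.
  by rewrite -mulrA ger_pMr// mulrC ler_pdivrMr// mul1r lerDl.
move=> e0; pose S := [set u | 0 <= u <= U /\ forall v, 0 <= v <= u -> `|G v| <= e * v].
have S0 : S 0.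
  split; first by rewrite lexx.
  by move=> v; rewrite -eq_le => /eqP <-; rewrite G0 normr0 mulr0.
have Sub : has_ubound S by exists U => u [/andP[]].
have hS : has_sup S by split => //; exists 0.
set s := sup S.
have s0 : 0 <= s by apply: ub_le_sup.
have sU : s <= U by apply: ge_sup; [exists 0|move=> u [/andP[]]].
have below v : 0 <= v -> v < s -> `|G v| <= e * v.
  move=> v0 vs; have [u [_ Su] vu] := sup_gt (proj1 hS) vs.
  by apply: Su; rewrite v0 ltW.
have Gs : `|G s| <= e * s.
  apply/ler_addgt0Pr => h h0.
  have [->|sn0] := eqVneq s 0; first by rewrite G0 normr0 mulr0 add0r ltW.
  have sp : 0 < s by rewrite lt_neqAle eq_sym sn0.
  pose v := Num.max 0 (s - h / (L + 1)).
  have L1 : 0 < L + 1 by rewrite ltr_pwDr.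
  have vs : v < s by rewrite gt_max sp/= ltrBlDr ltrDl divr_gt0.
  have v0 : 0 <= v by rewrite le_max lexx.
  have -> : G s = G v + (G s - G v) by rewrite addrC subrK.
  apply: le_trans (ler_normD _ _) _; apply: lerD.
    by apply: le_trans (below _ v0 vs) _; rewrite ler_pM2l// ltW.
  apply: le_trans (GL _ _ v0 (ltW vs) sU) _.
  have : s - v <= h / (L + 1) by rewrite lerBlDr -lerBlDl le_max lexx orbT.
  rewrite ler_pdivlMr// => H; apply: le_trans H.
  by rewrite mulrC; apply: ler_wpM2l; [rewrite subr_ge0 ltW|rewrite lerDl ler01].
move: sU; rewrite le_eqVlt => /predU1P[<- //|sU].
have [d d0 Gd] := Gr _ _ s0 sU e0.
pose z := Num.min U (s + d / 2).
have sz : s < z by rewrite lt_min sU ltrDl divr_gt0.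
suff /(ub_le_sup Sub) : S z by rewrite leNgt sz.
split; first by rewrite (le_trans s0 (ltW sz)) ge_min lexx.
move=> v /andP[v0 vz]; have [vs|sv] := ltP v s; first exact: below.
move: sv; rewrite le_eqVlt => /predU1P[<- //|sv].
have -> : G v = G s + (G v - G s) by rewrite addrC subrK.
apply: le_trans (ler_normD _ _) _.
rewrite -[X in e * X](subrK s) [_ - s + s]addrC mulrDr; apply: lerD => //.
apply: Gd => //; last by apply: le_trans vz _; rewrite ge_min lexx.
apply: (le_lt_trans vz); apply: (@le_lt_trans _ _ (s + d / 2)).
  by rewrite ge_min lexx orbT.
by rewrite ltrD2l ltr_pdivrMr// ltr_pMr// ltr1n.
Qed.

End interval_integral.

(** * The exponential functional of a path and its inverse *)

Section path_functional.
Context {R : realType}.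
Notation mu := (@lebesgue_measure R).
Variable w : R -> R.
Hypothesis cw : cadlag w.

Lemma cadlag_measurable : measurable_fun (`[0, +oo[ : set R) w.
Proof.
have mw := right_continuous_measurable (fun s => @cadlag_max0 R w s cw).
apply: eq_measurable_fun; last exact: (measurable_funTS mw).
by move=> s; rewrite inE /= in_itv/= andbT => s0; rewrite max_r.
Qed.

Lemma cadlag_expR_measurable u v : 0 <= u ->
  measurable_fun (`[u, v] : set R) (fun s => expR (w s)).
Proof.
move=> u0; apply: measurableT_comp => //.
apply: measurable_funS cadlag_measurable => //.
by move=> s /=; rewrite !in_itv/= andbT => /andP[us _]; exact: le_trans us.
Qed.

Lemma cadlag_expR_integrable u v : 0 <= u ->
  mu.-integrable `[u, v] (EFin \o (fun s => expR (w s))).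
Proof.
move=> u0; have [M Mw] := cadlag_bounded v cw.
apply: (@bounded_itv_integrable _ _ _ (expR M)).
- exact: itvcc_finite.
- exact: cadlag_expR_measurable.
- move=> s /=; rewrite in_itv/= => /andP[us sv].
  rewrite gtr0_norm ?expR_gt0// ler_expR.
  by apply: le_trans (ler_norm _) (Mw _ _); rewrite sv (le_trans u0 us).
Qed.

Local Notation A := (exp_functional w).
Local Notation tau := (lamperti_time w).

Lemma exp_functional_diff c1 c2 u v : 0 <= u <= v ->
  (forall s, u < s <= v -> c1 <= w s <= c2) ->
  expR c1 * (v - u) <= A v - A u <= expR c2 * (v - u).
Proof.
move=> uv wb; apply: Rintegral_itv_diff_bounds => //.
  exact: cadlag_expR_integrable.
by move=> s /wb; rewrite !ler_expR.
Qed.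

Lemma exp_functional0 : A 0 = 0.
Proof.
by rewrite /exp_functional /Rintegral set_itv1 integral_set1.
Qed.

Lemma exp_functional_lt u v : 0 <= u -> u < v -> A u < A v.
Proof.
move=> u0 uv; have [M Mw] := cadlag_bounded v cw.
have /andP[+ _] : expR (- M) * (v - u) <= A v - A u <= expR M * (v - u).
  apply: exp_functional_diff; first by rewrite u0 ltW.
  move=> s /andP[us sv]; rewrite -ler_norml; apply: Mw.
  by rewrite sv andbT (le_trans u0)// ltW.
rewrite -subr_gt0; apply: lt_le_trans.
by rewrite mulr_gt0 ?expR_gt0// subr_gt0.
Qed.

Lemma exp_functional_le u v : 0 <= u -> u <= v -> A u <= A v.
Proof.
by move=> u0; rewrite le_eqVlt => /predU1P[->//|uv]; exact/ltW/exp_functional_lt.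
Qed.

Lemma exp_functional_lt_inv u v : 0 <= v -> A u < A v -> u < v.
Proof.
by move=> v0; apply: contraTlt => vu; rewrite -leNgt exp_functional_le.
Qed.

Lemma exp_functional_ivt r U : 0 <= U -> 0 <= r -> r <= A U ->
  exists2 u, 0 <= u <= U & A u = r.
Proof.
move=> U0 r0 rU; move: U0; rewrite le_eqVlt => /predU1P[U0|U0].
  move: rU; rewrite -U0 exp_functional0 => rU; exists 0; first by rewrite lexx.
  by rewrite exp_functional0; apply/eqP; rewrite eq_le r0 rU.
have [] := @IVT _ A 0 U r (ltW U0).
- exact: (@parameterized_integral_continuous R 0 U (fun s => expR (w s))
    (ltW U0) (cadlag_expR_integrable U (lexx 0))).
- rewrite exp_functional0 min_l ?max_r ?r0// -exp_functional0;
  exact/exp_functional_le/ltW.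
- by move=> u; rewrite in_itv/= => uU Au; exists u.
Qed.

Lemma lamperti_time_exp_functional u : 0 <= u -> tau (A u) = u.
Proof.
move=> u0; apply/eqP; rewrite eq_le; apply/andP; split.
  by apply: ge_inf => //; exists 0 => v [].
apply: lb_le_inf; first by exists u.
by move=> v [v0]; apply: contraTle => vu; rewrite -ltNge exp_functional_lt.
Qed.

Lemma lamperti_time_notin r : (forall u, 0 <= u -> A u < r) -> tau r = 0.
Proof.
move=> Ar; rewrite /lamperti_time (_ : [set u | _] = set0) ?inf0//.
by rewrite -subset0 => u [/Ar]; rewrite ltNge => /negP.
Qed.

Lemma lamperti_time_ge0 r : 0 <= tau r.
Proof.
have [[u [u0 ru]]|] := pselect (exists u, 0 <= u /\ r <= A u).
  by apply: lb_le_inf; [exists u|move=> v []].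
move=> H; rewrite lamperti_time_notin// => u u0; rewrite ltNge; apply/negP => ru.
by apply: H; exists u.
Qed.

Lemma lamperti_timeK r U : 0 <= U -> 0 <= r -> r <= A U ->
  A (tau r) = r /\ 0 <= tau r <= U.
Proof.
move=> U0 r0 rU; have [u uU <-] := exp_functional_ivt U0 r0 rU.
by case/andP: uU => u0 uU; rewrite lamperti_time_exp_functional// u0 uU.
Qed.

(** The second conjunct excludes the paths whose functional never reaches [r], where [tau r] takes
    the default value 0. By monotonicity integer times suffice, so that the condition is a countable
    union. *)
Lemma lt_lamperti_time y r : 0 <= y -> 0 <= r ->
  (y < tau r) = (A y < r) && `[< exists n : nat, r <= A n%:R >].
Proof.
move=> y0 r0; apply/idP/idP.
  move=> yr; have [[u [u0 ru]]|] := pselect (exists u, 0 <= u /\ r <= A u); last first.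
    move=> H; move: yr; rewrite lamperti_time_notin ?ltNge ?y0//.
    move=> u u0; rewrite ltNge; apply/negP => ru; apply: H; by exists u.
  have [tr /andP[t0 tu]] := lamperti_timeK u0 r0 ru.
  rewrite -{1}tr exp_functional_lt//=; apply/asboolP.
  exists (Num.truncn u).+1; apply: le_trans ru _.
  by apply: exp_functional_le => //; apply/ltW; exact: truncnS_gt.
move=> /andP[Ar /asboolP[n rn]].
have [tr /andP[t0 tu]] := lamperti_timeK (ler0n _ _) r0 rn.
by apply: exp_functional_lt_inv => //; rewrite tr.
Qed.

End path_functional.

(** * The Lamperti clock *)

Section clock.
Context {R : realType}.
Notation mu := (@lebesgue_measure R).
Variables (w : R -> R) (a : R).
Hypotheses (cw : cadlag w) (a0 : 0 < a).
Local Notation A := (exp_functional w).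
Local Notation tau := (lamperti_time w).
Let Y s := (lamperti a w s)^-1.

(** The map is monotone as long as the functional reaches the level, and drops to the default value
    0 afterwards; both regimes are intervals. *)
Lemma lamperti_time_measurable t :
  measurable_fun (`[0, t] : set R) (fun s => tau (s / a)).
Proof.
pose D1 := [set s | 0 <= s <= t /\ exists2 u, 0 <= u & s / a <= A u].
pose D2 := [set s | 0 <= s <= t /\ forall u, 0 <= u -> A u < s / a].
have E : `[0, t]%classic = D1 `|` D2.
  apply/seteqP; split => s /=; rewrite in_itv/=; last by case=> -[].
  move=> st; have [?|H] := pselect (exists2 u, 0 <= u & s / a <= A u); first by left.
  right; split => // u u0; rewrite ltNge; apply/negP => su; apply: H; by exists u.
have i1 : is_interval D1.
  move=> x y [/andP[x0 _] _] [/andP[_ yt] [u u0 yu]] z /andP[xz zy].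
  split; first by rewrite (le_trans x0)// (le_trans zy).
  by exists u => //; apply: le_trans yu; rewrite ler_pM2r ?invr_gt0.
have i2 : is_interval D2.
  move=> x y [/andP[x0 _] xu] [/andP[_ yt] _] z /andP[xz zy].
  split; first by rewrite (le_trans x0)// (le_trans zy).
  by move=> u /xu /lt_le_trans; apply; rewrite ler_pM2r ?invr_gt0.
rewrite E; apply/measurable_funU; [exact: is_interval_measurable..|split].
  apply: nondecreasing_in_measurable => // x y [/andP[x0 _] _] [/andP[y0 _] [u u0 yu]] xy.
  have ra z : 0 <= z -> 0 <= z / a by move=> z0; rewrite divr_ge0// ltW.
  have [ty /andP[ty0 _]] := lamperti_timeK cw u0 (ra _ y0) yu.
  have xya : x / a <= y / a by rewrite ler_pM2r ?invr_gt0.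
  have [tx /andP[tx0 _]] := lamperti_timeK cw u0 (ra _ x0) (le_trans xya yu).
  rewrite leNgt; apply/negP => /(exp_functional_lt cw ty0).
  by rewrite ty tx ltNge xya.
apply: (eq_measurable_fun (cst (0:R) : R -> R)); last exact: measurable_cst.
by move=> s; rewrite inE => -[_ H]; rewrite lamperti_time_notin.
Qed.

Lemma lamperti_inv_measurable t : measurable_fun (`[0, t] : set R) Y.
Proof.
have mw := right_continuous_measurable (fun s => @cadlag_max0 R w s cw).
have YE s : Y s = a^-1 * expR (- (w \o Num.max 0) (tau (s / a))).
  by rewrite /Y /lamperti invfM expRN/= max_r// lamperti_time_ge0.
rewrite (funext YE); apply: measurable_funM => //.
apply: measurableT_comp => //; apply: measurableT_comp => //.
by apply: (measurableT_comp mw); exact: lamperti_time_measurable.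
Qed.

Lemma lamperti_timeS u v s : 0 <= u <= v -> a * A u < s <= a * A v ->
  u < tau (s / a) <= v.
Proof.
move=> /andP[u0 uv] /andP[us sv].
have v0 := le_trans u0 uv.
have us' : A u < s / a by rewrite ltr_pdivlMr// mulrC.
have sv' : s / a <= A v by rewrite ler_pdivrMr// mulrC.
have sa0 : 0 <= s / a.
  by rewrite ltW// (le_lt_trans _ us')// -(exp_functional0 w) exp_functional_le.
have [ts /andP[t0 tv]] := lamperti_timeK cw v0 sa0 sv'; rewrite tv andbT.
by apply: (exp_functional_lt_inv cw) => //; rewrite ts.
Qed.

Lemma lamperti_inv_integrable U : 0 <= U ->
  mu.-integrable `[0, a * A U] (EFin \o Y).
Proof.
move=> U0; have [M Mw] := cadlag_bounded U cw.
apply: (@bounded_itv_integrable _ _ _ (a^-1 * expR M)).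
- exact: itvcc_finite.
- exact: lamperti_inv_measurable.
- move=> s; rewrite in_itv/= => /andP[s0 sU].
  rewrite /Y /lamperti invfM -expRN ger0_norm; last first.
    by rewrite mulr_ge0 ?expR_ge0// invr_ge0 ltW.
  rewrite ler_pM2l ?invr_gt0// ler_expR.
  have sA : s / a <= A U by rewrite ler_pdivrMr// mulrC.
  have sa0 : 0 <= s / a by rewrite divr_ge0// ltW.
  have [_ tU] := lamperti_timeK cw U0 sa0 sA.
  by apply: le_trans (Mw _ tU); rewrite -normrN ler_norm.
Qed.

Let F u := \int[mu]_(s in `[0, a * A u]) Y s.

(** The elapsed time [a * (A v - A u)] is proportional to exp of the path and the integrand to exp
    of minus the path. Where the path oscillates by at most [c2 - c1] the two factors cancel up to
    exp of that oscillation, which takes the place of a substitution rule. *)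
Lemma clock_diff u v c1 c2 : 0 <= u <= v ->
  (forall s, u < s <= v -> c1 <= w s <= c2) ->
  `|(F v - v) - (F u - u)| <= (expR (c2 - c1) - 1) * (v - u).
Proof.
move=> /[dup] uv /andP[u0 uv'] wb; have v0 := le_trans u0 uv'.
have Auv : 0 <= a * A u <= a * A v.
  rewrite ler_pM2l// exp_functional_le// andbT pmulr_rge0//.
  by rewrite -(exp_functional0 w) exp_functional_le.
have /andP[F1 F2] : a^-1 * expR (- c2) * (a * A v - a * A u) <= F v - F u
    <= a^-1 * expR (- c1) * (a * A v - a * A u).
  apply: Rintegral_itv_diff_bounds => //; first exact: lamperti_inv_integrable.
  move=> s /(lamperti_timeS uv)/wb/andP[w1 w2].
  by rewrite /Y /lamperti invfM -expRN !ler_pM2l ?invr_gt0// !ler_expR !lerN2 w1 w2.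
have /andP[A1 A2] := exp_functional_diff cw uv wb.
have e x : a^-1 * x * (a * A v - a * A u) = x * (A v - A u).
  by rewrite -mulrBr mulrACA mulVf ?gt_eqF// mul1r.
rewrite !e in F1 F2.
have d0 : 0 <= v - u by rewrite subr_ge0.
have F1' : expR (c1 - c2) * (v - u) <= F v - F u.
  by apply: le_trans F1; rewrite [c1 - c2]addrC expRD -mulrA ler_pM2l ?expR_gt0.
have F2' : F v - F u <= expR (c2 - c1) * (v - u).
  by apply: (le_trans F2); rewrite [c2 - c1]addrC expRD -mulrA ler_pM2l ?expR_gt0.
(* The deviation below 1 is dominated by the one above, so a single constant bounds both sides. *)
have x1 : 1 - expR (c1 - c2) <= expR (c2 - c1) - 1.
  have := @expR_gt0 R (c2 - c1); rewrite -[c1 - c2]opprB expRN.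
  set z := expR _ => z0; rewrite -subr_ge0.
  have -> : z - 1 - (1 - z^-1) = (z - 1) ^+ 2 / z by field; rewrite gt_eqF.
  by rewrite divr_ge0 ?sqr_ge0// ltW.
have := ler_wpM2r d0 x1; move: F1' F2' d0 {F1 F2 x1 A1 A2}.
move: (expR (c1 - c2)) (expR (c2 - c1)) (F v) (F u) => b c Fv Fu F1' F2' d0 H.
by rewrite ler_norml; apply/andP; split; lra.
Qed.

(** [F u - u] is Lipschitz because the path is bounded on [0, U], and has right derivative 0 because
    the path is right-continuous: both are instances of [clock_diff], with oscillation [2 * M] and
    an arbitrarily small one. *)
Lemma clock_exp_functional U : 0 <= U -> F U = U.
Proof.
move=> U0; have [M Mw] := cadlag_bounded U cw.
have M0 : 0 <= M by apply: le_trans (Mw 0 _); rewrite ?normr_ge0// lexx.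
apply/eqP; rewrite -subr_eq0; apply/eqP.
apply: (@right_derivative0_cst _ (fun u => F u - u) U (expR (M - - M) - 1)) => //.
- by rewrite subr_ge0 -expR0 ler_expR opprK addr_ge0.
- by rewrite /F exp_functional0 mulr0 /Rintegral set_itv1 integral_set1 subr0.
- move=> u v u0 uv vU; apply: clock_diff; first by rewrite u0.
  move=> s /andP[us sv]; rewrite -ler_norml; apply: Mw.
  by rewrite (le_trans sv vU) andbT (le_trans u0)// ltW.
- move=> u e u0 uU e0.
  have [x x0 xe] : exists2 x, 0 < x & expR (x + x) - 1 <= e.
    exists (ln (1 + e) / 2); first by rewrite divr_gt0// ln_gt0// ltrDl.
    by rewrite -splitr lnK ?posrE ?addr_gt0// addrAC subrr add0r.
  have /cvgrPdist_le/(_ _ x0)[d /= d0 H] := proj1 cw _ u0.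
  exists d => // v uv vd vU.
  have := @clock_diff u v (w u - x) (w u + x); rewrite u0 (ltW uv) => /(_ isT).
  have -> : w u + x - (w u - x) = x + x by ring.
  move=> K; apply: (le_trans (K _)).
    move=> s /andP[us sv]; have := H s; rewrite /= ltr0_norm ?subr_lt0// opprB.
    rewrite ltrBlDl (le_lt_trans sv vd) => /(_ isT us).
    by rewrite ler_norml => /andP[? ?]; apply/andP; split; lra.
  by rewrite ler_wpM2r// subr_ge0 ltW.
Qed.

(* If [A] stays below [t / a], both sides are 0: the left-hand integral
   diverges, and [tau] is the infimum of the empty set. *)
Lemma pssmp_clock_lamperti t : 0 <= t -> pssmp_clock (lamperti a w) t = tau (t / a).
Proof.
move=> t0; have ta0 : 0 <= t / a by rewrite divr_ge0// ltW.
have [[u u0 tu]|H] := pselect (exists2 u, 0 <= u & t / a <= A u).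
  have [tt /andP[tau0 _]] := lamperti_timeK cw u0 ta0 tu.
  rewrite -[RHS]clock_exp_functional// /F tt /pssmp_clock.
  by rewrite [a * _]mulrC divfK ?gt_eqF.
have Ht u : 0 <= u -> A u < t / a.
  by move=> u0; rewrite ltNge; apply/negP => tu; apply: H; exists u.
rewrite lamperti_time_notin// /pssmp_clock /Rintegral.
have Y0 s : (0 <= (Y s)%:E)%E.
  by rewrite lee_fin invr_ge0 mulr_ge0 ?expR_ge0// ltW.
rewrite (_ : (\int[mu]_(s in _) _)%E = +oo%E)//; apply/eqyP => M M0.
have n0 : 0 <= (Num.truncn M).+1%:R :> R by [].
apply: (@le_trans _ _ ((Num.truncn M).+1%:R%:E)); first by rewrite lee_fin ltW// truncnS_gt.
rewrite -(clock_exp_functional n0) /F /Rintegral fineK; last first.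
  by apply: integrable_fin_num => //; exact: lamperti_inv_integrable.
apply: ge0_subset_integral => //.
- by apply/measurable_EFinP; exact: lamperti_inv_measurable.
- move=> s; rewrite /= !in_itv/= => /andP[-> sn] /=; apply: (le_trans sn).
  by rewrite -ler_pdivlMl// mulrC ltW// Ht.
Qed.

End clock.

(** * The Laplace exponent *)

Section exponential_family.
Context {d} {T : measurableType d} {R : realType}.
Variables (P : probability T R) (X : {RV P >-> R}).
Local Notation M m := (\int[P]_w expR (m * X w)).
Local Notation fin m := (\int[P]_w (expR (m * X w))%:E < +oo)%E.

Lemma is_derive_expRM (c x : R) :
  is_derive x 1 (fun y : R => expR (y * c)) (c * expR (x * c)).
Proof.
apply: is_derive_eq.
by rewrite scaler0 add0r /GRing.scale/= mulr1 mulrC.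
Qed.

Lemma measurable_expRM (m : R) : measurable_fun setT (fun w => expR (m * X w)).
Proof. by apply: measurableT_comp => //; exact: measurable_funM. Qed.

Lemma integrable_expRM (m : R) : fin m ->
  P.-integrable setT (EFin \o (fun w => expR (m * X w))).
Proof.
move=> mfin; apply/integrableP; split.
  by apply/measurable_EFinP; exact: measurable_expRM.
by under eq_integral do rewrite /= ger0_norm ?expR_ge0//.
Qed.

(** The domination, uniform in [x], for differentiating under the expectation. Since
    [r * |X0| <= expR (r * |X0|)], the factor [|X0|] costs a further [r] in the exponent, hence the
    moments of orders up to [2 * r] from [m] in what follows. *)
Lemma norm_expRM_le (x m r X0 : R) : 0 < r -> m - r <= x <= m + r ->
  `|X0| * expR (x * X0) <=
  r^-1 * (expR ((m + r + r) * X0) + expR ((m - r - r) * X0)).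
Proof.
move=> r0 /andP[x1 x2]; rewrite mulrC ler_pdivlMl// mulrCA mulrC.
have H : r * `|X0| <= expR (r * `|X0|).
  by apply: le_trans (expR_ge1Dx _); rewrite lerDr.
apply: (@le_trans _ _ (expR (r * `|X0|) * expR (x * X0))).
  by rewrite ler_wpM2r ?expR_ge0.
rewrite -expRD; have [X1|X1] := leP 0 X0.
  rewrite ger0_norm// ler_wpDr ?expR_ge0// ler_expR -mulrDl ler_wpM2r//; lra.
rewrite ltr0_norm// ler_wpDl ?expR_ge0// ler_expR mulrN -mulNr -mulrDl.
by apply: ler_wnM2r; [exact: ltW|lra].
Qed.

Let G (m r : R) w :=
  r^-1 * (expR ((m + r + r) * X w) + expR ((m - r - r) * X w)).

Let G_integrable (m r : R) : 0 < r ->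
  (forall x : R, m - 2 * r <= x <= m + 2 * r -> fin x) ->
  P.-integrable setT (EFin \o G m r).
Proof.
move=> r0 rfin; rewrite /G (_ : _ \o _ = (fun w => (r^-1)%:E * ((EFin \o (fun w => expR ((m + r + r) * X w))) w
  + (EFin \o (fun w => expR ((m - r - r) * X w))) w))%E); last first.
  by apply/funext => w.
apply: integrableZl => //; apply: integrableD => //.
  apply: integrable_expRM; apply: rfin. lra.
by apply: integrable_expRM; apply: rfin; lra.
Qed.

Lemma integrable_XexpRM (m r : R) : 0 < r ->
  (forall x : R, m - 2 * r <= x <= m + 2 * r -> fin x) ->
  P.-integrable setT (EFin \o (fun w => X w * expR (m * X w))).
Proof.
move=> r0 rfin; apply: le_integrable (G_integrable r0 rfin) => //.
  by apply/measurable_EFinP; apply: measurable_funM => //; exact: measurable_expRM.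
move=> w _ /=; rewrite lee_fin normrM (ger0_norm (expR_ge0 _)).
apply: le_trans (ler_norm _); apply: norm_expRM_le => //; lra.
Qed.

Lemma is_derive_mgf (m r : R) : 0 < r ->
  (forall x : R, m - 2 * r <= x <= m + 2 * r -> fin x) ->
  is_derive m 1 (fun x => M x) (\int[P]_w (X w * expR (m * X w))).
Proof.
move=> r0 rfin.
pose f x w := expR (x * X w).
have pf x w : partial1of2 f x w = X w * expR (x * X w).
  rewrite partial1of2E; have := @is_derive_expRM (X w) x.
  by move/@derive_val.
have Im : `]m - r, m + r[%classic m by rewrite /= in_itv/=; lra.
have intf x : `]m - r, m + r[%classic x -> P.-integrable setT (EFin \o f x).
  rewrite /= in_itv/= => xr; apply: integrable_expRM; apply: rfin; lra.
have df x w : `]m - r, m + r[%classic x -> setT w -> derivable (f ^~ w) x 1.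
  by move=> _ _; have := @is_derive_expRM (X w) x; move/@ex_derive.
have G0 w : 0 <= G m r w by rewrite mulr_ge0 ?invr_ge0 ?addr_ge0 ?expR_ge0// ltW.
have fG x w : `]m - r, m + r[%classic x -> setT w -> `|partial1of2 f x w| <= G m r w.
  rewrite /= in_itv/= => xr _; rewrite pf normrM (ger0_norm (expR_ge0 _)).
  apply: norm_expRM_le => //; lra.
apply: DeriveDef.
  exact: (derivable_under_integral measurableT Im intf df G0 (G_integrable r0 rfin) fG).
rewrite -derive1E (differentiation_under_integral measurableT Im intf df G0 (G_integrable r0 rfin) fG).
by apply: eq_Rintegral => w _; rewrite pf.
Qed.

(* Jensen's inequality under the exponentially tilted measure, in the form of
   the pointwise bound [expR (c + y) >= expR c * (1 + y)]. *)
Lemma mgf_tangent (m r x : R) : 0 < r ->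
  (forall x : R, m - 2 * r <= x <= m + 2 * r -> fin x) -> fin x -> 0 < M m ->
  M m * expR ((x - m) * (\int[P]_w (X w * expR (m * X w)) / M m)) <= M x.
Proof.
move=> r0 rfin xfin M0; set N := \int[P]_w (X w * _); set c := (x - m) * _.
have mfin : fin m by apply: rfin; lra.
have im := integrable_expRM mfin.
have iX := integrable_XexpRM r0 rfin.
have iZ (k : R) (g : T -> R) : P.-integrable setT (EFin \o g) ->
    P.-integrable setT (EFin \o (fun w => k * g w)).
  by move=> ig; have := integrableZl measurableT k ig.
have iD (g h : T -> R) : P.-integrable setT (EFin \o g) ->
    P.-integrable setT (EFin \o h) -> P.-integrable setT (EFin \o (fun w => g w + h w)).
  by move=> ig ih; have := integrableD measurableT ig ih.
have i1 := iZ (expR c * (1 - c)) _ im.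
have i2 := iZ (expR c * (x - m)) _ iX.
have -> : M m * expR c = \int[P]_w (expR c * (1 - c) * expR (m * X w) +
    expR c * (x - m) * (X w * expR (m * X w))).
  rewrite RintegralD// RintegralZl// RintegralZl// -/N.
  have -> : expR c * (x - m) * N = expR c * c * M m.
    by rewrite /c; field; rewrite gt_eqF.
  ring.
apply: le_Rintegral => //; [exact: iD|exact: integrable_expRM|].
move=> w _.
have -> : x * X w = m * X w + (c + ((x - m) * X w - c)) by ring.
rewrite expRD (expRD c); have := expR_ge1Dx ((x - m) * X w - c).
have := expR_gt0 c; have := expR_gt0 (m * X w).
set u := expR _; set v := expR c; set z := expR _ => u0 v0 H.
have -> : v * (1 - c) * u + v * (x - m) * (X w * u) =
  u * (v * (1 + ((x - m) * X w - c))) by ring.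
by rewrite !ler_pM2l.
Qed.

End exponential_family.

Lemma integral_expR_gt0 d (T : measurableType d) (R : realType)
    (P : probability T R) (Z : T -> R) : measurable_fun setT Z ->
  (0 < \int[P]_w (expR (Z w))%:E)%E.
Proof.
move=> mZ; rewrite lt_neqAle integral_ge0 ?andbT; last first.
  by move=> w _; rewrite lee_fin expR_ge0.
apply/eqP => I0.
have mf : measurable_fun setT (fun w => (expR (Z w))%:E).
  by apply/measurable_EFinP; exact: measurableT_comp.
have /(ae_eq_integral_abs P measurableT mf) H :
    (\int[P]_w `|(expR (Z w))%:E| = 0)%E.
  by rewrite I0; apply: eq_integral => w _; rewrite gee0_abs// lee_fin expR_ge0.
have PF : ProperFilter (almost_everywhere P).
  have PT : (0 < P setT)%E by rewrite probability_setT.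
  exact: ae_properfilter_algebraOfSetsType PT.
suff /filter_ex[w] : {ae P, forall w : T, False} by [].
by apply: filterS H => w /(_ I) [] /eqP; rewrite gt_eqF// expR_gt0.
Qed.

Section laplace_exponent_theory.
Context {d} {T : measurableType d} {R : realType}.
Variables (P : probability T R) (xi : R -> {RV P >-> R}) (psi : R -> \bar R).
Hypothesis hpsi : laplace_exponent xi psi.
Local Notation p := (fine \o psi).
Local Notation M m := (\int[P]_w expR (m * xi 1 w)).

Lemma laplace_exponentE (m t : R) : 0 <= t ->
  (\int[P]_w (expR (m * xi t w))%:E = expeR (t%:E * psi m))%E.
Proof. by move=> t0; rewrite -hpsi// unlock. Qed.

Lemma laplace_exponent_fin (m : R) : (psi m < +oo)%E -> psi m \is a fin_num.
Proof.
move=> my; rewrite fin_numE; apply/andP; split; last by rewrite lt_eqF.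
apply/eqP => mNy.
have mX : measurable_fun setT (fun w => m * xi 1 w) by exact: measurable_funM.
have := integral_expR_gt0 P mX; rewrite laplace_exponentE//.
by rewrite mul1e mNy /= ltxx.
Qed.

Lemma dom_fin (m : R) : dom psi m -> psi m = (p m)%:E.
Proof. by move=> /interior_subset /laplace_exponent_fin /fineK. Qed.

Lemma exponential_moment (m t : R) : dom psi m -> 0 <= t ->
  (\int[P]_w (expR (m * xi t w))%:E = (expR (t * p m))%:E)%E.
Proof. by move=> md t0; rewrite laplace_exponentE// dom_fin. Qed.

Lemma laplace_exponent0 : psi 0 = 0%E.
Proof.
have := @laplace_exponentE 0 1 ler01.
under eq_integral do rewrite mul0r expR0.
rewrite integral_cst//= mul1e [P setT]probability_setT mul1e -expeR0.
by move/expeR_inj.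
Qed.

(* At points where [psi] is infinite both sides are 0, by the junk values
   [fine +oo = 0] and [ln 0 = 0]. *)
Lemma laplace_exponent_ln (m : R) : p m = ln (M m).
Proof.
rewrite /Rintegral laplace_exponentE// mul1e/=.
by case: (psi m) => [r| |] /=; rewrite ?expRK// ln0.
Qed.

Lemma dom_near (m : R) : dom psi m ->
  exists2 r : R, 0 < r & forall x : R, m - 2 * r <= x <= m + 2 * r -> dom psi x.
Proof.
move=> md; have : nbhs m (dom psi) by exact: open_nbhs_nbhs (conj (@open_interior _ _) md).
move=> [e /= e0 H]; exists (e / 3); first by rewrite divr_gt0.
by move=> x xr; apply: H; rewrite /= ltr_norml; apply/andP; split; lra.
Qed.

Let dom_moment (x : R) : dom psi x -> (\int[P]_w (expR (x * xi 1 w))%:E < +oo)%E.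
Proof. by move=> xd; rewrite exponential_moment// ltry. Qed.

Let mgfE (m : R) : dom psi m -> M m = expR (p m).
Proof. by move=> md; rewrite /Rintegral exponential_moment//= mul1r. Qed.

Let laplace_derive (m : R) : dom psi m ->
  is_derive m 1 p (\int[P]_w (xi 1 w * expR (m * xi 1 w)) / M m).
Proof.
move=> md; have [r r0 rd] := dom_near md.
have M0 : 0 < M m by rewrite mgfE// expR_gt0.
rewrite (_ : p = @ln R \o (fun x => M x)); last first.
  by apply/funext => x; exact: laplace_exponent_ln.
have dM := is_derive_mgf r0 (fun x xr => dom_moment (rd x xr)).
have dl := is_derive1_ln M0.
have := @is_derive1_comp _ (@ln R) (fun x => M x) m _ _ dl dM.
by rewrite [_^-1 * _]mulrC.
Qed.

Lemma dpsiE (m : R) : dom psi m ->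
  dpsi psi m = \int[P]_w (xi 1 w * expR (m * xi 1 w)) / M m.
Proof.
by move=> md; have H := laplace_derive md; rewrite /dpsi derive1E derive_val.
Qed.

Lemma laplace_exponent_is_derive (m : R) : dom psi m ->
  is_derive m 1 p (dpsi psi m).
Proof. by move=> md; rewrite dpsiE//; exact: laplace_derive. Qed.

(** The form in which convexity of the exponent is used throughout: the logarithm of
    [mgf_tangent]. *)
Lemma laplace_exponent_tangent (x m : R) : dom psi x -> dom psi m ->
  p m + dpsi psi m * (x - m) <= p x.
Proof.
move=> xd md; have [r r0 rd] := dom_near md.
have M0 : 0 < M m by rewrite mgfE// expR_gt0.
have := mgf_tangent r0 (fun x xr => dom_moment (rd x xr)) (dom_moment xd) M0.
by rewrite -dpsiE// [M x]mgfE// [M m]mgfE// -expRD ler_expR mulrC.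
Qed.

Lemma dpsi_nondecreasing (x y : R) : dom psi x -> dom psi y -> x <= y ->
  dpsi psi x <= dpsi psi y.
Proof.
move=> xd yd; rewrite le_eqVlt => /predU1P[->//|xy].
have := laplace_exponent_tangent xd yd; have := laplace_exponent_tangent yd xd.
move: (p x) (p y) (dpsi psi x) (dpsi psi y) => a b c e h1 h2.
have : (c - e) * (y - x) <= 0 by lra.
by rewrite pmulr_lle0 ?subr_gt0// subr_le0.
Qed.

(* [z] is obtained as a maximizer of [y * z - psi z] over [x1, x2]. *)
Lemma dpsi_ivt (x1 x2 y : R) : x1 <= x2 ->
  (forall z : R, x1 <= z <= x2 -> dom psi z) ->
  dpsi psi x1 < y -> y < dpsi psi x2 ->
  exists2 z, x1 < z < x2 & dpsi psi z = y.
Proof.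
move=> x12 xd y1 y2.
pose f (z : R) := y * z - p z.
have d1 : dom psi x1 by apply: xd; rewrite lexx.
have d2 : dom psi x2 by apply: xd; rewrite lexx andbT.
have [r1 r10 rd1] := dom_near d1; have [r2 r20 rd2] := dom_near d2.
have xd' (z : R) : x1 - r1 < z < x2 + r2 -> dom psi z.
  move=> /andP[z1 z2]; have [zx1|x1z] := leP z x1; first by apply: rd1; lra.
  have [zx2|x2z] := leP z x2; first by apply: xd; lra.
  by apply: rd2; lra.
have df (z : R) : x1 - r1 < z < x2 + r2 -> is_derive z 1 f (y - dpsi psi z).
  move=> zx; have dp := laplace_exponent_is_derive (xd' _ zx).
  have di : is_derive z 1 (fun z : R => y * z) y.
    by apply: is_derive_eq; rewrite /GRing.scale/= mulr1.
  exact: is_deriveB.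
have cf : {within `[x1, x2], continuous f}.
  apply: derivable_within_continuous => z; rewrite in_itv/= => zx.
  have /df : x1 - r1 < z < x2 + r2 by lra.
  by move/@ex_derive.
have [c] := EVT_max x12 cf; rewrite in_itv/= => /[dup] cx /andP[c1 c2] cmax.
have cr : x1 - r1 < c < x2 + r2 by lra.
(* Beyond [x1] and [x2] the tangents there, of slopes below and above [y], show that [f] does not
   exceed its values at these points. So [c] is a maximum on an open interval, and the derivative
   vanishes even should [c] be an endpoint. *)
have cmax' (z : R) : x1 - r1 < z < x2 + r2 -> f z <= f c.
  move=> /[dup] zr /andP[z1 z2]; have zd := xd' _ zr.
  have f1 : f x1 <= f c by apply: cmax; rewrite in_itv/= lexx.
  have f2 : f x2 <= f c by apply: cmax; rewrite in_itv/= lexx andbT.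
  have := laplace_exponent_tangent zd d1; have := laplace_exponent_tangent zd d2.
  move: f1 f2; rewrite /f; have [zx1|x1z] := leP z x1; first by move=> *; nra.
  have [zx2|x2z] := leP z x2; last by move=> *; nra.
  by move=> _ _ _ _; apply: cmax; rewrite in_itv/= zx2 ltW.
have r12 : x1 - r1 <= x2 + r2 by lra.
have D0 : is_derive c 1 f 0.
  apply: (derive1_at_max r12) => [z||z]; rewrite in_itv/=.
  - by move/df/@ex_derive.
  - by [].
  - exact: cmax'.
have Dc : y = dpsi psi c.
  apply/eqP; rewrite -subr_eq0; have := df _ cr => D1.
  by rewrite -(@derive_val _ _ _ _ _ _ _ D1) (@derive_val _ _ _ _ _ _ _ D0).
exists c => //; rewrite !lt_neqAle c1 c2 !andbT; apply/andP; split.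
  by apply: contraTneq y1 => ->; rewrite -Dc ltxx.
by apply: contraTneq y2 => <-; rewrite -Dc ltxx.
Qed.

End laplace_exponent_theory.

(** * Independence of increments *)

Section independent_product.
Context {d} {T : measurableType d} {R : realType}.
Variable P : probability T R.

Lemma independent_integralM (f g : {mfun T >-> R}) :
  (forall w, 0 <= f w) -> (forall w, 0 <= g w) ->
  (forall A B : set R, measurable A -> measurable B ->
    P (f @^-1` A `&` g @^-1` B) = P (f @^-1` A) * P (g @^-1` B))%E ->
  (\int[P]_w (f w * g w)%:E = \int[P]_w (f w)%:E * \int[P]_w (g w)%:E)%E.
Proof.
move=> f0 g0 fg.
have mh : measurable_fun setT (fun w => (f w, g w)).
  by apply: measurable_fun_pair => //.
pose h0 := isMeasurableFun.Build _ _ _ _ _ mh.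
pose h : {mfun T >-> (R * R)%type} := HB.pack (fun w => (f w, g w)) h0.
(* Absolute values make the integrand nonnegative on the whole plane, as Tonelli requires, and
   change nothing on the range of (f, g). *)
pose F (z : R * R) := (`|z.1| * `|z.2|)%:E.
have mF : measurable_fun setT F.
  apply/measurable_EFinP; apply: measurable_funM; apply: measurableT_comp => //.
have F0 z : (0 <= F z)%E by rewrite lee_fin mulr_ge0.
have mabs : measurable_fun setT (fun x : R => `|x|%:E).
  by apply/measurable_EFinP; exact: normr_measurable.
have E1 : (\int[P]_w (f w * g w)%:E = \int[distribution P h]_z F z)%E.
  rewrite ge0_integral_distribution//; apply: eq_integral => w _ /=.
  by rewrite /F/= !ger0_norm.
have E2 : (\int[distribution P h]_z F z =
    \int[(distribution P f \x distribution P g)%E]_z F z)%E.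
  apply/esym/eq_measure_integral => /= A mA _.
  have H := (product_measure_unique (m1 := distribution P f) (m2 := distribution P g) (m' := distribution P h) fg mA).
  exact H.
have E3 x : (\int[distribution P g]_y F (x, y) =
    `|x|%:E * \int[distribution P g]_y `|y|%:E)%E.
  by rewrite -ge0_integralZl.
rewrite E1 E2 fubini_tonelli1// /fubini_F/=.
under eq_integral do rewrite E3.
rewrite ge0_integralZr//; last by apply: integral_ge0 => y _; rewrite lee_fin.
by rewrite !ge0_integral_distribution//; congr (_ * _)%E;
  apply: eq_integral => w _ /=; rewrite ger0_norm.
Qed.

End independent_product.

(** * The filtration along a time grid and the Markov property *)

Section levy_filtration.
Context {d} {T : measurableType d} {R : realType}.
Variables (P : probability T R) (xi : R -> {RV P >-> R}).
Hypothesis hxi : levy_from_zero xi.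
Variable s : nat -> R.
Hypotheses (s0 : s 0%N = 0) (s_nd : forall i, s i <= s i.+1).

Local Notation D i := (increment xi (s i) (s i.+1)).

(** A pi-system generating the natural filtration of the sampled process at [s k]: since the grid
    starts at 0, the first [k] increments determine [xi (s j)] for [j <= k]. *)
Definition cylinder (k : nat) : set (set T) :=
  [set F | exists2 B : nat -> set R, (forall i, measurable (B i)) &
     F = \bigcap_(i < k) (D i @^-1` B i)].

Lemma increment_measurable u v : measurable_fun setT (increment xi u v).
Proof. exact: measurable_funB. Qed.

Let mD k (B : set R) : measurable B -> measurable (D k @^-1` B).
Proof.
by move=> mB; rewrite -[X in measurable X]setTI; exact: increment_measurable.
Qed.

Lemma cylinder_measurable k : cylinder k `<=` d.-measurable.
Proof.
move=> F [B mB ->]; apply: bigcap_measurableType => i _; exact: mD.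
Qed.

Lemma cylinderT k : cylinder k setT.
Proof.
by exists (fun=> setT) => //; apply/seteqP; split.
Qed.

Lemma cylinderI k : setI_closed (cylinder k).
Proof.
move=> F F' [B mB ->] [B' mB' ->].
exists (fun i => B i `&` B' i) => [i|]; first exact: measurableI.
by rewrite -bigcapI.
Qed.

Lemma sigma_cylinder_measurable k : <<s cylinder k>> `<=` d.-measurable.
Proof.
apply: smallest_sub; first exact: sigma_algebra_measurable.
exact: cylinder_measurable.
Qed.

Lemma cylinder_increment_indep k F (B : set R) : cylinder k F -> measurable B ->
  P (F `&` D k @^-1` B) = (P F * P (D k @^-1` B))%E.
Proof.
have [_ _ ind _] := hxi.
move=> [B0 mB0 ->] mB.
have s00 : 0 <= s 0%N by rewrite s0.
pose B1 i := if (i < k)%N then B0 i else B.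
have mB1 i : measurable (B1 i) by rewrite /B1; case: ifPn.
have := ind k.+1 s B1 s00 s_nd mB1.
rewrite big_ord_recr /= bigcap_mkord big_ord_recr/= {2}/B1 {3}/B1 ltnn.
rewrite -(bigcap_mkord k (fun i => D i @^-1` B1 i)).
have E1 : \bigcap_(i < k) (D i @^-1` B1 i) = \bigcap_(i < k) (D i @^-1` B0 i).
  by apply: eq_bigcapr => i /=; rewrite /B1 => ->.
rewrite E1 => ->; congr (_ * _)%E.
rewrite (ind k s B0 s00 s_nd mB0); apply: eq_bigr => i _.
by rewrite /B1 ltn_ord.
Qed.

(** As functions of [E], both sides are finite measures, a restriction and a multiple of [P], that
    agree on the pi-system of cylinders. *)
Lemma sigma_cylinder_increment_indep k E (B : set R) :
  <<s cylinder k>> E -> measurable B ->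
  P (E `&` D k @^-1` B) = (P E * P (D k @^-1` B))%E.
Proof.
move=> sE mB; have mDB := mD k mB.
have x0 : 0 <= fine (P (D k @^-1` B)) by rewrite fine_ge0.
have PE : P (D k @^-1` B) = (fine (P (D k @^-1` B)))%:E.
  by rewrite fineK// fin_num_measure.
transitivity (mrestr P mDB E) => //.
transitivity (mscale (NngNum x0) P E); last first.
  by rewrite /mscale/= [in RHS]PE muleC.
apply: (g_sigma_algebra_measure_unique (cylinder k) _ (fun=> setT)) sE => //.
- exact: cylinder_measurable.
- by move=> i; exact: cylinderT.
- by rewrite bigcup_const.
- exact: cylinderI.
- move=> F GF; rewrite /mscale/= /mrestr cylinder_increment_indep// [in LHS]PE.
  by rewrite muleC.
- by move=> i; rewrite /= /mrestr setTI (le_lt_trans (probability_le1 _ _))// ltry.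
Qed.

Let Gt k := g_sigma_algebraType (cylinder k).

Lemma increment_adapted k i : (i < k)%N ->
  measurable_fun (setT : set (Gt k)) (D i : Gt k -> R).
Proof.
move=> ik _ B mB; rewrite setTI; apply: sub_sigma_algebra.
exists (fun j => if j == i then B else setT) => [j|]; first by case: ifPn.
apply/seteqP; split => w /= => [Bw j jk|].
  by have [->|] := eqVneq j i.
by move=> /(_ i ik); rewrite /= eqxx.
Qed.

Lemma levy_sum w n : xi (s n) w = \sum_(i < n) D i w.
Proof.
have [x0 _ _ _] := hxi.
elim: n => [|n IH]; first by rewrite big_ord0 s0 x0.
by rewrite big_ord_recr /= -IH /increment addrC subrK.
Qed.

Lemma levy_adapted k j : (j <= k)%N ->
  measurable_fun (setT : set (Gt k)) (xi (s j) : Gt k -> R).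
Proof.
move=> jk; rewrite (_ : (xi (s j) : T -> R) = fun w => \sum_(i < j) D i w); last first.
  by apply/funext => w; rewrite levy_sum.
apply: measurable_sum => i; apply: increment_adapted.
exact: leq_trans jk.
Qed.

Variable psi : R -> \bar R.
Hypothesis hpsi : laplace_exponent xi psi.
Local Notation p := (fine \o psi).

Lemma increment_moment (m u v : R) : dom psi m -> 0 <= u -> u <= v ->
  (\int[P]_w (expR (m * increment xi u v w))%:E = (expR ((v - u) * p m))%:E)%E.
Proof.
move=> md u0 uv; have [x0 _ _ st] := hxi.
have uv0 : 0 <= v - u by rewrite subr_ge0.
rewrite -(exponential_moment hpsi md uv0).
pose D1 : {mfun T >-> R} := HB.pack (increment xi u v)
  (isMeasurableFun.Build _ _ _ _ _ (increment_measurable u v)).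
have mf : measurable_fun setT (fun x : R => (expR (m * x))%:E).
  by apply/measurable_EFinP; apply: measurableT_comp => //; exact: measurable_funM.
have f0 (x : R) : (0 <= (expR (m * x))%:E)%E by rewrite lee_fin expR_ge0.
have := ge0_integral_distribution D1 mf f0; rewrite /comp/= => <-.
have := ge0_integral_distribution (xi (v - u)) mf f0; rewrite /comp/= => <-.
apply: eq_measure_integral => B mB _.
transitivity (P (increment xi 0 (v - u) @^-1` B)); first exact: st.
by congr (P _); apply/seteqP; split => w /=; rewrite /increment x0 subr0.
Qed.

(** The indicator of the past event [E] is absorbed into the factor depending on the past, so that
    the independence of two nonnegative variables suffices and no conditional expectation occurs. *)
Lemma levy_markov k (E : set T) (q m : R) : dom psi m -> <<s cylinder k>> E ->
  (\int[P]_(w in E) (expR (q * xi (s k) w + m * D k w))%:E =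
   \int[P]_(w in E) (expR (q * xi (s k) w))%:E
     * (expR ((s k.+1 - s k) * p m))%:E)%E.
Proof.
move=> md sE; have mE := sigma_cylinder_measurable sE.
have sk0 : 0 <= s k by rewrite -s0; elim: (k) => // n /le_trans; apply.
rewrite -increment_moment//.
pose f w := expR (q * xi (s k) w) * \1_E w.
pose g w := expR (m * D k w).
have fG : measurable_fun (setT : set (Gt k)) (f : Gt k -> R).
  apply: measurable_funM.
    by apply: measurableT_comp => //; apply: measurable_funM => //; exact: levy_adapted.
  exact: measurable_indic.
have mf : measurable_fun setT f.
  apply: measurable_funM; last exact: measurable_indic.
  by apply: measurableT_comp => //; exact: measurable_funM.
have mg : measurable_fun setT g.
  apply: measurableT_comp => //; apply: measurable_funM => //.
  exact: increment_measurable.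
pose f1 : {mfun T >-> R} := HB.pack f (isMeasurableFun.Build _ _ _ _ _ mf).
pose g1 : {mfun T >-> R} := HB.pack g (isMeasurableFun.Build _ _ _ _ _ mg).
have f0 w : 0 <= f1 w by rewrite mulr_ge0 ?expR_ge0.
have g0 w : 0 <= g1 w by rewrite expR_ge0.
have fg (A B : set R) : measurable A -> measurable B ->
    P (f1 @^-1` A `&` g1 @^-1` B) = (P (f1 @^-1` A) * P (g1 @^-1` B))%E.
  move=> mA mB.
  have mB' : measurable ((fun x : R => expR (m * x)) @^-1` B).
    rewrite -[X in measurable X]setTI.
    have me : measurable_fun setT (fun x : R => expR (m * x)).
      by apply: measurableT_comp => //; exact: measurable_funM.
    exact: me.
  have sA : <<s cylinder k>> (f @^-1` A).
    by have := fG measurableT _ mA; rewrite setTI.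
  exact: sigma_cylinder_increment_indep sA mB'.
have := independent_integralM f0 g0 fg; rewrite /f1 /g1 /= /f /g => H.
transitivity (\int[P]_w (expR (q * xi (s k) w) * \1_E w * expR (m * D k w))%:E)%E.
  rewrite integral_mkcond; apply: eq_integral => w _.
  rewrite patchE indicE; case: ifPn => _; rewrite ?mulr1 ?mulr0 ?mul0r//.
  by rewrite expRD.
rewrite H; congr (_ * _)%E.
rewrite [RHS]integral_mkcond; apply: eq_integral => w _.
by rewrite patchE indicE; case: ifPn => _; rewrite ?mulr1 ?mulr0.
Qed.

End levy_filtration.

(** * Maximal inequality *)

Section maximal_inequality.
Context {d} {T : measurableType d} {R : realType}.
Variables (P : probability T R) (xi : R -> {RV P >-> R}).
Hypothesis hxi : levy_from_zero xi.
Variable psi : R -> \bar R.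
Hypothesis hpsi : laplace_exponent xi psi.
Local Notation p := (fine \o psi).

Let mexp (m t : R) D : measurable_fun D (fun w => (expR (m * xi t w))%:E).
Proof. by apply: measurable_funTS; apply/measurable_EFinP; exact: measurable_expRM. Qed.

Lemma levy_markov_horizon (s : nat -> R) (k : nat) (S : R) (E : set T) (q m : R) :
  s 0%N = 0 -> (forall i, s i <= s i.+1) -> s k <= S ->
  dom psi m -> <<s cylinder xi s k>> E ->
  (\int[P]_(w in E) (expR (q * xi (s k) w + m * (xi S w - xi (s k) w)))%:E =
   \int[P]_(w in E) (expR (q * xi (s k) w))%:E
     * (expR ((S - s k) * p m))%:E)%E.
Proof.
move=> s0 s_nd skS md sE.
(* The grid is kept up to index [k] and then jumps to the horizon: the increment following [s k]
   becomes [xi S - xi (s k)] while the cylinders of order [k] are unchanged. *)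
pose s' i := if (i <= k)%N then s i else S.
have s'0 : s' 0%N = 0 by [].
have s'_nd i : s' i <= s' i.+1.
  rewrite /s'; have [ik|ik] := leqP i.+1 k; first by rewrite ltnW.
  case: ifPn => // ik'; have -> : i = k by apply/eqP; rewrite eqn_leq ik'.
  by [].
have E1 : cylinder xi s' k = cylinder xi s k.
  by apply/seteqP; split => F [B mB ->]; exists B => //;
    apply: eq_bigcapr => i /= ik; rewrite /s' ik ltnW.
have E2 : s' k = s k by rewrite /s' leqnn.
have E3 : s' k.+1 = S by rewrite /s' ltnn.
have := @levy_markov _ _ _ P xi hxi s' s'0 s'_nd psi hpsi k E q m md.
by rewrite E1 E2 E3; apply.
Qed.

Definition passage (s : nat -> R) (z : R) (k : nat) : set T :=
  [set w | exists2 j, (j <= k)%N & z < xi (s j) w].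

Definition first_passage (s : nat -> R) (z : R) (k : nat) : set T :=
  [set w | (forall j, (j < k)%N -> xi (s j) w <= z) /\ z < xi (s k) w].

Lemma first_passage_adapted (s : nat -> R) (z : R) (k : nat) :
  s 0%N = 0 -> (forall i, s i <= s i.+1) ->
  <<s cylinder xi s k>> (first_passage s z k).
Proof.
move=> s0 s_nd.
have -> : first_passage s z k =
    (\bigcap_(j < k) xi (s j) @^-1` `]-oo, z]) `&` xi (s k) @^-1` `]z, +oo[.
  apply/seteqP; split => w /= [H1 H2]; split.
  - by move=> j jk; rewrite /= in_itv/= H1.
  - by rewrite in_itv/= andbT.
  - by move=> j jk; have := H1 j jk; rewrite /= in_itv.
  - by move: H2; rewrite in_itv/= andbT.
have M j B : (j <= k)%N -> measurable B ->
    measurable ((xi (s j) @^-1` B) : set (g_sigma_algebraType (cylinder xi s k))).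
  move=> jk mB; have := levy_adapted hxi s0 jk measurableT mB.
  by rewrite setTI.
suff : measurable (((\bigcap_(j < k) xi (s j) @^-1` `]-oo, z]) `&`
    xi (s k) @^-1` `]z, +oo[) : set (g_sigma_algebraType (cylinder xi s k))) by [].
apply: measurableI; last exact: M.
apply: bigcap_measurableType => j /= jk; apply: M => //; exact: ltnW.
Qed.

Lemma passage_measurable s z k : measurable (passage s z k).
Proof.
have -> : passage s z k = \bigcup_(j < k.+1) xi (s j) @^-1` `]z, +oo[.
  apply/seteqP; split => w /= [j jk H]; exists j => //=.
    by rewrite in_itv/= andbT.
  by move: H; rewrite /= in_itv/= andbT.
apply: bigcup_measurable => j _; rewrite -[X in measurable X]setTI.
exact: measurable_funP.
Qed.

Lemma passageS s z k : passage s z k.+1 = passage s z k `|` first_passage s z k.+1.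
Proof.
apply/seteqP; split => w /=; last first.
  by case=> [[j jk H]|[_ H]]; [exists j => //; exact: leqW|exists k.+1].
move=> [j jk H]; have [Hp|Hp] := pselect (passage s z k w); first by left.
have Hj i : (i < k.+1)%N -> xi (s i) w <= z.
  by move=> ik; rewrite leNgt; apply/negP => iz; apply: Hp; exists i.
right; split => //; move: jk; rewrite leq_eqVlt => /predU1P[<-//|/Hj].
by rewrite leNgt H.
Qed.

(** The event is decomposed by the first grid time [s n] at which the path exceeds [z]. There,
    changing the exponent from [m] to [m'] gains [expR ((m - m') * z)] on the path up to [s n], and
    the independent remainder only grows, as [p m <= p m']. *)
Lemma maximal_inequality (s : nat -> R) (z S m m' : R) (k : nat) :
  s 0%N = 0 -> (forall i, s i <= s i.+1) -> s k <= S ->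
  dom psi m -> dom psi m' -> m <= m' -> p m <= p m' ->
  (\int[P]_(w in passage s z k) (expR (m * xi S w))%:E <=
   (expR ((m - m') * z))%:E *
     \int[P]_(w in passage s z k) (expR (m' * xi S w))%:E)%E.
Proof.
move=> s0 s_nd skS md md' mm' pmm'.
have snd i j : (i <= j)%N -> s i <= s j.
  by move=> ij; rewrite -(subnK ij); elim: (j - i)%N => // n /le_trans; apply.
have I0 D (x : R) : (0 <= \int[P]_(w in D) (expR (x * xi S w))%:E)%E.
  by apply: integral_ge0 => w _; rewrite lee_fin expR_ge0.
have F n : s n <= S -> (\int[P]_(w in first_passage s z n) (expR (m * xi S w))%:E <=
   (expR ((m - m') * z))%:E *
     \int[P]_(w in first_passage s z n) (expR (m' * xi S w))%:E)%E.
  move=> snS; have sE := @first_passage_adapted s z n s0 s_nd.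
  have mE := sigma_cylinder_measurable sE.
  have horizon x : dom psi x ->
      (\int[P]_(w in first_passage s z n) (expR (x * xi S w))%:E =
       \int[P]_(w in first_passage s z n) (expR (x * xi (s n) w))%:E
        * (expR ((S - s n) * p x))%:E)%E.
    move=> xd; rewrite -(levy_markov_horizon x s0 s_nd snS xd sE).
    by apply: eq_integral => w _; rewrite -mulrDr addrC subrK.
  rewrite (horizon _ md) (horizon _ md') muleA; apply: lee_pmul.
  - by apply: integral_ge0 => w _; rewrite lee_fin expR_ge0.
  - by rewrite lee_fin expR_ge0.
  - rewrite -ge0_integralZl//.
    + apply: ge0_le_integral => //.
      * by apply: measurable_funeM; exact: mexp.
      * move=> w [_ zw]; rewrite -EFinM lee_fin -expRD ler_expR.
        move: (xi (s n) w) zw => x zx; nra.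
  - by rewrite lee_fin ler_expR ler_wpM2l// subr_ge0.
elim: k skS => [|k IH] skS.
  have -> : passage s z 0 = first_passage s z 0; last exact: F.
  apply/seteqP; split => w /=; last by case=> _ H; exists 0%N.
  by case=> j; rewrite leqn0 => /eqP -> H; split.
have mN : measurable (first_passage s z k.+1).
  exact: sigma_cylinder_measurable (@first_passage_adapted s z k.+1 s0 s_nd).
have mp := passage_measurable s z k.
have dis : [disjoint passage s z k & first_passage s z k.+1].
  apply/disj_set2P; rewrite -subset0 => w /= [[j jk H] [/(_ j jk)]].
  by rewrite leNgt H.
rewrite passageS !ge0_integral_setU//.
rewrite ge0_muleDr//; apply: leeD; last exact: F.
by apply: IH; apply: le_trans skS; exact: snd.
Qed.

End maximal_inequality.

(** * Tilted bounds on the exponential functional *)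

(** If the path stayed below [ln (K / S) - 1] the functional would be at most K/e, so the path
    exceeds this level somewhere, and by right-continuity also at a dyadic time slightly later. The
    [- 1] provides the strict inequality. *)
Lemma exp_functional_gt_dyadic (R : realType) (w : R -> R) (S K : R) :
  cadlag w -> 0 < S -> 0 < K -> K <= exp_functional w S ->
  exists N j, (j <= 2 ^ N)%N /\ ln (K / S) - 1 < w (S * j%:R / (2 ^ N)%:R).
Proof.
move=> cw S0 K0 KS; set z := ln (K / S) - 1.
have [u [u0 uS zu]] : exists u, [/\ 0 < u, u <= S & z < w u].
  apply/not_existsP => H.
  have wz u : 0 < u <= S -> w u <= z.
    by move=> /andP[u0 uS]; rewrite leNgt; apply/negP => zu; exact: (H u).
  have [M Mw] := cadlag_bounded S cw.
  have /andP[_] : expR (- M) * (S - 0) <= exp_functional w S - exp_functional w 0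
      <= expR z * (S - 0).
    apply: exp_functional_diff => //; first by rewrite lexx ltW.
    move=> s sS; rewrite wz// andbT; have /Mw : 0 <= s <= S.
      by case/andP: sS => /ltW -> ->.
    by rewrite ler_norml => /andP[].
  rewrite exp_functional0 !subr0 leNgt => /negP; apply; apply: lt_le_trans KS.
  rewrite /z expRD lnK ?posrE ?divr_gt0// mulrAC divfK ?gt_eqF//.
  by rewrite gtr_pMr// expRN invf_lt1 ?expR_gt0// expR_gt1.
(* At [u = S] there is no room to the right within [0, S], but [S] is itself a grid point. *)
have [uS'|uS'] := eqVneq u S.
  by exists 0%N, 1%N; split => //; rewrite expn0 mulr1 divr1 -uS'.
have {uS' uS} uS : u < S by rewrite lt_neqAle uS'.
have z0 : 0 < w u - z by rewrite subr_gt0.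
have /cvgrPdist_lt/(_ _ z0)[e /= e0 He] := proj1 cw u (ltW u0).
have [N NP] : exists N, (2 ^ N)%:R^-1 < e / S :> R.
  have [n _ /(_ n (leqnn n)) H] := near_infty_natSinv_lt (PosNum (divr_gt0 e0 S0)).
  exists n.+1; apply: le_lt_trans H; rewrite lef_pV2 ?posrE ?ltr0n ?expn_gt0//.
  by rewrite ler_nat ltnW// ltn_expl.
have tN : 0 < (2 ^ N)%:R :> R by rewrite ltr0n expn_gt0.
pose j := (Num.truncn (u * (2 ^ N)%:R / S)).+1.
have q0 : 0 <= u * (2 ^ N)%:R / S by rewrite !mulr_ge0 ?invr_ge0// ltW.
have /andP[j1 j2] := truncn_itv q0; rewrite -/j in j2.
have uj : u < S * j%:R / (2 ^ N)%:R.
  by rewrite ltr_pdivlMr// [S * _]mulrC -ltr_pdivrMr.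
have ju : S * j%:R / (2 ^ N)%:R - u < e.
  have : (j%:R : R) <= u * (2 ^ N)%:R / S + 1 by rewrite -natr1 lerD2r.
  rewrite -(ler_pM2l S0) mulrDr mulr1 [S * (_ / S)]mulrC divfK ?gt_eqF// => H.
  apply: le_lt_trans (_ : S / (2 ^ N)%:R < e); last by rewrite mulrC -ltr_pdivlMr.
  by rewrite lerBlDl ler_pdivrMr// mulrDl divfK ?gt_eqF.
exists N, j; split.
  rewrite -ltnS /j ltnS truncn_lt_nat// ltr_pdivrMr// mulrC ltr_pM2l//.
have := He (S * j%:R / (2 ^ N)%:R); rewrite /= ltr0_norm ?subr_lt0// opprB.
move=> /(_ ju uj); rewrite ltr_norml => /andP[_].
by rewrite ltrD2l ltrN2.
Qed.

Section tilted_bounds.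
Context {d} {T : measurableType d} {R : realType}.
Variables (P : probability T R) (xi : R -> {RV P >-> R}).
Hypothesis hxi : levy_from_zero xi.
Variable psi : R -> \bar R.
Hypothesis hpsi : laplace_exponent xi psi.
Local Notation p := (fine \o psi).
Local Notation A S w := (exp_functional (xi ^~ w) S).
Notation mu := (@lebesgue_measure R).

Let cxi w : cadlag (xi ^~ w).
Proof. by case: hxi. Qed.

Lemma levy_jointly_measurable :
  measurable_fun setT (fun q : R * T => xi (Num.max 0 q.1) q.2).
Proof.
apply: (@measurable_uncurry_right_continuous R _ T
  (fun s w => xi (Num.max 0 s) w)) => // w s.
exact: (@cadlag_max0 R (xi ^~ w) s (cxi w)).
Qed.

Lemma exp_functional_measurable S : measurable_fun setT (fun w => A S w).
Proof.
have -> : (fun w => A S w) = (fun w => fine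
    (\int[mu]_u ((expR (xi (Num.max 0 u) w)) * \1_(`[0, S]) u)%:E)%E).
  apply/funext => w; rewrite /exp_functional /Rintegral; congr fine.
  rewrite integral_mkcond; apply: eq_integral => u _.
  rewrite patchE indicE; case: ifPn => [|_]; last by rewrite mulr0.
  by rewrite inE/= in_itv/= => /andP[u0 _]; rewrite mulr1 max_r.
apply: (measurableT_comp (fine_measurable measurableT)).
pose F (q : R * T) := (expR (xi (Num.max 0 q.1) q.2) * \1_(`[0, S]) q.1)%:E.
have mF : measurable_fun setT F.
  apply/measurable_EFinP; apply: measurable_funM.
    by apply: measurableT_comp => //; exact: levy_jointly_measurable.
  by apply: measurableT_comp => //; exact: measurable_indic.
have F0 q : (0 <= F q)%E by rewrite lee_fin mulr_ge0 ?expR_ge0.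
have := measurable_fun_fubini_tonelli_G (m1 := mu) F mF F0; apply.
Qed.

Lemma exp_functional_set_measurable S (B : set R) : measurable B ->
  measurable [set w | B (A S w)].
Proof.
move=> mB; have := exp_functional_measurable S measurableT mB.
by rewrite setTI.
Qed.

(** The passage events of the dyadic grids increase to an event containing the one at hand, and the
    maximal inequality bounds them uniformly in the grid; monotone convergence concludes. *)
Lemma tilted_exp_functional_ge (m m' S K : R) : dom psi m -> dom psi m' ->
  m <= m' -> p m <= p m' -> 0 < S -> 0 < K ->
  (\int[P]_(w in [set w | (K <= A S w)%R]) (expR (m * xi S w))%:E <=
   (expR ((m - m') * (ln (K / S) - 1) + S * p m'))%:E)%E.
Proof.
move=> md md' mm' pmm' S0 K0; set z := ln (K / S) - 1.
(* The minimum freezes the grid at [S] after index 2^N, so that it is nondecreasing over all indices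
   and never passes the horizon. *)
pose s N (j : nat) : R := S * (minn j (2 ^ N))%:R / (2 ^ N)%:R.
have tN N : 0 < (2 ^ N)%:R :> R by rewrite ltr0n expn_gt0.
have s0 N : s N 0%N = 0 by rewrite /s min0n mulr0 mul0r.
have s_nd N i : s N i <= s N i.+1.
  rewrite /s ler_pM2r ?invr_gt0// ler_pM2l// ler_nat.
  by rewrite leq_min geq_minr andbT (leq_trans (geq_minl _ _)).
have sS N : s N (2 ^ N)%N <= S by rewrite /s minnn -mulrA divff ?gt_eqF// mulr1.
pose G N := passage xi (s N) z (2 ^ N).
have mG N : measurable (G N) by exact: passage_measurable.
have G_nd : nondecreasing_seq G.
  apply/nondecreasing_seqP => N; apply/subsetPset => w /= [j jN H].
  exists (2 * j)%N; first by rewrite expnS leq_mul2l jN orbT.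
  move: H; rewrite /s (minn_idPl jN) (minn_idPl _) ?expnS ?leq_mul2l ?jN ?orbT//.
  by rewrite !natrM mulrCA -[(2%:R * (2 ^ N)%:R)^-1]/(_^-1) -mulf_div divff ?mul1r.
have f0 (x : R) w : (0 <= (expR (x * xi S w))%:E)%E by rewrite lee_fin expR_ge0.
have mf (x : R) D : measurable_fun D (fun w => (expR (x * xi S w))%:E).
  by apply: measurable_funTS; apply/measurable_EFinP; exact: measurable_expRM.
have mA : measurable [set w | (K <= A S w)%R].
  rewrite [X in measurable X](_ : _ = [set w | `[K, +oo[%classic (A S w)]).
    exact: exp_functional_set_measurable.
  by apply/seteqP; split => w /=; rewrite in_itv/= andbT.
apply: (@le_trans _ _ (\int[P]_(w in \bigcup_N G N) (expR (m * xi S w))%:E)%E).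
  apply: ge0_subset_integral => //; first exact: bigcupT_measurable.
  move=> w /= KA; have [N [j [jN H]]] := exp_functional_gt_dyadic (cxi w) S0 K0 KA.
  by exists N => //; exists j => //; rewrite /s (minn_idPl jN).
have cG := @ge0_nondecreasing_set_cvg_integral _ _ _ G
  (fun w => (expR (m * xi S w))%:E) P G_nd mG (fun N => mf m _) (fun N w _ => f0 m w).
apply: (cvge_to_le cG); apply: nearW => N.
apply: le_trans (maximal_inequality hxi hpsi z (s0 N) (s_nd N) (sS N) md md' mm' pmm') _.
rewrite expRD EFinM lee_pmul2l ?lte_fin ?expR_gt0//.
rewrite -(exponential_moment hpsi md' (ltW S0)).
by apply: ge0_subset_integral => //; exact: passage_measurable.
Qed.

End tilted_bounds.

(* Jensen's inequality for the convex function [x |-> x `^ (- eta)]. *)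
Lemma exp_functional_le_jensen (R : realType) (w : R -> R) (S K eta : R) :
  cadlag w -> 1 <= S -> 0 < K -> 0 <= eta -> exp_functional w S <= K ->
  (1 <= \int[@lebesgue_measure R]_(u in `[(S - 1)%R, S])
          (expR (- eta * (w u - ln K)))%:E)%E.
Proof.
move=> cw S1 K0 eta0 AK.
have S10 : 0 <= S - 1 by rewrite subr_ge0.
have iw := cadlag_expR_integrable cw S S10.
have mI : measurable (`[(S - 1)%R, S]%classic : set R) by [].
have mw : measurable_fun (`[(S - 1)%R, S] : set R) w.
  apply: measurable_funS (cadlag_measurable cw) => //.
  by move=> s /=; rewrite !in_itv/= andbT => /andP[us _]; exact: le_trans us.
have [M Mw] := cadlag_bounded S cw.
have ig : lebesgue_measure.-integrable `[(S - 1)%R, S]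
    (EFin \o (fun u => expR (- eta * (w u - ln K)))).
  apply: (@bounded_itv_integrable _ _ _ (expR (eta * (M + ln K)))).
  - exact: itvcc_finite.
  - by apply: measurableT_comp => //; apply: measurable_funM => //;
      apply: measurable_funB.
  - move=> u; rewrite in_itv/= => /andP[u1 u2].
    rewrite ger0_norm ?expR_ge0// ler_expR mulNr -mulrN ler_wpM2l//.
    have : `|w u| <= M by apply: Mw; rewrite u2 andbT (le_trans S10).
    by rewrite ler_norml => /andP[h _]; lra.
have i2 : lebesgue_measure.-integrable `[(S - 1)%R, S]
    (EFin \o (fun u => (- eta / K) * expR (w u))).
  have := integrableZl _ (- eta / K) iw; apply; exact: measurable_itv.
have i1 : lebesgue_measure.-integrable `[(S - 1)%R, S]
    (EFin \o (fun u => (1 + eta) + (- eta / K) * expR (w u))).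
  have c1 : lebesgue_measure.-integrable `[(S - 1)%R, S] (EFin \o cst (1 + eta)).
    apply: (@bounded_itv_integrable _ _ _ `|1 + eta|) => //; exact: itvcc_finite.
  have := integrableD _ c1 i2; apply; exact: measurable_itv.
have -> : (\int[@lebesgue_measure R]_(u in `[(S - 1)%R, S])
          (expR (- eta * (w u - ln K)))%:E)%E =
   (\int[@lebesgue_measure R]_(u in `[(S - 1)%R, S]) expR (- eta * (w u - ln K)))%:E.
  by rewrite /Rintegral fineK//; apply: integrable_fin_num.
rewrite lee_fin.
(* Two tangent lines, exp(-eta x) >= 1 - eta x and x <= exp(x) - 1 at x = w u - ln K, bound the
   integrand below by an affine function of [expR (w u)]. Its integral over the unit interval is at
   least 1 because that of [expR (w u)] is at most [K]. *)
apply: (@le_trans _ _ (\int[@lebesgue_measure R]_(u in `[(S - 1)%R, S])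
   ((1 + eta) + (- eta / K) * expR (w u)))); last first.
  apply: le_Rintegral => // u _.
  apply: le_trans (expR_ge1Dx _).
  have : w u - ln K <= expR (w u) / K - 1.
    have := expR_ge1Dx (w u - ln K); rewrite expRB lnK ?posrE// => H; lra.
  move: (w u - ln K) (expR (w u)) => x y H.
  have -> : - eta / K * y = - eta * (y / K) by ring.
  move: (y / K) H => q H; nra.
have iwS : lebesgue_measure.-integrable `[0, S] (EFin \o (fun s => expR (w s))).
  exact: cadlag_expR_integrable.
have J : \int[@lebesgue_measure R]_(u in `[(S - 1)%R, S]) expR (w u) <= K.
  apply: le_trans AK; rewrite /exp_functional /Rintegral fine_le//.
  - by apply: integrable_fin_num.
  - by apply: integrable_fin_num.
  - apply: ge0_subset_integral => //.
    + by apply/measurable_EFinP; apply: cadlag_expR_measurable.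
    + by move=> s /=; rewrite !in_itv/= => /andP[s1 ->]; rewrite (le_trans S10).
rewrite RintegralD//; last first.
  apply: (@bounded_itv_integrable _ _ _ `|1 + eta|) => //; exact: itvcc_finite.
rewrite RintegralZl// Rintegral_cst//= lebesgue_measure_itv/= lte_fin.
rewrite ltrBlDr ltrDl ltr01/= opprB addrC subrK mulr1.
move: (\int[_]_(_ in _) _) J => I IK.
have -> : - eta / K * I = - eta * (I / K) by ring.
have : I / K <= 1 by rewrite ler_pdivrMr// mul1r.
move: (I / K) => q q1; nra.
Qed.

Section tilted_bounds_below.
Context {d} {T : measurableType d} {R : realType}.
Variables (P : probability T R) (xi : R -> {RV P >-> R}).
Hypothesis hxi : levy_from_zero xi.
Variable psi : R -> \bar R.
Hypothesis hpsi : laplace_exponent xi psi.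
Local Notation p := (fine \o psi).
Local Notation A S w := (exp_functional (xi ^~ w) S).
Notation mu := (@lebesgue_measure R).

Let cxi w : cadlag (xi ^~ w).
Proof. by case: hxi. Qed.

Lemma two_time_moment (q m u S : R) : dom psi q -> dom psi m -> 0 <= u <= S ->
  (\int[P]_w (expR (q * xi u w + m * (xi S w - xi u w)))%:E =
   (expR (u * p q + (S - u) * p m))%:E)%E.
Proof.
move=> qd md /andP[u0 uS].
pose s (i : nat) := if i is 0%N then 0 else u.
have s_nd i : s i <= s i.+1 by case: i.
have sT : <<s cylinder xi s 1>> setT by apply: sub_sigma_algebra; exact: cylinderT.
have := @levy_markov_horizon _ _ _ P xi hxi psi hpsi s 1%N S setT q m erefl s_nd uS md sT.
by rewrite /= => ->; rewrite (exponential_moment hpsi)// -EFinM -expRD.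
Qed.

(** Jensen's bound is integrated by Tonelli, each [u] contributing the moment with exponent
    [u * p m' + (S - u) * p m]. This decreases in [u] since [p m' <= p m], so a unit interval ending
    at [S] loses only a bounded term: the worst time is [S - 1]. *)
Lemma tilted_exp_functional_le (m' m S K : R) : dom psi m' -> dom psi m ->
  m' <= m -> p m' <= p m -> 1 <= S -> 0 < K ->
  (\int[P]_(w in [set w | (A S w <= K)%R]) (expR (m * xi S w))%:E <=
   (expR ((m - m') * ln K + (S - 1) * p m' + p m))%:E)%E.
Proof.
move=> md' md mm' pmm' S1 K0.
have eta0 : 0 <= m - m' by rewrite subr_ge0.
pose F (q : R * T) := (expR (m * xi S q.2 + - (m - m') * (xi (Num.max 0 q.1) q.2 - ln K))
  * \1_(`[(S - 1)%R, S]) q.1)%:E.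
have mF : measurable_fun setT F.
  apply/measurable_EFinP; apply: measurable_funM.
    apply: measurableT_comp => //; apply: measurable_funD.
      apply: measurable_funM => //.
      by apply: (measurableT_comp (f := xi S)).
    apply: measurable_funM => //; apply: measurable_funB => //.
    exact: levy_jointly_measurable.
  by apply: measurableT_comp => //; exact: measurable_indic.
have F0 q : (0 <= F q)%E by rewrite lee_fin mulr_ge0 ?expR_ge0.
have S10 : 0 <= S - 1 by rewrite subr_ge0.
have mA : measurable [set w | (A S w <= K)%R].
  rewrite [X in measurable X](_ : _ = [set w | `]-oo, K]%classic (A S w)]).
    exact: exp_functional_set_measurable.
  by apply/seteqP; split => w /=; rewrite in_itv.
apply: (@le_trans _ _ (\int[P]_w \int[mu]_u F (u, w))%E).
  rewrite integral_mkcond; apply: ge0_le_integral => //.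
  - by move=> w _; rewrite patchE; case: ifPn => // _; rewrite lee_fin expR_ge0.
  - apply/(measurable_restrictT _ _).1 => //.
    by apply: measurable_funTS; apply/measurable_EFinP; exact: measurable_expRM.
  - have := measurable_fun_fubini_tonelli_G (m1 := mu) F mF F0; apply.
  - move=> w _; rewrite patchE; case: ifPn => [|_]; last first.
      by apply: integral_ge0.
    rewrite inE => /= AK.
    have := exp_functional_le_jensen (cxi w) S1 K0 eta0 AK => J.
    apply: (@le_trans _ _ ((expR (m * xi S w))%:E *
      \int[mu]_(u in `[(S - 1)%R, S]) (expR (- (m - m') * (xi u w - ln K)))%:E)%E).
      by rewrite -[leLHS]mule1 lee_pmul2l// lte_fin expR_gt0.
    rewrite -ge0_integralZl//; last first.
      apply/measurable_EFinP; apply: measurableT_comp => //.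
      apply: measurable_funM => //; apply: measurable_funB => //.
      apply: measurable_funS (cadlag_measurable (cxi w)) => //.
      by move=> s /=; rewrite !in_itv/= andbT => /andP[us _]; exact: le_trans us.
    rewrite integral_mkcond le_eqVlt; apply/orP; left; apply/eqP.
    apply: eq_integral => u _; rewrite patchE /F/= indicE.
    case: ifPn => [|_]; last by rewrite mulr0.
    rewrite inE/= in_itv/= => /andP[u1 _].
    by rewrite mulr1 expRD EFinM max_r// (le_trans S10).
rewrite -(fubini_tonelli (m1 := mu) (m2 := P) F mF F0).
set C := expR _.
apply: (@le_trans _ _ (\int[mu]_u (C * \1_(`[(S - 1)%R, S]) u)%:E)%E).
  apply: ge0_le_integral => //.
  - by move=> u _; apply: integral_ge0.
  - have := measurable_fun_fubini_tonelli_F (m2 := P) F mF F0; apply.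
  - by apply/measurable_EFinP; apply: measurable_funM => //; exact: measurable_indic.
  move=> u _; rewrite /F/= indicE.
  have [|_] := boolP (u \in `[(S - 1)%R, S]%classic); last first.
    rewrite mulr0 (_ : (fun w => _) = cst 0%E) ?integral0//.
    by apply/funext => w; rewrite mulr0.
  rewrite inE/= in_itv/= => /andP[u1 uS]; have u0 := le_trans S10 u1.
  rewrite mulr1 max_r//.
  have uS' : 0 <= u <= S by rewrite u0.
  have E w : ((expR (m * xi S w + - (m - m') * (xi u w - ln K)) * 1%:R)%:E =
     (expR ((m - m') * ln K))%:E * (expR (m' * xi u w + m * (xi S w - xi u w)))%:E)%E.
    by rewrite mulr1 -EFinM -expRD; congr (expR _)%:E; ring.
  under eq_integral do rewrite E.
  rewrite ge0_integralZl//; last first.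
    apply/measurable_EFinP; apply: measurableT_comp => //.
    by apply: measurable_funD; apply: measurable_funM => //; exact: measurable_funB.
  rewrite two_time_moment// -EFinM -expRD lee_fin ler_expR.
  move: (p m) (p m') pmm' => x y xy.
  rewrite -addrA lerD2l; have : (S - 1) * (x - y) <= u * (x - y).
    by rewrite ler_wpM2r// subr_ge0.
  by move=> H; lra.
have -> : (\int[mu]_u (C * \1_(`[(S - 1)%R, S]) u)%:E =
    \int[mu]_(u in `[(S - 1)%R, S]) (cst C%:E) u)%E.
  rewrite [RHS]integral_mkcond; apply: eq_integral => u _.
  by rewrite patchE indicE; case: ifPn => _; rewrite ?mulr1 ?mulr0.
rewrite integral_cst//= lebesgue_measure_itv/= lte_fin.
by rewrite ltrBlDr ltrDl ltr01 -EFinB opprB addrC subrK mule1.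
Qed.

(** The sign condition treats both tails at once: [E] lies below [b] when [q < m] and above [b] when
    [q > m]. *)
Lemma tilted_chernoff (m q S b : R) (E : set T) : dom psi q -> 0 <= S ->
  measurable E -> (forall w, E w -> (m - q) * (xi S w - b) <= 0) ->
  (\int[P]_(w in E) (expR (m * xi S w))%:E <=
   (expR ((m - q) * b + S * p q))%:E)%E.
Proof.
move=> qd S0 mE Eb.
have mx (x : R) D : measurable_fun D (fun w => (expR (x * xi S w))%:E).
  by apply: measurable_funTS; apply/measurable_EFinP; exact: measurable_expRM.
rewrite expRD EFinM -(exponential_moment hpsi qd S0).
rewrite -ge0_integralZl//.
apply: (@le_trans _ _ (\int[P]_(w in E)
   ((expR ((m - q) * b))%:E * (expR (q * xi S w))%:E))%E).
  apply: ge0_le_integral => //.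
  - by apply: measurable_funeM; exact: mx.
  - move=> w /Eb; rewrite -EFinM -expRD lee_fin ler_expR => H; lra.
apply: ge0_subset_integral => //.
- by apply: measurable_funeM; exact: mx.
Qed.

End tilted_bounds_below.

(** * Exponential rates *)

Lemma near_pinfty_ge (R : realType) (c : R) : \forall h \near pinfty_nbhs R, c <= h.
Proof. by apply: nbhs_pinfty_ge; exact: num_real. Qed.

Lemma near_ln_le_linear (R : realType) (y c e : R) : 0 < y -> 0 < e ->
  \forall h \near pinfty_nbhs R, ln (y * h) + c <= e * h.
Proof.
move=> y0 e0; pose d := e / 2; have d0 : 0 < d by rewrite divr_gt0.
near=> h.
have h0 : 0 < h by near: h; apply: nbhs_pinfty_gt; exact: num_real.
have -> : y * h = (y / d) * (d * h) by field; rewrite gt_eqF.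
rewrite lnM ?posrE ?divr_gt0 ?mulr_gt0//.
have H1 : ln (d * h) <= d * h - 1.
  have := @expR_ge1Dx R (ln (d * h)); rewrite lnK ?posrE ?mulr_gt0// => H; lra.
have H2 : d * h = e * h - d * h by rewrite /d; field.
have H3 : ln (y / d) + c <= d * h.
  by rewrite -ler_pdivrMl//; near: h; exact: near_pinfty_ge.
lra.
Unshelve. all: by end_near. Qed.

Lemma near_linear_ge (R : realType) (c e : R) : 0 < e ->
  \forall h \near pinfty_nbhs R, c <= e * h.
Proof.
move=> e0; near=> h; rewrite -ler_pdivrMl//; near: h; exact: near_pinfty_ge.
Unshelve. all: by end_near. Qed.

Section asymptotics.
Context {d} {T : measurableType d} {R : realType}.
Variables (P : probability T R) (xi : R -> {RV P >-> R}).
Hypothesis hxi : levy_from_zero xi.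
Variable psi : R -> \bar R.
Hypothesis hpsi : laplace_exponent xi psi.
Hypothesis dom0 : dom psi 0.
Local Notation p := (fine \o psi).
Local Notation A S w := (exp_functional (xi ^~ w) S).

(** The counterpart of the tangent inequality, which bounds the exponent from below: first-order
    upper bounds on both sides of [m], from differentiability. *)
Lemma laplace_exponent_step (m e : R) : dom psi m -> 0 < e ->
  exists2 r : R, 0 < r & forall t, 0 < t -> t <= r ->
    [/\ dom psi (m + t), dom psi (m - t),
        p (m + t) <= p m + t * (dpsi psi m + e) &
        p (m - t) <= p m - t * (dpsi psi m - e)].
Proof.
move=> md e0; have [r r0 rd] := dom_near md.
have D := laplace_exponent_is_derive hpsi md.
have : (fun h : R => h^-1 *: (p (h *: 1 + m) - p m)) @ 0^' --> dpsi psi m.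
  by case: D => cv <-; exact: cv.
move/cvgrPdist_le => /(_ _ e0) [x /= x0 Hx].
pose r' := Num.min r (x / 2).
have r'0 : 0 < r' by rewrite lt_min r0 divr_gt0.
exists r' => // t t0; rewrite le_min => /andP[tr tx].
have tx' : t < x by apply: le_lt_trans tx _; rewrite ltr_pdivrMr// ltr_pMr// ltr1n.
have H1 := Hx t; have H2 := Hx (- t).
rewrite /= sub0r normrN gtr0_norm// in H1.
rewrite /= sub0r opprK gtr0_norm// in H2.
have tN0 : t != 0 by rewrite gt_eqF.
have {}H1 := H1 tx' tN0.
have {}H2 : `|dpsi psi m - (- t)^-1 *: (fine (psi (- t *: 1 + m)) - fine (psi m))| <= e.
  by apply: H2 => //; rewrite oppr_eq0.
have s1 (q : R) : q *: (1 : R) + m = m + q by rewrite /GRing.scale/= mulr1 addrC.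
rewrite !s1 /GRing.scale/= in H1 H2.
split; [apply: rd; lra|apply: rd; lra| |].
- move: H1; rewrite ler_norml => /andP[H1 _].
  have : t^-1 * (fine (psi (m + t)) - fine (psi m)) <= dpsi psi m + e by lra.
  rewrite ler_pdivrMl//; move: (fine _) (fine _) (dpsi _ _) => *; lra.
- move: H2; rewrite ler_norml => /andP[_ H2].
  have : dpsi psi m - e <= (- t)^-1 * (fine (psi (m - t)) - fine (psi m)) by lra.
  rewrite invrN mulNr -mulrN ler_pdivlMl//.
  by move: (fine _) (fine _) (dpsi _ _) => *; lra.
Qed.

Let psi0 : p 0 = 0.
Proof. by rewrite /= (laplace_exponent0 hpsi). Qed.

Let integral0m E S : measurable E ->
  (\int[P]_(w in E) (expR (0 * xi S w))%:E = P E)%E.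
Proof.
move=> mE; under eq_integral do rewrite mul0r expR0.
by rewrite integral_cst//= mul1e.
Qed.

Lemma exp_functional_le_measurable S K : measurable [set w | (A S w <= K)%R].
Proof.
rewrite [X in measurable X](_ : _ = [set w | `]-oo, K]%classic (A S w)]).
  exact: (exp_functional_set_measurable hxi).
by apply/seteqP; split => w /=; rewrite in_itv.
Qed.

Lemma exp_functional_lt_measurable S K : measurable [set w | (A S w < K)%R].
Proof.
rewrite [X in measurable X](_ : _ = [set w | `]-oo, K[%classic (A S w)]).
  exact: (exp_functional_set_measurable hxi).
by apply/seteqP; split => w /=; rewrite in_itv.
Qed.

Lemma exp_functional_ge_measurable S K : measurable [set w | (K <= A S w)%R].
Proof.
rewrite [X in measurable X](_ : _ = [set w | `[K, +oo[%classic (A S w)]).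
  exact: (exp_functional_set_measurable hxi).
by apply/seteqP; split => w /=; rewrite in_itv/= andbT.
Qed.

(** The tilted estimate at tilt 0, with [m] as the competing exponent; [e * h] absorbs the terms
    that do not grow with [h]. *)
Lemma prob_exp_functional_le_upper (m y a e : R) : dom psi m -> m <= 0 -> p m <= 0 ->
  0 < y -> 0 < a -> 0 < e -> \forall h \near pinfty_nbhs R,
  (P [set w | (A (y * h) w <= expR h / a)%R] <= (expR (h * (- m + y * p m + e)))%:E)%E.
Proof.
move=> md m0 pm0 y0 a0 e0; near=> h.
have S1 : 1 <= y * h by near: h; exact: near_linear_ge.
have K0 : 0 < expR h / a by rewrite divr_gt0 ?expR_gt0.
rewrite -(integral0m (y * h) (exp_functional_le_measurable _ _)).
have pm0' : p m <= p 0 by rewrite psi0.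
apply: le_trans (tilted_exp_functional_le hxi hpsi md dom0 m0 pm0' S1 K0) _.
rewrite lee_fin ler_expR psi0 ln_div ?posrE ?expR_gt0// expRK.
have : m * ln a - p m <= e * h by near: h; exact: near_linear_ge.
move: (p m) => q; lra.
Unshelve. all: by end_near. Qed.

Lemma prob_exp_functional_ge_upper (m y a e : R) : dom psi m -> 0 <= m -> 0 <= p m ->
  0 < y -> 0 < a -> 0 < e -> \forall h \near pinfty_nbhs R,
  (P [set w | (expR h / a <= A (y * h) w)%R] <= (expR (h * (- m + y * p m + e)))%:E)%E.
Proof.
move=> md m0 pm0 y0 a0 e0.
have m1 : 0 < m + 1 by lra.
(* The logarithm of the horizon [y * h] enters multiplied by [m]; adding 1 to the denominator covers
   [m = 0]. *)
have e1 : 0 < e / (m + 1) by rewrite divr_gt0.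
near=> h.
have S1 : 0 < y * h by rewrite mulr_gt0//; near: h; apply: nbhs_pinfty_gt; exact: num_real.
have K0 : 0 < expR h / a by rewrite divr_gt0 ?expR_gt0.
rewrite -(integral0m (y * h) (exp_functional_ge_measurable _ _)).
have pm0' : p 0 <= p m by rewrite psi0.
apply: le_trans (tilted_exp_functional_ge hxi hpsi dom0 md m0 pm0' S1 K0) _.
rewrite lee_fin ler_expR !ln_div ?posrE ?divr_gt0 ?expR_gt0// expRK.
have : ln (y * h) + Num.max 0 (ln a + 1) <= e / (m + 1) * h.
  by near: h; exact: near_ln_le_linear.
have h0 : 0 <= h by near: h; exact: near_pinfty_ge.
have Hm : ln a + 1 <= Num.max 0 (ln a + 1) by rewrite le_max lexx orbT.
have Em : m * (e / (m + 1) * h) <= e * h.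
  rewrite mulrA ler_wpM2r// mulrA ler_pdivrMr// mulrC; lra.
move: (p m) (ln (y * h)) (ln a) (Num.max _ _) Hm => q l la M Hm H.
have : m * (l + la + 1) <= m * (e / (m + 1) * h) by rewrite ler_wpM2l//; lra.
lra.
Unshelve. all: by end_near. Qed.

(** The complement of [E] and the event [E1] each take at most a quarter of the tilted mass
    [expR (S * p m)], so [E] minus [E1] keeps half of it; there the density is at most
    [expR (m * b)], which converts the mass into probability. *)
Lemma tilted_lower_bound (m S b : R) (E E1 : set T) : dom psi m -> 0 <= S ->
  measurable E -> measurable E1 -> (forall w, ~ E1 w -> m * xi S w <= m * b) ->
  (\int[P]_(w in E1) (expR (m * xi S w))%:E <= (expR (S * p m - ln 4))%:E)%E ->
  (\int[P]_(w in ~` E) (expR (m * xi S w))%:E <= (expR (S * p m - ln 4))%:E)%E ->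
  ((expR (S * p m - m * b - ln 2))%:E <= P E)%E.
Proof.
move=> md S0 mE mE1 Hb I1 I2.
have mx D : measurable_fun D (fun w => (expR (m * xi S w))%:E).
  by apply: measurable_funTS; apply/measurable_EFinP; exact: measurable_expRM.
have f0 w : (0 <= (expR (m * xi S w))%:E)%E by rewrite lee_fin expR_ge0.
have H : ((expR (S * p m))%:E <= \int[P]_(w in E `\` E1) (expR (m * xi S w))%:E +
   ((expR (S * p m - ln 4))%:E + (expR (S * p m - ln 4))%:E))%E.
  have s1 : (\int[P]_w (expR (m * xi S w))%:E = \int[P]_(w in E) (expR (m * xi S w))%:E
      + \int[P]_(w in ~` E) (expR (m * xi S w))%:E)%E.
    rewrite -{1}(setvU E) setUC ge0_integral_setU//; first exact: measurableC.
    exact/disj_setPCl.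
  have s2 : (\int[P]_(w in E) (expR (m * xi S w))%:E =
      \int[P]_(w in E `\` E1) (expR (m * xi S w))%:E
      + \int[P]_(w in E `&` E1) (expR (m * xi S w))%:E)%E.
    rewrite -{1}(setUIDK E E1) setUC ge0_integral_setU//.
    - exact: measurableD.
    - exact: measurableI.
    - by apply/disj_set2P; rewrite -subset0 => w [[_ ?] [_ ?]].
  have s3 : (\int[P]_(w in E `&` E1) (expR (m * xi S w))%:E <=
      (expR (S * p m - ln 4))%:E)%E.
    by apply: le_trans I1; apply: ge0_subset_integral => //; exact: measurableI.
  rewrite -(exponential_moment hpsi md S0) s1 s2 -addeA.
  by rewrite leeD2l// leeD.
have H2 : (\int[P]_(w in E `\` E1) (expR (m * xi S w))%:E <= (expR (m * b))%:E * P E)%E.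
  apply: (@le_trans _ _ (\int[P]_(w in E `\` E1) (cst (expR (m * b))%:E w))%E).
    apply: ge0_le_integral => //; first exact: measurableD.
    by move=> w [_ /Hb]; rewrite lee_fin ler_expR.
  rewrite integral_cst//; last exact: measurableD.
  rewrite lee_pmul2l ?lte_fin ?expR_gt0//; apply: le_measure; rewrite ?inE//.
  exact: measurableD.
have PE : P E = (fine (P E))%:E by rewrite fineK// fin_num_measure.
move: H H2; rewrite PE; set x := fine _.
rewrite -EFinM -EFinD => H H2.
have : ((expR (S * p m))%:E <= (expR (m * b) * x)%:E +
   (expR (S * p m - ln 4) + expR (S * p m - ln 4))%:E)%E.
  by apply: (le_trans H); rewrite leeD2r.
rewrite -EFinD !lee_fin [S * p m - m * b - _]addrAC !expRB !lnK ?posrE// => H3.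
rewrite ler_pdivrMr ?expR_gt0// [x * _]mulrC; lra.
Qed.

End asymptotics.

(** * Cramer lower bounds under the tilt *)

Section asymptotic_lower_bounds.
Context {d} {T : measurableType d} {R : realType}.
Variables (P : probability T R) (xi : R -> {RV P >-> R}).
Hypothesis hxi : levy_from_zero xi.
Variable psi : R -> \bar R.
Hypothesis hpsi : laplace_exponent xi psi.
Local Notation p := (fine \o psi).
Local Notation A S w := (exp_functional (xi ^~ w) S).

Let level_measurable S (B : set R) : measurable B -> measurable [set w | B (xi S w)].
Proof.
by move=> mB; rewrite -[X in measurable X]setTI; exact: measurable_funP.
Qed.

(** As [m <= 0], the density exp(m xi_S) is large only where xi_S is small, so only the lower tail
    of xi_S is discarded. The tilted drift [v] satisfies y v < 1, which makes the event for A
    typical. *)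
Lemma prob_exp_functional_lt_lower (m y a e : R) : dom psi m -> m <= 0 ->
  0 < dpsi psi m -> 0 < y -> y * dpsi psi m < 1 -> 0 < a -> 0 < e ->
  \forall h \near pinfty_nbhs R,
  ((expR (h * (y * p m - y * m * dpsi psi m - e)))%:E <=
   P [set w | (A (y * h) w < expR h / a)%R])%E.
Proof.
move=> md m0; set v := dpsi psi m => v0 y0 yv a0 e0.
(* Chosen so that lowering the slope [v] by [D] costs at most [e / 2] in the exponent; [1 - m]
   rather than [- m] covers [m = 0]. *)
pose D : R := e / (2 * y * (1 - m)).
have m1 : 0 < 1 - m by lra.
have D0 : 0 < D by rewrite divr_gt0// mulr_gt0// mulr_gt0.
have mD : - m * y * D <= e / 2.
  have -> : - m * y * D = (- m / (1 - m)) * (e / 2).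
    by rewrite /D; field; rewrite !gt_eqF.
  rewrite ger_pMl ?divr_gt0// ler_pdivrMr//; lra.
have D20 : 0 < D / 2 by rewrite divr_gt0.
have [r r0 /(_ r r0 (lexx r)) [_ rd2 _ rp2]] := laplace_exponent_step hpsi md D20.
(* Half of the gap between [v] and 1/y: the perturbed slope [v + c] stays below 1/y. *)
pose c : R := (1 - y * v) / (2 * y).
have c0 : 0 < c by rewrite divr_gt0 ?mulr_gt0// subr_gt0.
have yc : y * (v + c) = 1 - (1 - y * v) / 2 by rewrite /c; field; rewrite gt_eqF.
have [r' r'0 /(_ r' r'0 (lexx r')) [rd' _ rp' _]] := laplace_exponent_step hpsi md c0.
have k1 : 0 < y * r * D / 2 by rewrite divr_gt0// mulr_gt0// mulr_gt0.
have k2 : 0 < (1 - y * v) / 2 by lra.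
have k3 : 0 < e / 2 by rewrite divr_gt0.
near=> h.
have h0 : 0 < h by near: h; apply: nbhs_pinfty_gt; exact: num_real.
have S0 : 0 < y * h by rewrite mulr_gt0.
have K0 : 0 < expR h / a by rewrite divr_gt0 ?expR_gt0.
have N1 : ln 4 <= (y * r * D / 2) * h by near: h; exact: near_linear_ge.
have N2 : ln (y * h) + (ln a + 1 + ln 4 / r') <= (1 - y * v) / 2 * h.
  by near: h; exact: near_ln_le_linear.
have N3 : ln 2 <= e / 2 * h by near: h; exact: near_linear_ge.
pose b := y * h * (v - D).
pose E1 := [set w | `]-oo, b[%classic (xi (y * h) w)].
have mE1 : measurable E1 by exact: level_measurable.
have mE := exp_functional_lt_measurable hxi (y * h) (expR h / a).
have Hb w : ~ E1 w -> m * xi (y * h) w <= m * b.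
  by rewrite /E1/= in_itv/= => /negP; rewrite -leNgt => bw; rewrite ler_wnM2l.
have I1 : (\int[P]_(w in E1) (expR (m * xi (y * h) w))%:E <=
    (expR (y * h * p m - ln 4))%:E)%E.
  apply: le_trans (tilted_chernoff hpsi (b := b) rd2 (ltW S0) mE1 _) _.
    move=> w; rewrite /E1/= in_itv/= => wb.
    rewrite opprB addrC subrK pmulr_rle0// subr_le0; exact: ltW.
  rewrite lee_fin ler_expR; have : y * h * p (m - r) <= y * h * (p m - r * (v - D / 2)).
    by rewrite ler_pM2l.
  move: (p (m - r)) (p m) N1; rewrite /b => q1 q2 N1 H; lra.
have I2 : (\int[P]_(w in ~` [set w | (A (y * h) w < expR h / a)%R])
    (expR (m * xi (y * h) w))%:E <= (expR (y * h * p m - ln 4))%:E)%E.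
  have -> : ~` [set w | (A (y * h) w < expR h / a)%R] =
      [set w | (expR h / a <= A (y * h) w)%R].
    by apply/seteqP; split => w /=; rewrite leNgt => /negP.
  have mm' : m <= m + r' by rewrite lerDl ltW.
  have pmm' : p m <= p (m + r').
    apply: le_trans (laplace_exponent_tangent hpsi rd' md).
    by rewrite lerDl mulr_ge0 ?ltW// [m + r']addrC addrK.
  apply: le_trans (tilted_exp_functional_ge hxi hpsi md rd' mm' pmm' S0 K0) _.
  rewrite lee_fin ler_expR !ln_div ?posrE ?divr_gt0 ?expR_gt0// expRK.
  have : y * h * p (m + r') <= y * h * (p m + r' * (v + c)) by rewrite ler_pM2l.
  have : r' * (ln (y * h) + (ln a + 1 + ln 4 / r')) <= r' * ((1 - y * v) / 2 * h).
    by rewrite ler_pM2l.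
  have -> : r' * (ln (y * h) + (ln a + 1 + ln 4 / r')) =
     r' * (ln (y * h) + ln a + 1) + ln 4 by field; rewrite gt_eqF.
  have -> : y * h * (p m + r' * (v + c)) = y * h * p m + h * r' * (y * (v + c)) by ring.
  rewrite yc.
  move: (p (m + r')) (p m) (ln (y * h)) (ln a) (ln 4) => q1 q2 l la l4 G H; lra.
apply: le_trans (tilted_lower_bound hpsi md (ltW S0) mE mE1 Hb I1 I2).
rewrite lee_fin ler_expR /b.
have : (- m * y * D) * h <= e / 2 * h by rewrite ler_wpM2r// ltW.
move: (p m) (ln 2) N3 => q l2 N3 H; lra.
Unshelve. all: by end_near. Qed.

(** The mirror image: only the upper tail of xi_S is discarded, and the competing exponent is
    [m - r']. The slope [v - c] is the midpoint of [v] and 1/y, hence positive, which gives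
    [p (m - r') <= p m]. *)
Lemma prob_exp_functional_ge_lower (m y a e : R) : dom psi m -> 0 <= m ->
  0 < dpsi psi m -> 0 < y -> 1 < y * dpsi psi m -> 0 < a -> 0 < e ->
  \forall h \near pinfty_nbhs R,
  ((expR (h * (y * p m - y * m * dpsi psi m - e)))%:E <=
   P [set w | (expR h / a <= A (y * h) w)%R])%E.
Proof.
move=> md m0; set v := dpsi psi m => v0 y0 yv a0 e0.
pose D : R := e / (2 * y * (1 + m)).
have m1 : 0 < 1 + m by lra.
have D0 : 0 < D by rewrite divr_gt0// mulr_gt0// mulr_gt0.
have mD : m * y * D <= e / 2.
  have -> : m * y * D = (m / (1 + m)) * (e / 2).
    by rewrite /D; field; rewrite !gt_eqF.
  rewrite ger_pMl ?divr_gt0// ler_pdivrMr//; lra.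
have D20 : 0 < D / 2 by rewrite divr_gt0.
have [r r0 /(_ r r0 (lexx r)) [rd _ rp _]] := laplace_exponent_step hpsi md D20.
pose c : R := (y * v - 1) / (2 * y).
have c0 : 0 < c by rewrite divr_gt0 ?mulr_gt0// subr_gt0.
have yc : y * (v - c) = 1 + (y * v - 1) / 2 by rewrite /c; field; rewrite gt_eqF.
have vc0 : 0 < v - c by rewrite -(pmulr_rgt0 _ y0) yc; lra.
have [r' r'0 /(_ r' r'0 (lexx r')) [_ rd' _ rp']] := laplace_exponent_step hpsi md c0.
have k1 : 0 < y * r * D / 2 by rewrite divr_gt0// mulr_gt0// mulr_gt0.
have k2 : 0 < r' * ((y * v - 1) / 2) by rewrite mulr_gt0//; lra.
have k3 : 0 < e / 2 by rewrite divr_gt0.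
near=> h.
have h0 : 0 < h by near: h; apply: nbhs_pinfty_gt; exact: num_real.
have S1 : 1 <= y * h by near: h; exact: near_linear_ge.
have S0 : 0 < y * h by rewrite mulr_gt0.
have K0 : 0 < expR h / a by rewrite divr_gt0 ?expR_gt0.
have N1 : ln 4 <= (y * r * D / 2) * h by near: h; exact: near_linear_ge.
have N2 : ln 4 - r' * ln a + r' * (v - c) <= r' * ((y * v - 1) / 2) * h.
  by near: h; exact: near_linear_ge.
have N3 : ln 2 <= e / 2 * h by near: h; exact: near_linear_ge.
pose b := y * h * (v + D).
pose E1 := [set w | `]b, +oo[%classic (xi (y * h) w)].
have mE1 : measurable E1 by exact: level_measurable.
have mE := exp_functional_ge_measurable hxi (y * h) (expR h / a).
have Hb w : ~ E1 w -> m * xi (y * h) w <= m * b.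
  by rewrite /E1/= in_itv/= andbT => /negP; rewrite -leNgt => bw; rewrite ler_wpM2l.
have I1 : (\int[P]_(w in E1) (expR (m * xi (y * h) w))%:E <=
    (expR (y * h * p m - ln 4))%:E)%E.
  apply: le_trans (tilted_chernoff hpsi (b := b) rd (ltW S0) mE1 _) _.
    move=> w; rewrite /E1/= in_itv/= andbT => wb.
    have -> : m - (m + r) = - r by ring.
    by rewrite mulNr oppr_le0 mulr_ge0 ?ltW// subr_gt0.
  rewrite lee_fin ler_expR; have : y * h * p (m + r) <= y * h * (p m + r * (v + D / 2)).
    by rewrite ler_pM2l.
  move: (p (m + r)) (p m) N1; rewrite /b => q1 q2 N1 H; lra.
have I2 : (\int[P]_(w in ~` [set w | (expR h / a <= A (y * h) w)%R])
    (expR (m * xi (y * h) w))%:E <= (expR (y * h * p m - ln 4))%:E)%E.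
  have mm' : m - r' <= m by rewrite gerBl ltW.
  have pmm' : p (m - r') <= p m.
    apply: (le_trans rp'); rewrite gerBl mulr_ge0 ?ltW//.
  apply: (@le_trans _ _ (\int[P]_(w in [set w | (A (y * h) w <= expR h / a)%R])
      (expR (m * xi (y * h) w))%:E)%E).
    apply: ge0_subset_integral => //.
    - exact: measurableC.
    - exact: exp_functional_le_measurable.
    - by apply: measurable_funTS; apply/measurable_EFinP; exact: measurable_expRM.
    - by move=> w /= /negP; rewrite -ltNge => /ltW.
  apply: le_trans (tilted_exp_functional_le hxi hpsi rd' md mm' pmm' S1 K0) _.
  rewrite lee_fin ler_expR !ln_div ?posrE ?expR_gt0// expRK.
  have : (y * h - 1) * p (m - r') <= (y * h - 1) * (p m - r' * (v - c)).
    by rewrite ler_wpM2l// subr_ge0.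
  have -> : (y * h - 1) * (p m - r' * (v - c)) =
     y * h * p m - p m - h * r' * (y * (v - c)) + r' * (v - c) by ring.
  rewrite yc.
  move: (p (m - r')) (p m) (ln a) (ln 4) N2 => q1 q2 la l4 N2 H; lra.
apply: le_trans (tilted_lower_bound hpsi md (ltW S0) mE mE1 Hb I1 I2).
rewrite lee_fin ler_expR /b.
have : (m * y * D) * h <= e / 2 * h by rewrite ler_wpM2r// ltW.
move: (p m) (ln 2) N3 => q l2 N3 H; lra.
Unshelve. all: by end_near. Qed.

End asymptotic_lower_bounds.

(** * Events of the clock *)

Section clock_events.
Context {d} {T : measurableType d} {R : realType}.
Variables (P : probability T R) (xi : R -> {RV P >-> R}).
Hypothesis hxi : levy_from_zero xi.
Variable psi : R -> \bar R.
Hypothesis hpsi : laplace_exponent xi psi.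
Hypothesis dom0 : dom psi 0.
Hypothesis dpsi0 : 0 < dpsi psi 0.
Variable a : R.
Hypothesis a0 : 0 < a.
Local Notation p := (fine \o psi).
Local Notation A S w := (exp_functional (xi ^~ w) S).

Let cxi w : cadlag (xi ^~ w).
Proof. by case: hxi. Qed.

Definition clock_ratio (t : R) (w : T) : R := lamperti_time (xi ^~ w) (t / a) / ln t.
Local Notation Z := clock_ratio.

Lemma pssmp_law_scaled_clock (t : R) (B : set R) : 0 <= t ->
  pssmp_law xi a [set X | B (scaled_clock X t)] = P [set w | B (Z t w)].
Proof.
move=> t0; rewrite /pssmp_law; congr (P _); apply/seteqP; split => w /=;
  by rewrite /scaled_clock pssmp_clock_lamperti.
Qed.

Lemma laplace_exponent_neg : exists2 m : R, m < 0 & dom psi m /\ p m < 0.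
Proof.
have e0 : 0 < dpsi psi 0 / 2 by rewrite divr_gt0.
have [r r0 /(_ r r0 (lexx r)) [_ rd _ rp]] := laplace_exponent_step hpsi dom0 e0.
exists (- r); first by rewrite oppr_lt0.
move: rd rp; rewrite sub0r [p 0]/= (laplace_exponent0 hpsi) => rd rp; split => //.
apply: le_lt_trans rp _; rewrite sub0r oppr_lt0 mulr_gt0//.
by rewrite subr_gt0 ltr_pdivrMr// ltr_pMr// ltr1n.
Qed.

(** The paths on which [lamperti_time] at level [K] is the infimum of the empty set, so that the
    clock is not the inverse of the functional. *)
Definition bounded_functional (K : R) : set T :=
  [set w | forall n : nat, A n%:R w < K].

Lemma bounded_functional_measurable K : measurable (bounded_functional K).
Proof.
rewrite (_ : bounded_functional K = \bigcap_n [set w | (A n%:R w < K)%R]); last first.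
  by apply/seteqP; split => w /= H n; [move=> _|]; apply: H.
by apply: bigcapT_measurable => n; exact: exp_functional_lt_measurable.
Qed.

(** Positive drift provides some [m < 0] with [p m < 0], and the Chernoff bound for {A(n) <= K} then
    decays exponentially in [n]. *)
Lemma bounded_functional_null K : 0 < K -> P (bounded_functional K) = 0%E.
Proof.
move=> K0; have [m m0 [md pm0]] := laplace_exponent_neg.
apply/eqP; rewrite eq_le measure_ge0 andbT; apply/lee_addgt0Pr => e e0.
(* The threshold from which the Chernoff exponent at horizon [n] is at most [ln e]. *)
rewrite add0e; pose k : R := - m * ln K - p m - ln e.
have [n nk] : exists n : nat, 1 <= n%:R :> R /\ k <= n%:R * - p m.
  exists (Num.truncn (k / - p m)).+1; split; first by rewrite ler1n.
  by rewrite -ler_pdivrMr ?oppr_gt0//; apply/ltW; exact: truncnS_gt.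
have pm0' : p m <= p 0 by rewrite [p 0]/= (laplace_exponent0 hpsi) ltW.
have := tilted_exp_functional_le hxi hpsi md dom0 (ltW m0) pm0' nk.1 K0.
move=> H; apply: (@le_trans _ _ (P [set w | (A n%:R w <= K)%R])).
  apply: le_measure; rewrite ?inE.
  - exact: bounded_functional_measurable.
  - exact: exp_functional_le_measurable.
  - by move=> w /= /(_ n)/ltW.
have : (P [set w | (A n%:R w <= K)%R] =
    \int[P]_(w in [set w | (A n%:R w <= K)%R]) (expR (0 * xi n%:R w))%:E)%E.
  under eq_integral do rewrite mul0r expR0.
  by rewrite integral_cst ?mul1e//; exact: exp_functional_le_measurable.
move=> ->; apply: (le_trans H).
rewrite lee_fin -[leRHS]lnK ?posrE// ler_expR [p 0]/= (laplace_exponent0 hpsi)/=.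
case: nk => _; rewrite /k/=; move: (ln K) (ln e) (fine _) => x y z; lra.
Qed.

Lemma clock_ratio_ge0 (t : R) w : 1 <= t -> 0 <= Z t w.
Proof. by move=> t1; rewrite divr_ge0 ?lamperti_time_ge0 ?ln_ge0. Qed.

Lemma clock_ratio_gt (t y : R) w : 1 < t -> 0 <= y ->
  (y < Z t w) = (A (y * ln t) w < t / a) && ~~ `[< bounded_functional (t / a) w >].
Proof.
move=> t1 y0; have t0 : 0 < t by apply: lt_trans t1.
have h0 : 0 < ln t by rewrite ln_gt0.
rewrite /Z ltr_pdivlMr// lt_lamperti_time//; first last.
- by rewrite divr_ge0// ltW.
- by rewrite mulr_ge0// ltW.
congr (_ && _); apply/asboolP/negP => [[n H] /asboolP/(_ n)|H].
  by rewrite ltNge H.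
apply/not_existsP => H'; apply: H; apply/asboolP => n.
by rewrite ltNge; apply/negP; exact: H'.
Qed.

Lemma clock_ratio_ge_sub (t y : R) w : 1 < t -> 0 <= y -> y <= Z t w ->
  A (y * ln t) w <= t / a.
Proof.
move=> t1 y0 yZ; have t0 : 0 < t by apply: lt_trans t1.
have h0 : 0 < ln t by rewrite ln_gt0.
have ta0 : 0 <= t / a by rewrite divr_ge0// ltW.
have yh0 : 0 <= y * ln t by rewrite mulr_ge0// ltW.
have [//|Ay] := leP (A (y * ln t) w) (t / a).
have [tt /andP[tau0 tauy]] := lamperti_timeK (cxi w) yh0 ta0 (ltW Ay).
have : y * ln t <= lamperti_time (xi ^~ w) (t / a) by rewrite -ler_pdivlMr.
by move=> /(exp_functional_le (cxi w) yh0); rewrite tt leNgt Ay.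
Qed.

Lemma clock_ratio_gt_measurable (t y : R) : 1 < t -> measurable [set w | y < Z t w].
Proof.
move=> t1; have [y0|y0] := leP 0 y; last first.
  rewrite (_ : [set w | _] = setT)//; apply/seteqP; split => // w _ /=.
  by rewrite (lt_le_trans y0)// clock_ratio_ge0// ltW.
rewrite (_ : [set w | _] = [set w | (A (y * ln t) w < t / a)%R] `\`
    bounded_functional (t / a)); last first.
  apply/seteqP; split => w /=; rewrite clock_ratio_gt//.
    by move=> /andP[-> /negP H]; split => // H'; apply: H; apply/asboolP.
  by move=> [-> H]; apply/negP => /asboolP.
apply: measurableD; first exact: exp_functional_lt_measurable.
exact: bounded_functional_measurable.
Qed.

Lemma clock_ratio_measurable (t : R) : 1 < t -> measurable_fun setT (Z t).
Proof.
move=> t1; apply: (measurability (@RGenOInfty.G R)) => [|/= _ [_] [r] -> <-].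
  exact: RGenOInfty.measurableE.
rewrite setTI (_ : _ @^-1` _ = [set w | r < Z t w]).
  exact: clock_ratio_gt_measurable.
by apply/seteqP; split => w /=; rewrite in_itv/= andbT.
Qed.

Lemma clock_ratio_set_measurable (t : R) (B : set R) : 1 < t -> measurable B ->
  measurable [set w | B (Z t w)].
Proof. by move=> t1 mB; have := clock_ratio_measurable t1 measurableT mB; rewrite setTI. Qed.

Lemma prob_clock_ratio_gt (t y : R) : 1 < t -> 0 <= y ->
  P [set w | y < Z t w] = P [set w | (A (y * ln t) w < t / a)%R].
Proof.
move=> t1 y0; have t0 : 0 < t by apply: lt_trans t1.
have mE := exp_functional_lt_measurable hxi (y * ln t) (t / a).
have mN := bounded_functional_measurable (t / a).
apply/eqP; rewrite eq_le; apply/andP; split.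
  apply: le_measure; rewrite ?inE//; first exact: clock_ratio_gt_measurable.
  by move=> w /=; rewrite clock_ratio_gt// => /andP[].
rewrite -[leRHS]adde0 -(bounded_functional_null (divr_gt0 t0 a0)).
apply: le_trans (measureU2 _ _ _); last 2 first.
- exact: clock_ratio_gt_measurable.
- exact: mN.
apply: le_measure; rewrite ?inE//.
  by apply: measurableU => //; exact: clock_ratio_gt_measurable.
move=> w /= Aw; have [?|?] := pselect (bounded_functional (t / a) w); [by right|left].
by rewrite clock_ratio_gt// Aw; apply/negP => /asboolP.
Qed.

Lemma prob_clock_ratio_ge (t y : R) : 1 < t -> 0 <= y ->
  (P [set w | (y <= Z t w)%R] <= P [set w | (A (y * ln t) w <= t / a)%R])%E.
Proof.
move=> t1 y0; apply: le_measure; rewrite ?inE.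
- rewrite (_ : [set w | _] = [set w | `[y, +oo[%classic (Z t w)]).
    exact: clock_ratio_set_measurable.
  by apply/seteqP; split => w /=; rewrite in_itv/= andbT.
- exact: exp_functional_le_measurable.
- by move=> w /=; exact: clock_ratio_ge_sub.
Qed.

Lemma prob_clock_ratio_le (t y : R) : 1 < t -> 0 <= y ->
  P [set w | Z t w <= y] = P [set w | t / a <= A (y * ln t) w].
Proof.
move=> t1 y0.
have -> : [set w | Z t w <= y] = ~` [set w | y < Z t w].
  by apply/seteqP; split => w /=; rewrite leNgt => /negP.
have -> : [set w | t / a <= A (y * ln t) w] = ~` [set w | (A (y * ln t) w < t / a)%R].
  by apply/seteqP; split => w /=; rewrite leNgt => /negP.
rewrite !probability_setC ?prob_clock_ratio_gt//.
- exact: exp_functional_lt_measurable.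
- exact: clock_ratio_gt_measurable.
Qed.

End clock_events.

Lemma near_ln (R : realType) (Q : R -> Prop) :
  (\forall h \near pinfty_nbhs R, Q h) ->
  \forall t \near pinfty_nbhs R, [/\ Q (ln t), 1 < t & t = expR (ln t)].
Proof.
move=> [M [Mr MQ]]; near=> t.
have t0 : 0 < t by near: t; apply: nbhs_pinfty_gt; exact: num_real.
have t1 : 1 < t by near: t; apply: nbhs_pinfty_gt; exact: num_real.
split => //; last by rewrite lnK.
apply: MQ; rewrite -(expRK M) ltr_ln ?posrE ?expR_gt0//.
Unshelve. all: by end_near. Qed.

(** * Upper bounds for the tails of the clock *)

Section clock_rates.
Context {d} {T : measurableType d} {R : realType}.
Variables (P : probability T R) (xi : R -> {RV P >-> R}).
Hypothesis hxi : levy_from_zero xi.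
Variables (psi : R -> \bar R) (mm mp : \bar R).
Hypothesis hpsi : laplace_exponent xi psi.
Hypothesis hdom : dom psi = [set m | (mm < m%:E < mp)%E].
Hypothesis dom0 : dom psi 0.
Hypothesis dpsi0 : 0 < dpsi psi 0.
Variable a : R.
Hypothesis a0 : 0 < a.
Local Notation p := (fine \o psi).
Local Notation v0 := (dpsi psi 0).
Local Notation A S w := (exp_functional (xi ^~ w) S).
Local Notation Z := (clock_ratio xi a).
Local Notation Ms m := (m_zero psi < m%:E < mp)%E.

Let p0 : p 0 = 0.
Proof. by rewrite /= (laplace_exponent0 hpsi). Qed.

Let mp0 : (0 < mp)%E.
Proof. by move: dom0; rewrite hdom /= => /andP[]. Qed.

Lemma m_zero_ltP m : (m_zero psi < m%:E)%E ->
  exists2 u, u < m & dom psi u /\ 0 < dpsi psi u.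
Proof.
by move=> /ereal_inf_lt [_ [u [ud u0] <-]]; rewrite lte_fin => um; exists u.
Qed.

Lemma m_zero_le u : dom psi u -> 0 < dpsi psi u -> (m_zero psi <= u%:E)%E.
Proof. by move=> ud u0; apply: ereal_inf_lbound; exists u. Qed.

Lemma tilt_dom m : Ms m -> dom psi m /\ 0 < dpsi psi m.
Proof.
move=> /andP[/m_zero_ltP[u um [ud u0]] mmp].
have md : dom psi m.
  rewrite hdom /= mmp andbT; move: ud; rewrite hdom /= => /andP[+ _].
  by move/lt_trans; apply; rewrite lte_fin.
by split => //; apply: lt_le_trans u0 _; apply: (dpsi_nondecreasing hpsi) => //; exact: ltW.
Qed.

Lemma dom_itv m u z : dom psi m -> dom psi z -> m <= u <= z -> dom psi u.
Proof.
rewrite hdom /= => /andP[m1 _] /andP[_ z2] /andP[mu uz]; apply/andP; split.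
  by apply: lt_le_trans m1 _; rewrite lee_fin.
by apply: le_lt_trans z2; rewrite lee_fin.
Qed.

(** Two tangent inequalities replace continuity of [dpsi] at 0: the exponent rises by at least v0
    r/4 from -r to -r/4, so its slope at -r/4 is positive. *)
Lemma m_zero_lt0 : (m_zero psi < 0)%E.
Proof.
have e0 : 0 < v0 / 2 by rewrite divr_gt0.
have [r r0 /(_ r r0 (lexx r)) [_ rd _ rp]] := laplace_exponent_step hpsi dom0 e0.
rewrite p0 !sub0r in rd rp.
have r4 : - r <= - (r / 4) by lra.
have ud : dom psi (- (r / 4)) by apply: (dom_itv rd dom0); lra.
apply: (@le_lt_trans _ _ (- (r / 4))%:E); last by rewrite lte_fin; lra.
apply: m_zero_le => //.
have := laplace_exponent_tangent hpsi ud dom0; rewrite p0 => t1.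
have := laplace_exponent_tangent hpsi rd ud => t2.
have : dpsi psi (- (r / 4)) * (3 * r / 4) >= v0 * r / 4.
  move: t1 t2 rp; move: (p (- (r / 4))) (p (- r)) (dpsi psi (- (r / 4))) v0 => *; lra.
move=> H; have : 0 < dpsi psi (- (r / 4)) * (3 * r / 4).
  by apply: lt_le_trans H; rewrite divr_gt0// mulr_gt0.
by rewrite pmulr_lgt0// divr_gt0// mulr_gt0.
Qed.

Lemma tilt0 : Ms 0.
Proof. by rewrite m_zero_lt0. Qed.

Lemma rate_ge m y : Ms m -> ((m - y * p m)%:E <= rate psi mp y)%E.
Proof. by move=> mM; apply: ereal_sup_ubound; exists m. Qed.

Lemma rate_ge0 y : (0 <= rate psi mp y)%E.
Proof. by have := rate_ge y tilt0; rewrite p0 mulr0 subr0. Qed.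

Lemma rate_gtP y c : (c%:E < rate psi mp y)%E -> exists2 m, Ms m & c < m - y * p m.
Proof. by move=> /ereal_sup_gt [_ [m mM <-]]; rewrite lte_fin => cm; exists m. Qed.

Lemma exponent_ge m : dom psi m -> v0 * m <= p m.
Proof. by move=> md; have := laplace_exponent_tangent hpsi md dom0; rewrite p0 add0r subr0. Qed.

Lemma exponent_le m : dom psi m -> p m <= m * dpsi psi m.
Proof.
move=> md; have := laplace_exponent_tangent hpsi dom0 md; rewrite p0.
by move: (p m) (dpsi psi m) => *; lra.
Qed.

Lemma exponent_sign m : Ms m -> m <= 0 -> p m <= 0.
Proof.
move=> /tilt_dom [md d0] m0; apply: le_trans (exponent_le md) _.
by rewrite mulr_le0_ge0// ltW.
Qed.

Let expR_le1 (h c x : R) : 0 <= h -> 0 <= c -> x <= 1 -> x <= expR (h * c).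
Proof. by move=> h0 c0 x1; apply: (le_trans x1); rewrite -expR0 ler_expR mulr_ge0. Qed.

Lemma probability_le_expR (c t : R) (E : set T) : 1 < t -> 0 <= c -> measurable E ->
  (P E <= (expR (ln t * c))%:E)%E.
Proof.
move=> t1 c0 mE; apply: le_trans (probability_le1 P mE) _.
by rewrite lee_fin; apply: expR_le1 => //; rewrite ln_ge0// ltW.
Qed.

Let mZ (t : R) (B : set R) : 1 < t -> measurable B -> measurable [set w | B (Z t w)].
Proof. exact: (clock_ratio_set_measurable hxi a0). Qed.

Lemma clock_ratio_ge_measurable (t y : R) : 1 < t -> measurable [set w | (y <= Z t w)%R].
Proof.
move=> t1; rewrite (_ : [set w | _] = [set w | `[y, +oo[%classic (Z t w)]).
  exact: mZ.
by apply/seteqP; split => w /=; rewrite in_itv/= andbT.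
Qed.

Lemma clock_ratio_le_measurable (t y : R) : 1 < t -> measurable [set w | (Z t w <= y)%R].
Proof.
move=> t1; rewrite (_ : [set w | _] = [set w | `]-oo, y]%classic (Z t w)]).
  exact: mZ.
by apply/seteqP; split => w /=; rewrite in_itv.
Qed.

Lemma clock_upper_right m y c : dom psi m -> m <= 0 -> p m <= 0 -> 0 < y ->
  - m + y * p m < c ->
  \forall t \near pinfty_nbhs R, (P [set w | (y <= Z t w)%R] <= (expR (ln t * c))%:E)%E.
Proof.
move=> md m0 pm0 y0 mc.
have e0 : 0 < c - (- m + y * p m) by rewrite subr_gt0.
have := near_ln (prob_exp_functional_le_upper hxi hpsi dom0 md m0 pm0 y0 a0 e0).
apply: filterS => t [H t1 tE].
apply: le_trans (prob_clock_ratio_ge hxi a0 t1 (ltW y0)) _.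
by move: H; rewrite -tE [- m + _ + _]addrC subrK.
Qed.

Lemma clock_upper_left m y c : dom psi m -> 0 <= m -> 0 <= p m -> 0 < y ->
  - m + y * p m < c ->
  \forall t \near pinfty_nbhs R, (P [set w | (Z t w <= y)%R] <= (expR (ln t * c))%:E)%E.
Proof.
move=> md m0 pm0 y0 mc.
have e0 : 0 < c - (- m + y * p m) by rewrite subr_gt0.
have := near_ln (prob_exp_functional_ge_upper hxi hpsi dom0 md m0 pm0 y0 a0 e0).
apply: filterS => t [H t1 tE].
rewrite (prob_clock_ratio_le hxi hpsi dom0 dpsi0 a0 t1 (ltW y0)).
by move: H; rewrite -tE [- m + _ + _]addrC subrK.
Qed.

(** A near-maximiser [m <= 0] of the rate serves in the Chernoff bound. To the right of 1/v0 an
    [m > 0] contributes [m - y * p m <= 0], in which case [c >= 0] and the bound is trivial. *)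
Lemma clock_rate_upper_right y c : 0 < y -> 1 <= y * v0 ->
  (- rate psi mp y < c%:E)%E ->
  \forall t \near pinfty_nbhs R, (P [set w | (y <= Z t w)%R] <= (expR (ln t * c))%:E)%E.
Proof.
move=> y0 yv; rewrite lteNl -EFinN => /rate_gtP [m mM mc].
have [md d0] := tilt_dom mM; have [m0|m0] := leP m 0.
  apply: (@clock_upper_right m) => //; first exact: exponent_sign.
  by rewrite addrC; lra.
have c0 : 0 <= c.
  have H : m <= y * p m.
    apply: le_trans (_ : y * (v0 * m) <= _); last by rewrite ler_pM2l// exponent_ge.
    by rewrite mulrA ler_peMl// ltW.
  by move: mc; move: (y * p m) H => *; lra.
near=> t; apply: probability_le_expR => //; last apply: clock_ratio_ge_measurable; near: t;
  apply: nbhs_pinfty_gt; exact: num_real.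
Unshelve. all: by end_near. Qed.

Lemma clock_rate_upper_left y c : 0 <= y -> y * v0 <= 1 ->
  (- rate psi mp y < c%:E)%E ->
  \forall t \near pinfty_nbhs R, (P [set w | (Z t w <= y)%R] <= (expR (ln t * c))%:E)%E.
Proof.
(* The level 0 can be an end of Delta; there the event would require [A 0 = 0] to reach
   [t / a > 0]. *)
rewrite le_eqVlt => /predU1P[<- _ _|y0 yv].
  near=> t; have t1 : 1 < t by near: t; apply: nbhs_pinfty_gt; exact: num_real.
  rewrite (prob_clock_ratio_le hxi hpsi dom0 dpsi0 a0 t1 (lexx 0)).
  rewrite (_ : [set w | _] = set0) ?measure0 ?lee_fin ?expR_ge0//.
  rewrite -subset0 => w /=; rewrite mul0r exp_functional0 leNgt => /negP; apply.
  by rewrite divr_gt0// (lt_trans _ t1).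
rewrite lteNl -EFinN => /rate_gtP [m mM mc].
have [md d0] := tilt_dom mM; have [m0|m0] := leP 0 m.
  apply: (@clock_upper_left m) => //; last by rewrite addrC; lra.
  by apply: le_trans (exponent_ge md); rewrite mulr_ge0// ltW.
have c0 : 0 <= c.
  have H : m <= y * p m.
    apply: le_trans (_ : y * (v0 * m) <= _); last by rewrite ler_pM2l// exponent_ge.
    by rewrite mulrA; nra.
  by move: mc; move: (y * p m) H => *; lra.
near=> t; apply: probability_le_expR => //; last apply: clock_ratio_le_measurable; near: t;
  apply: nbhs_pinfty_gt; exact: num_real.
Unshelve. all: by end_near. Qed.

End clock_rates.

Lemma near_expRD_le (R : realType) (x1 x2 B : R) : x1 < B -> x2 < B ->
  \forall h \near pinfty_nbhs R, expR (h * x1) + expR (h * x2) <= expR (h * B).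
Proof.
move=> x1B x2B; pose k := Num.min (B - x1) (B - x2).
have k0 : 0 < k by rewrite lt_min !subr_gt0 x1B.
near=> h.
have h0 : 0 <= h by near: h; exact: near_pinfty_ge.
have hk : ln 2 <= k * h by near: h; exact: near_linear_ge.
have k1 : k <= B - x1 by rewrite ge_min lexx.
have k2 : k <= B - x2 by rewrite ge_min lexx orbT.
have half x : k <= B - x -> expR (h * x) <= expR (h * B) / 2.
  move=> kx; rewrite -[X in _ / X](@lnK R) ?posrE// -expRB ler_expR.
  have : h * k <= h * (B - x) by rewrite ler_wpM2l.
  lra.
by have := half _ k1; have := half _ k2; lra.
Unshelve. all: by end_near. Qed.

(** * Lower bounds for windows and concentration of the clock *)

Section clock_rates_lower.
Context {d} {T : measurableType d} {R : realType}.
Variables (P : probability T R) (xi : R -> {RV P >-> R}).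
Hypothesis hxi : levy_from_zero xi.
Variables (psi : R -> \bar R) (mm mp : \bar R).
Hypothesis hpsi : laplace_exponent xi psi.
Hypothesis hdom : dom psi = [set m | (mm < m%:E < mp)%E].
Hypothesis dom0 : dom psi 0.
Hypothesis dpsi0 : 0 < dpsi psi 0.
Variable a : R.
Hypothesis a0 : 0 < a.
Local Notation p := (fine \o psi).
Local Notation v0 := (dpsi psi 0).
Local Notation A S w := (exp_functional (xi ^~ w) S).
Local Notation Z := (clock_ratio xi a).
Local Notation Ms m := (m_zero psi < m%:E < mp)%E.

Lemma near_gt1 : \forall t \near pinfty_nbhs R, (1 : R) < t.
Proof. by apply: nbhs_pinfty_gt; exact: num_real. Qed.

(** Removing from [E] an event of strictly smaller exponential order leaves its lower bound intact
    up to an arbitrarily small loss in the exponent. *)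
Lemma window_lower (E F W : R -> set T) (B x c : R) : x < B -> c < B ->
  (forall t, 1 < t -> [/\ measurable (E t), measurable (F t) & measurable (W t)]) ->
  (forall t, 1 < t -> E t `<=` W t `|` F t) ->
  (\forall t \near pinfty_nbhs R, ((expR (ln t * B))%:E <= P (E t))%E) ->
  (\forall t \near pinfty_nbhs R, (P (F t) <= (expR (ln t * x))%:E)%E) ->
  \forall t \near pinfty_nbhs R, ((expR (ln t * c))%:E <= P (W t))%E.
Proof.
move=> xB cB mEFW EWF HE HF.
have := near_ln (near_expRD_le cB xB) => HS.
apply: filterS3 HS HE HF => t [S t1 _] HEt HFt.
have [mE mF mW] := mEFW t t1.
have : ((expR (ln t * B))%:E <= P (W t) + P (F t))%E.
  have U2 : (P (W t `|` F t) <= P (W t) + P (F t))%E by exact: measureU2.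
  apply: (le_trans HEt); apply: le_trans U2.
  by apply: le_measure; rewrite ?inE//; [exact: measurableU|exact: EWF].
have PW : P (W t) = (fine (P (W t)))%:E by rewrite fineK// fin_num_measure.
move: HFt; have -> : P (F t) = (fine (P (F t)))%:E by rewrite fineK// fin_num_measure.
rewrite PW -EFinD !lee_fin => H1 H2.
rewrite -(lerD2r (expR (ln t * x))); apply: (le_trans S); apply: (le_trans H2).
by rewrite lerD2l.
Qed.

Let mZ (t : R) (B : set R) : 1 < t -> measurable B -> measurable [set w | B (Z t w)].
Proof. exact: (clock_ratio_set_measurable hxi a0). Qed.

Lemma clock_ratio_oo_measurable (t y z : R) : 1 < t -> measurable [set w | (y < Z t w < z)%R].
Proof.
move=> t1; rewrite (_ : [set w | _] = [set w | `]y, z[%classic (Z t w)]).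
  exact: mZ.
by apply/seteqP; split => w /=; rewrite in_itv.
Qed.

Lemma clock_ratio_oc_measurable (t y z : R) : 1 < t -> measurable [set w | (y < Z t w <= z)%R].
Proof.
move=> t1; rewrite (_ : [set w | _] = [set w | `]y, z]%classic (Z t w)]).
  exact: mZ.
by apply/seteqP; split => w /=; rewrite in_itv.
Qed.

Lemma clock_ratio_cc_measurable (t y z : R) : 1 < t -> measurable [set w | (y <= Z t w <= z)%R].
Proof.
move=> t1; rewrite (_ : [set w | _] = [set w | `[y, z]%classic (Z t w)]).
  exact: mZ.
by apply/seteqP; split => w /=; rewrite in_itv.
Qed.

Lemma rate_finP y c : (c%:E < - rate psi mp y)%E ->
  exists2 r, rate psi mp y = r%:E & c < - r.
Proof.
move=> cr; have := rate_ge0 hpsi hdom dom0 dpsi0 y; move: cr.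
case: (rate psi mp y) => [r| |] //= cr _; exists r => //.
Qed.

(** The slope equation is solved at a point [y'] strictly between [y] and [z]. The resulting [m]
    makes {Z > y} typical, is strictly negative even for [y = 1 / v0], and also serves in the
    Chernoff bound that discards {Z >= z}. *)
Lemma clock_rate_lower_right y z m1 c : 0 < y -> 1 <= y * v0 -> Ms m1 ->
  y * dpsi psi m1 < 1 -> y < z -> (c%:E < - rate psi mp y)%E ->
  \forall t \near pinfty_nbhs R,
    ((expR (ln t * c))%:E <= P [set w | (y < Z t w < z)%R])%E.
Proof.
move=> y0 yv mM1 yd1 yz /rate_finP [r rE cr].
have [md1 d10] := tilt_dom hpsi hdom mM1.
have m10 : m1 < 0.
  rewrite ltNge; apply/negP => m1ge; move: yd1; rewrite ltNge => /negP; apply.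
  apply: (le_trans yv); rewrite ler_pM2l//.
  exact: (dpsi_nondecreasing hpsi).
pose e := (- c - r) / 3.
have e0 : 0 < e by rewrite /e; lra.
have eE : 3 * e = - c - r by rewrite /e; field.
clearbody e.
(* The three terms keep [y' = y + D] below [z], make the loss -m D/y' at most [e], and place 1/y'
   above [dpsi psi m1], so that the slope equation is solvable between [m1] and 0. *)
pose D := Num.min (Num.min ((z - y) / 2) (e * y / - m1)) (((dpsi psi m1)^-1 - y) / 2).
have D0 : 0 < D.
  rewrite !lt_min !divr_gt0 ?mulr_gt0 ?subr_gt0 ?oppr_gt0//.
  by rewrite -[_^-1]mul1r ltr_pdivlMr.
have D1 : D <= (z - y) / 2 by rewrite !ge_min lexx.
have D2 : - m1 * D <= e * y.
  by rewrite mulrC -ler_pdivlMr ?oppr_gt0// !ge_min lexx orbT.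
have D3 : D <= ((dpsi psi m1)^-1 - y) / 2 by rewrite ge_min lexx orbT.
clearbody D; pose y' := y + D.
have y'0 : 0 < y' by rewrite /y' addr_gt0.
have yy' : y < y' by rewrite /y' ltrDl.
have y'z : y' < z by rewrite /y'; lra.
have y'd : dpsi psi m1 < y'^-1.
  rewrite -[y'^-1]mul1r ltr_pdivlMr// mulrC -ltr_pdivlMr// div1r /y'.
  have : y < (dpsi psi m1)^-1 by rewrite -[_^-1]mul1r ltr_pdivlMr.
  move: ((dpsi psi m1)^-1) D3 => q D3; lra.
have y'v : y'^-1 < v0.
  rewrite -[y'^-1]mul1r ltr_pdivrMr// mulrC; apply: (le_lt_trans yv).
  by rewrite ltr_pM2r.
have [m /andP[m1m mlt0] dm] := dpsi_ivt hpsi (ltW m10)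
  (fun u hu => dom_itv hdom md1 dom0 hu) y'd y'v.
have mM : Ms m.
  have /andP[h1 _] := mM1; have /andP[_ h2] := tilt0 hpsi hdom dom0 dpsi0.
  rewrite (lt_trans h1) ?lte_fin//; apply: lt_trans h2; by rewrite lte_fin.
have [md d0] := tilt_dom hpsi hdom mM.
have pm0 := exponent_sign hpsi hdom dom0 mM (ltW mlt0).
have pml := exponent_le hpsi dom0 md.
(* [L] is the exponent of the lower bound for {Z > y} and [U] that of the upper bound for {Z >= z}.
   The inequality [p m <= m * dpsi psi m] turns [y' < z] into [U < L]. *)
pose L := y * p m - y * m * dpsi psi m.
pose U := - m + z * p m.
have UL : U < L.
  rewrite -subr_gt0.
  have -> : L - U = m * (y' - y) * y'^-1 - (z - y) * p m.
    by rewrite /L /U dm; field; rewrite gt_eqF.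
  rewrite dm in pml.
  have H1 : (z - y) * p m <= (z - y) * (m * y'^-1) by rewrite ler_pM2l// subr_gt0.
  have H2 : 0 < - m * (z - y') * y'^-1.
    by rewrite !mulr_gt0 ?invr_gt0 ?subr_gt0 ?oppr_gt0.
  move: H1 H2; rewrite /y'; move: ((y + D)^-1) (p m) => q1 q2 *; lra.
have Lr : - r - e <= L.
  have H : m - y * p m <= r by rewrite -lee_fin -rE; exact: rate_ge.
  have -> : L = - (m - y * p m) + m * D * y'^-1.
    by rewrite /L dm /y'; field; rewrite gt_eqF.
  have : - m * D * y'^-1 <= e.
    rewrite ler_pdivrMr//; apply: (@le_trans _ _ (- m1 * D)).
      by rewrite ler_pM2r// lerN2 ltW.
    by apply: (le_trans D2); rewrite ler_pM2l// ltW.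
  move: H; move: (y'^-1) (y * p m) => *; lra.
pose g := (L - U) / 3.
have g0 : 0 < g by rewrite divr_gt0// subr_gt0.
pose e1 := Num.min e g.
have e10 : 0 < e1 by rewrite lt_min e0.
have yd : y * dpsi psi m < 1 by rewrite dm ltr_pdivrMr// mul1r.
have E1 : e1 <= e by rewrite ge_min lexx.
have E2 : e1 <= g by rewrite ge_min lexx orbT.
apply: (@window_lower (fun t => [set w | (y < Z t w)%R])
  (fun t => [set w | (z <= Z t w)%R]) _ (L - e1) (U + g + g / 2)).
- by rewrite /g in E2 *; move: E2 UL; clearbody L U e1; move=> *; lra.
- by move: E1 Lr eE; clearbody L e1 => *; lra.
- move=> t t1; split; [exact: clock_ratio_gt_measurable|exact: clock_ratio_ge_measurable|exact: clock_ratio_oo_measurable].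
- move=> t t1 w /= yw; have [zw|wz] := leP z (Z t w); first by right.
  by left; rewrite yw ?wz.
- have := near_ln (prob_exp_functional_lt_lower hxi hpsi md (ltW mlt0) d0 y0 yd a0 e10).
  apply: filterS => t [H t1 tE].
  by rewrite (prob_clock_ratio_gt hxi hpsi dom0 dpsi0 a0 t1 (ltW y0)); move: H; rewrite -tE.
- apply: (@clock_upper_right _ _ _ _ _ hxi _ hpsi dom0 _ a0 m) => //.
  + exact: ltW.
  + exact: lt_trans y0 yz.
  + by rewrite -/U -addrA ltrDl addr_gt0// divr_gt0.
Qed.

Lemma clock_rate_lower_left y z m2 c : 0 < z -> z < y -> y * v0 <= 1 -> Ms m2 ->
  1 < y * dpsi psi m2 -> (c%:E < - rate psi mp y)%E ->
  \forall t \near pinfty_nbhs R,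
    ((expR (ln t * c))%:E <= P [set w | (z < Z t w <= y)%R])%E.
Proof.
move=> z0 zy yv mM2 yd2 /rate_finP [r rE cr].
have y0 : 0 < y by exact: lt_trans zy.
have [md2 d20] := tilt_dom hpsi hdom mM2.
have m20 : 0 < m2.
  rewrite ltNge; apply/negP => m2le; move: yd2; rewrite ltNge => /negP; apply.
  apply: le_trans yv; rewrite ler_pM2l//.
  exact: (dpsi_nondecreasing hpsi).
pose e := (- c - r) / 3.
have e0 : 0 < e by rewrite /e; lra.
have eE : 3 * e = - c - r by rewrite /e; field.
clearbody e.
(* The first three terms play the same roles as on the right. The last one secures [U < L]: for
   [m > 0] the bound used is [v0 * m <= p m], so the gap is at least m(y - z)v0 - m D/y'. *)
pose D := Num.min (Num.min (Num.min ((y - z) / 2) (e * z / m2))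
  ((y - (dpsi psi m2)^-1) / 2)) (z * ((y - z) * v0 / 2)).
have D0 : 0 < D.
  rewrite !lt_min !divr_gt0 ?mulr_gt0 ?divr_gt0 ?mulr_gt0 ?subr_gt0//.
  by rewrite -[_^-1]mul1r ltr_pdivrMr.
have D1 : D <= (y - z) / 2 by rewrite !ge_min lexx.
have D2 : m2 * D <= e * z.
  by rewrite mulrC -ler_pdivlMr// !ge_min lexx orbT.
have D3 : D <= (y - (dpsi psi m2)^-1) / 2 by rewrite !ge_min lexx !orbT.
have D4 : D <= z * ((y - z) * v0 / 2) by rewrite ge_min lexx orbT.
clearbody D; pose y' := y - D.
have zy' : z < y' by rewrite /y'; lra.
have y'0 : 0 < y' by exact: lt_trans zy'.
have yy' : y' < y by rewrite /y' gtrBl.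
have y'd : y'^-1 < dpsi psi m2.
  rewrite -[y'^-1]mul1r ltr_pdivrMr// mulrC -ltr_pdivrMr// div1r /y'.
  have : (dpsi psi m2)^-1 < y by rewrite -[_^-1]mul1r ltr_pdivrMr.
  move: ((dpsi psi m2)^-1) D3 => q D3; lra.
have y'v : v0 < y'^-1.
  rewrite -[y'^-1]mul1r ltr_pdivlMr// mulrC; apply: lt_le_trans yv.
  by rewrite ltr_pM2r.
have [m /andP[mgt0 mm2] dm] := dpsi_ivt hpsi (ltW m20)
  (fun u hu => dom_itv hdom dom0 md2 hu) y'v y'd.
have mM : Ms m.
  have /andP[_ h1] := mM2; have /andP[h2 _] := tilt0 hpsi hdom dom0 dpsi0.
  rewrite (lt_trans h2) ?lte_fin//; apply: lt_trans h1; by rewrite lte_fin.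
have [md d0] := tilt_dom hpsi hdom mM.
have pmv := exponent_ge hpsi dom0 md.
have pm0 : 0 <= p m by apply: le_trans pmv; rewrite mulr_ge0// ltW.
pose L := y * p m - y * m * dpsi psi m.
pose U := - m + z * p m.
have DM : m * D * y'^-1 <= m * ((y - z) * v0 / 2).
  rewrite -mulrA ler_pM2l// ler_pdivrMr// mulrC; apply: (le_trans D4).
  by rewrite ler_wpM2r ?ltW// !mulr_gt0 ?invr_gt0 ?subr_gt0.
have UL : U < L.
  rewrite -subr_gt0.
  have -> : L - U = - (m * D * y'^-1) + (y - z) * p m.
    by rewrite /L /U dm /y'; field; rewrite gt_eqF.
  have H1 : (y - z) * (v0 * m) <= (y - z) * p m by rewrite ler_pM2l// subr_gt0.
  have H2 : 0 < m * ((y - z) * v0 / 2).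
    by rewrite !mulr_gt0 ?invr_gt0 ?subr_gt0.
  move: H1 H2 DM; move: (y'^-1) (p m) v0 => *; lra.
have Lr : - r - e <= L.
  have H : m - y * p m <= r by rewrite -lee_fin -rE; exact: rate_ge.
  have -> : L = - (m - y * p m) - m * D * y'^-1.
    by rewrite /L dm /y'; field; rewrite gt_eqF.
  have : m * D * y'^-1 <= e.
    rewrite ler_pdivrMr//; apply: (@le_trans _ _ (m2 * D)).
      by rewrite ler_pM2r// ltW.
    by apply: (le_trans D2); rewrite ler_pM2l// ltW.
  move: H; move: (y'^-1) (y * p m) => *; lra.
pose g := (L - U) / 3.
have g0 : 0 < g by rewrite divr_gt0// subr_gt0.
pose e1 := Num.min e g.
have e10 : 0 < e1 by rewrite lt_min e0.
have yd : 1 < y * dpsi psi m by rewrite dm ltr_pdivlMr// mul1r.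
have E1 : e1 <= e by rewrite ge_min lexx.
have E2 : e1 <= g by rewrite ge_min lexx orbT.
apply: (@window_lower (fun t => [set w | (Z t w <= y)%R])
  (fun t => [set w | (Z t w <= z)%R]) _ (L - e1) (U + g + g / 2)).
- by rewrite /g in E2 *; move: E2 UL; clearbody L U e1; move=> *; lra.
- by move: E1 Lr eE; clearbody L e1 => *; lra.
- move=> t t1; split; [exact: clock_ratio_le_measurable|exact: clock_ratio_le_measurable|exact: clock_ratio_oc_measurable].
- move=> t t1 w /= yw; have [zw|wz] := leP (Z t w) z; first by right.
  by left; rewrite yw ?wz.
- have := near_ln (prob_exp_functional_ge_lower hxi hpsi md (ltW mgt0) d0 y0 yd a0 e10).
  apply: filterS => t [H t1 tE].
  by rewrite (prob_clock_ratio_le hxi hpsi dom0 dpsi0 a0 t1 (ltW y0)); move: H; rewrite -tE.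
- apply: (@clock_upper_left _ _ _ _ _ hxi _ hpsi dom0 dpsi0 _ a0 m) => //.
  + exact: ltW.
  + by rewrite -/U -addrA ltrDl addr_gt0// divr_gt0.
Qed.

(** A small negative exponent -r suffices: to first order the Chernoff exponent is r(1 - y v0),
    which is negative. *)
Lemma clock_concentration_right y : 1 < y * v0 -> exists2 c, c < 0 &
  \forall t \near pinfty_nbhs R, (P [set w | (y <= Z t w)%R] <= (expR (ln t * c))%:E)%E.
Proof.
move=> yv; have y0 : 0 < y.
  by rewrite -(pmulr_lgt0 _ dpsi0) (lt_trans _ yv).
have e0 : 0 < (y * v0 - 1) / (2 * y) by rewrite divr_gt0 ?mulr_gt0// subr_gt0.
have [r r0 /(_ r r0 (lexx r)) [_ rd _ rp]] := laplace_exponent_step hpsi dom0 e0.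
rewrite [p 0]/= (laplace_exponent0 hpsi) !sub0r in rd rp.
have H : y * p (- r) <= - (r * ((y * v0 + 1) / 2)).
  have : y * p (- r) <= y * (- (r * (v0 - (y * v0 - 1) / (2 * y)))) by rewrite ler_pM2l.
  by move/le_trans; apply; rewrite le_eqVlt; apply/orP; left; apply/eqP; field; rewrite gt_eqF.
have H0 : r < r * ((y * v0 + 1) / 2) by rewrite ltr_pMr//; lra.
have pr0 : p (- r) <= 0.
  rewrite -(pmulr_rle0 _ y0); apply: (le_trans H).
  by rewrite oppr_le0 ltW// (lt_trans r0).
exists ((- - r + y * p (- r)) / 2).
  by move: (y * p (- r)) (r * ((y * v0 + 1) / 2)) H H0 => *; lra.
apply: (@clock_upper_right _ _ _ _ _ hxi _ hpsi dom0 _ a0 (- r)) => //.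
  by rewrite oppr_le0 ltW.
by move: (y * p (- r)) (r * ((y * v0 + 1) / 2)) H H0 => *; lra.
Qed.

Lemma clock_concentration_left y : 0 < y -> y * v0 < 1 -> exists2 c, c < 0 &
  \forall t \near pinfty_nbhs R, (P [set w | (Z t w <= y)%R] <= (expR (ln t * c))%:E)%E.
Proof.
move=> y0 yv.
have e0 : 0 < (1 - y * v0) / (2 * y) by rewrite divr_gt0 ?mulr_gt0// subr_gt0.
have [r r0 /(_ r r0 (lexx r)) [rd _ rp _]] := laplace_exponent_step hpsi dom0 e0.
rewrite [p 0]/= (laplace_exponent0 hpsi) !add0r in rd rp.
have H : y * p r <= r * ((y * v0 + 1) / 2).
  have : y * p r <= y * (r * (v0 + (1 - y * v0) / (2 * y))) by rewrite ler_pM2l.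
  by move/le_trans; apply; rewrite le_eqVlt; apply/orP; left; apply/eqP; field; rewrite gt_eqF.
have H0 : r * ((y * v0 + 1) / 2) < r by rewrite gtr_pMr//; lra.
exists ((- r + y * p r) / 2).
  by move: (y * p r) (r * ((y * v0 + 1) / 2)) H H0 => *; lra.
apply: (@clock_upper_left _ _ _ _ _ hxi _ hpsi dom0 dpsi0 _ a0 r) => //.
- exact: ltW.
- by apply: le_trans (exponent_ge hpsi dom0 rd); rewrite mulr_ge0// ltW.
by move: (y * p r) (r * ((y * v0 + 1) / 2)) H H0 => *; lra.
Qed.

Lemma clock_concentration y1 y2 c : y1 * v0 < 1 -> 1 < y2 * v0 -> c < 0 ->
  \forall t \near pinfty_nbhs R,
    ((expR (ln t * c))%:E <= P [set w | (y1 <= Z t w <= y2)%R])%E.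
Proof.
(* [y1] may be nonpositive, whereas the left tail bound needs a positive level below 1/v0. *)
move=> yv1 yv2 c0; pose z := Num.max y1 (v0^-1 / 2).
have z0 : 0 < z by rewrite lt_max divr_gt0 ?orbT// invr_gt0.
have zv : z * v0 < 1.
  rewrite -ltr_pdivlMr// div1r gt_max; apply/andP; split.
    by rewrite -div1r ltr_pdivlMr.
  by rewrite ltr_pdivrMr// ltr_pMr ?invr_gt0// ltr1n.
have [c1 c10 H1] := clock_concentration_left z0 zv.
have [c2 c20 H2] := clock_concentration_right yv2.
apply: (@window_lower (fun=> setT)
  (fun t => [set w | (Z t w <= z)%R] `|` [set w | (y2 <= Z t w)%R]) _ 0
  (Num.max c1 c2 / 2)) => //.
- by rewrite pmulr_llt0// gt_max c10.
- move=> t t1; split => //; last exact: clock_ratio_cc_measurable.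
  by apply: measurableU; [exact: clock_ratio_le_measurable|exact: clock_ratio_ge_measurable].
- move=> t t1 w _ /=; have [zw|wz] := leP (Z t w) z; first by right; left.
  have [yw|wy] := leP y2 (Z t w); first by right; right.
  by left; rewrite (ltW wy) andbT ltW// (le_lt_trans _ wz)// le_max lexx.
- by apply: nearW => t; rewrite mulr0 expR0 probability_setT.
- have x12 : Num.max c1 c2 < Num.max c1 c2 / 2.
    have : Num.max c1 c2 < 0 by rewrite gt_max c10.
    by move: (Num.max c1 c2) => x; lra.
  have x1 : c1 < Num.max c1 c2 / 2 by apply: le_lt_trans x12; rewrite le_max lexx.
  have x2 : c2 < Num.max c1 c2 / 2 by apply: le_lt_trans x12; rewrite le_max lexx orbT.
  have HS := near_ln (near_expRD_le x1 x2).
  apply: filterS3 HS H1 H2 => t [S t1 _] h1 h2.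
  apply: (@le_trans _ _ (P [set w | (Z t w <= z)%R] + P [set w | (y2 <= Z t w)%R])%E).
    by apply: measureU2; [exact: clock_ratio_le_measurable|exact: clock_ratio_ge_measurable].
  apply: (@le_trans _ _ ((expR (ln t * c1))%:E + (expR (ln t * c2))%:E)%E).
    exact: leeD.
  by rewrite -EFinD lee_fin.
Qed.

End clock_rates_lower.

(** * The interval Delta *)

Section ereal_limits.
Context {R : realType} {U : Type} (F : set_system U) {FF : ProperFilter F}.
Implicit Types (f : U -> \bar R) (l : \bar R).

Lemma ereal_cvg_bounds f l :
  (forall c : R, (c%:E < l)%E -> \forall x \near F, (c%:E <= f x)%E) ->
  (forall c : R, (l < c%:E)%E -> \forall x \near F, (f x <= c%:E)%E) ->
  f x @[x --> F] --> l.
Proof.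
case: l => [r| |] H1 H2.
- apply/fine_cvgP; split.
    have h1 := H1 (r - 1) _; have h2 := H2 (r + 1) _.
    near=> x; rewrite fin_real//; apply/andP; split.
      apply: (@lt_le_trans _ _ (r - 1)%:E); first by rewrite ltNyr.
      by near: x; apply: h1; rewrite lte_fin ltrBlDr ltrDl.
    apply: (@le_lt_trans _ _ (r + 1)%:E); last by rewrite ltry.
    by near: x; apply: h2; rewrite lte_fin ltrDl.
  apply/cvgrPdist_le => e e0.
  have h1 := H1 (r - e) _; have h2 := H2 (r + e) _.
  near=> x.
  have : ((r - e)%:E <= f x)%E.
    by near: x; apply: h1; rewrite lte_fin ltrBlDr ltrDl.
  have : (f x <= (r + e)%:E)%E.
    by near: x; apply: h2; rewrite lte_fin ltrDl.
  rewrite /comp/=; case: (f x) => [s| |] //=; rewrite !lee_fin => s2 s1.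
  by rewrite ler_norml; apply/andP; split; lra.
- by apply/cvgeyPge => c; apply: H1; rewrite ltry.
- by apply/cvgeNyPle => c; apply: H2; rewrite ltNyr.
Unshelve. all: by end_near. Qed.

(** The [lim] in [tau_plus] and [tau_zero] carries information only once the limit is known to
    exist, which here follows from monotonicity along the filter. *)
Lemma ereal_nonincreasing_is_cvg f (V : set U) : F V ->
  (forall x, V x -> \forall y \near F, (f y <= f x)%E) -> cvg (f x @[x --> F]).
Proof.
move=> FV H; apply/cvg_ex; exists (ereal_inf (f @` V)).
apply: ereal_cvg_bounds => c cl.
  apply: filterS FV => x Vx; apply: (le_trans (ltW cl)).
  by apply: ereal_inf_lbound; exists x.
have [_ [x Vx <-] fx] := ereal_inf_lt cl.
by apply: filterS (H x Vx) => y /le_trans; apply; exact: ltW.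
Qed.

Lemma ereal_nondecreasing_is_cvg f (V : set U) : F V ->
  (forall x, V x -> \forall y \near F, (f x <= f y)%E) -> cvg (f x @[x --> F]).
Proof.
move=> FV H; apply/cvg_ex; exists (ereal_sup (f @` V)).
apply: ereal_cvg_bounds => c cl; last first.
  apply: filterS FV => x Vx; apply: le_trans (ltW cl).
  by apply: ereal_sup_ubound; exists x.
have [_ [x Vx <-] fx] := ereal_sup_gt cl.
by apply: filterS (H x Vx) => y; apply: le_trans; exact: ltW.
Qed.

End ereal_limits.

Section delta.
Context {d} {T : measurableType d} {R : realType}.
Variables (P : probability T R) (xi : R -> {RV P >-> R}).
Variables (psi : R -> \bar R) (mm mp : \bar R).
Hypothesis hpsi : laplace_exponent xi psi.
Hypothesis hdom : dom psi = [set m | (mm < m%:E < mp)%E].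
Hypothesis dom0 : dom psi 0.
Hypothesis dpsi0 : 0 < dpsi psi 0.
Local Notation p := (fine \o psi).
Local Notation v0 := (dpsi psi 0).
Local Notation Ms m := (m_zero psi < m%:E < mp)%E.

Let tilt_ge m : dom psi m -> 0 <= m -> Ms m.
Proof.
move=> md m0; move: (md); rewrite hdom /= => /andP[_ ->]; rewrite andbT.
by apply: lt_le_trans (m_zero_lt0 hpsi hdom dom0 dpsi0) _; rewrite lee_fin.
Qed.

Let tilt_le m : (m_zero psi < m%:E)%E -> m <= 0 -> Ms m.
Proof.
move=> -> m0 /=; have /andP[_] := tilt0 hpsi hdom dom0 dpsi0.
by apply: le_lt_trans; rewrite lee_fin.
Qed.

Let dom_pos (m : R) : 0 <= m -> (m%:E < mp)%E -> dom psi m.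
Proof.
move=> m0 mmp; rewrite hdom /= mmp andbT; move: dom0; rewrite hdom /= => /andP[h _].
by apply: lt_le_trans h _; rewrite lee_fin.
Qed.

Let dpsi_mono m u : dom psi m -> dom psi u -> m <= u -> dpsi psi m <= dpsi psi u.
Proof. exact: (dpsi_nondecreasing hpsi). Qed.

(** By contradiction: if the slope never exceeds 1/z on the positive side, its limit at a finite
    [mp] does not either, and for [mp = +oo] the inequality [p m <= m * dpsi psi m] gives m/psi(m)
    >= z, also in the limit. *)
Lemma tau_plus_lt z : (tau_plus psi mp < z%:E)%E ->
  0 < z /\ exists2 m, Ms m & 1 < z * dpsi psi m.
Proof.
rewrite /tau_plus; have mp0 : (0 < mp)%E.
  by have /andP[] := tilt0 hpsi hdom dom0 dpsi0.
have none : ~ (exists2 m, Ms m & 1 < z * dpsi psi m) ->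
    forall m, 0 <= m -> (m%:E < mp)%E -> z * dpsi psi m <= 1.
  move=> H m m0 mmp; rewrite leNgt; apply/negP => zm; apply: H.
  by exists m => //; apply: tilt_ge => //; exact: dom_pos.
case E : mp mp0 => [r| |] // mp0.
- have r0 : 0 < r by rewrite -lte_fin.
  have V : \forall m \near r^'-, 0 < m < r.
    near=> m; apply/andP; split; near: m; [exact: nbhs_left_gt|exact: nbhs_left_lt].
  have Vd m : 0 < m < r -> dom psi m.
    by move=> /andP[m0 mr]; apply: dom_pos; rewrite ?ltW// E lte_fin.
  set f := (X in lim X).
  have cf : cvg f.
    apply: (ereal_nondecreasing_is_cvg V) => x xr; near=> y.
    rewrite lee_fin; apply: dpsi_mono; first exact: Vd.
      by apply: Vd; near: y.
    apply: ltW; near: y; apply: nbhs_left_gt; by case/andP: xr.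
  (* The limit is thus positive, and of the conventions for the inverse only the one at [+oo] comes
     into play. *)
  have L0 : (v0%:E <= lim f)%E.
    apply: lime_ge => //; near=> y; have y0 : 0 < y < r by near: y.
    by rewrite lee_fin; apply: dpsi_mono => //; [exact: Vd|case/andP: y0 => /ltW].
  have Lz : (forall m, 0 <= m -> (m%:E < mp)%E -> z * dpsi psi m <= 1) ->
      0 < z -> (lim f <= (z^-1)%:E)%E.
    move=> H z0; apply: lime_le => //; near=> y; have y0 : 0 < y < r by near: y.
    rewrite lee_fin -[z^-1]mul1r ler_pdivlMr// mulrC; case/andP: y0 => y0 yr.
    by apply: H; rewrite ?ltW// E lte_fin.
  case: (lim f) L0 Lz => [l| |] //.
  + rewrite lee_fin => l0 Lz; have lp : 0 < l by exact: lt_le_trans l0.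
    rewrite inver gt_eqF// lte_fin => lz.
    have z0 : 0 < z by apply: lt_trans lz; rewrite invr_gt0.
    split => //; rewrite -E; apply: contrapT => /none /Lz /(_ z0).
    have zl : z^-1 < l by rewrite invf_plt ?posrE.
    by rewrite lee_fin leNgt zl.
  + move=> _ Lz; rewrite invey lte_fin => z0; split => //; rewrite -E.
    by apply: contrapT => /none /Lz /(_ z0).
- have pm m : 0 < m -> [/\ dom psi m, 0 < p m & p m <= m * dpsi psi m].
    move=> m0; have md : dom psi m by apply: dom_pos; rewrite ?ltW// E ltry.
    split => //; last exact: (exponent_le hpsi dom0).
    by apply: lt_le_trans (exponent_ge hpsi dom0 md); rewrite mulr_gt0.
  set f := (X in lim X).
  have V : \forall m \near +oo, (0 : R) < m by exact: nbhs_pinfty_gt.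
  (* m/psi(m) is the reciprocal of the slope of the chord from the origin, which is nondecreasing in
     m by convexity. *)
  have cf : cvg f.
    apply: (ereal_nonincreasing_is_cvg V) => x x0; near=> y.
    have xy : x < y by near: y; apply: nbhs_pinfty_gt; exact: num_real.
    have [xd px pxd] := pm _ x0; have [yd py _] := pm _ (lt_trans x0 xy).
    rewrite lee_fin ler_pdivrMr// mulrAC ler_pdivlMr//.
    have := laplace_exponent_tangent hpsi yd xd.
    move: px py pxd; rewrite /=.
    move: (fine (psi x)) (fine (psi y)) (dpsi psi x) => a b c px py pxd H.
    have : x * (a + c * (y - x)) <= x * b by rewrite ler_pM2l.
    have : a * (y - x) <= x * c * (y - x) by rewrite ler_pM2r ?subr_gt0.
    by move=> *; lra.
  have L0 : (0 <= lim f)%E.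
    apply: lime_ge => //; near=> y; have y0 : 0 < y by near: y.
    by rewrite lee_fin divr_ge0 ?ltW//; case: (pm _ y0).
  move=> lz; have z0 : 0 < z by rewrite -lte_fin (le_lt_trans L0).
  split => //; rewrite -E; apply: contrapT => /none H; move: lz.
  rewrite ltNge => /negP; apply; apply: lime_ge => //; near=> y.
  have y0 : 0 < y by near: y.
  have [yd py pyd] := pm _ y0; rewrite lee_fin ler_pdivlMr//.
  apply: le_trans (_ : z * (y * dpsi psi y) <= _); first by rewrite ler_pM2l.
  by rewrite mulrCA ger_pMr//; apply: H; rewrite ?ltW// E ltry.
Unshelve. all: by end_near. Qed.

(** The same contradiction on the negative side, where m and psi(m) are both negative when
    [m_zero psi] is [-oo]. *)
Lemma tau_zero_gt z : 0 < z -> (z%:E < tau_zero psi)%E ->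
  exists2 m, Ms m & z * dpsi psi m < 1.
Proof.
move=> z0; have m00 := m_zero_lt0 hpsi hdom dom0 dpsi0.
have none : ~ (exists2 m, Ms m & z * dpsi psi m < 1) ->
    forall m, (m_zero psi < m%:E)%E -> m <= 0 -> 1 <= z * dpsi psi m.
  move=> H m m1 m2; rewrite leNgt; apply/negP => zm; apply: H.
  by exists m => //; exact: tilt_le.
rewrite /tau_zero; case E : (m_zero psi) m00 => [r| |] // m00.
- have r0 : r < 0 by rewrite -lte_fin.
  have V : \forall m \near r^'+, r < m < 0.
    near=> m; apply/andP; split; near: m; [exact: nbhs_right_gt|exact: nbhs_right_lt].
  have Vd m : r < m < 0 -> dom psi m.
    move=> /andP[rm m0]; have : Ms m by apply: tilt_le; rewrite ?ltW// E lte_fin.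
    by case/(tilt_dom hpsi hdom).
  set f := (X in lim X).
  have cf : cvg f.
    apply: (ereal_nonincreasing_is_cvg V) => x xr; near=> y.
    rewrite lee_fin; apply: dpsi_mono; last 2 first.
    - exact: Vd.
    - by apply: ltW; near: y; apply: nbhs_right_lt; case/andP: xr.
    by apply: Vd; near: y.
  rewrite -E => lz; apply: contrapT => /none H; move: lz.
  have : ((z^-1)%:E <= lim f)%E.
    apply: lime_ge => //; near=> y; have : r < y < 0 by near: y.
    move=> /andP[ry y0]; rewrite lee_fin -[z^-1]mul1r ler_pdivrMr// mulrC.
    by apply: H; rewrite ?ltW// E lte_fin.
  case: (lim f) => [l| |] //.
  + rewrite lee_fin => lz; have l0 : 0 < l by apply: lt_le_trans lz; rewrite invr_gt0.
    by rewrite inver gt_eqF// lte_fin ltNge -[z]invrK lef_pV2 ?posrE ?invr_gt0// lz.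
  + by move=> _; rewrite invey lte_fin ltNge ltW.
- have pm m : m < 0 -> [/\ dom psi m, p m < 0 & p m <= m * dpsi psi m].
    move=> m0; have mM : Ms m by apply: tilt_le; rewrite ?ltW// E ltNyr.
    have [md d0] := tilt_dom hpsi hdom mM.
    have H := exponent_le hpsi dom0 md; split => //.
    by apply: le_lt_trans H _; rewrite nmulr_rlt0.
  set f := (X in lim X).
  have V : \forall m \near -oo, m < (0 : R) by exact: nbhs_ninfty_lt.
  have cf : cvg f.
    apply: (ereal_nondecreasing_is_cvg V) => x x0; near=> y.
    have xy : y < x by near: y; apply: nbhs_ninfty_lt; exact: num_real.
    have [xd px pxd] := pm _ x0; have [yd py _] := pm _ (lt_trans xy x0).
    rewrite lee_fin ler_ndivlMr// mulrAC ler_ndivlMr//.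
    have := laplace_exponent_tangent hpsi yd xd.
    move: px py pxd; rewrite /=.
    move: (fine (psi x)) (fine (psi y)) (dpsi psi x) => a b c px py pxd H.
    have : x * b <= x * (a + c * (y - x)) by rewrite ler_nM2l.
    have : x * c * (y - x) <= a * (y - x) by rewrite ler_nM2r ?subr_lt0.
    by move=> *; lra.
  rewrite -E => lz; apply: contrapT => /none H; move: lz.
  rewrite ltNge => /negP; apply; apply: lime_le => //; near=> y.
  have y0 : y < 0 by near: y.
  have [yd py pyd] := pm _ y0; rewrite lee_fin ler_ndivrMr//.
  apply: (@le_trans _ _ (z * (y * dpsi psi y))); first by rewrite ler_pM2l.
  by rewrite mulrCA ger_nMr//; apply: H; rewrite ?ltW// E ltNyr.
Unshelve. all: by end_near. Qed.

End delta.

(** * The limits *)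

Section log_decay_bounds.
Context {R : realType}.
Implicit Types (h c : R) (q l : \bar R).

Lemma log_decay_le h c q : 0 < h -> (0 <= q)%E -> (q <= (expR (h * c))%:E)%E ->
  (log_decay h q <= c%:E)%E.
Proof.
move=> h0 q0 qc; rewrite /log_decay lee_pdivrMl//.
rewrite -[X in (_ <= X)%E]expeRK lee_lne// in_itv/= leey ?andbT//.
Qed.

Lemma log_decay_ge h c q : 0 < h -> ((expR (h * c))%:E <= q)%E ->
  (c%:E <= log_decay h q)%E.
Proof.
move=> h0 qc; rewrite /log_decay lee_pdivlMl//.
rewrite -[X in (X <= _)%E]expeRK lee_lne// in_itv/= leey andbT.
  by rewrite lee_fin expR_ge0.
by apply: le_trans qc; rewrite lee_fin expR_ge0.
Qed.

Lemma log_decay_le_inv h c q : 0 < h -> (0 <= q)%E -> (log_decay h q <= c%:E)%E ->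
  (q <= (expR (h * c))%:E)%E.
Proof.
move=> h0 q0; rewrite /log_decay lee_pdivrMl// -EFinM => H.
have : (expeR (lne q) <= expeR (h * c)%:E)%E by rewrite lee_expeR.
by rewrite lneK// in_itv/= q0 leey.
Qed.

Lemma log_decay_mono h q q' : 0 < h -> (0 <= q)%E -> (q <= q')%E ->
  (log_decay h q <= log_decay h q')%E.
Proof.
move=> h0 q0 qq; rewrite /log_decay lee_pmul2l ?lte_fin ?invr_gt0//.
by rewrite lee_lne// in_itv/= leey andbT//; exact: le_trans qq.
Qed.

Lemma limsup_pinfty_le (f : R -> \bar R) l :
  (\forall t \near pinfty_nbhs R, (f t <= l)%E) -> (limsup_pinfty f <= l)%E.
Proof.
move=> H; apply: (@le_trans _ _ (ereal_sup (f @` [set t | (f t <= l)%E]))).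
  by apply: ereal_inf_lbound; exists [set t | (f t <= l)%E].
by apply: ub_ereal_sup => _ [t ft <-].
Qed.

Lemma limsup_pinfty_lt (f : R -> \bar R) l : (limsup_pinfty f < l)%E ->
  \forall t \near pinfty_nbhs R, (f t <= l)%E.
Proof.
move=> /ereal_inf_lt [_ [V FV <-] Vl]; apply: filterS FV => t Vt.
by apply: le_trans (ltW Vl); apply: ereal_sup_ubound; exists t.
Qed.

Lemma liminf_pinfty_ge (f : R -> \bar R) l :
  (\forall t \near pinfty_nbhs R, (l <= f t)%E) -> (l <= liminf_pinfty f)%E.
Proof.
move=> H; rewrite /liminf_pinfty /limf_einf leeNr.
apply: (@limsup_pinfty_le (fun t => - f t)%E).
by apply: filterS H => t; rewrite leeN2.
Qed.

Lemma ereal_le_real_above x l : (forall c, (l < c%:E)%E -> (x <= c%:E)%E) -> (x <= l)%E.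
Proof.
case: l => [r| |] H; [|by rewrite leey|].
  by apply/lee_addgt0Pr => e e0; rewrite -EFinD; apply: H; rewrite lte_fin ltrDl.
case: x H => [r| |] H //; last by have := H 0 (ltNyr _).
by have := H (r - 1) (ltNyr _); rewrite lee_fin lerBrDr gerDl ler10.
Qed.

Lemma ereal_ge_real_below x l : (forall c, (c%:E < l)%E -> (c%:E <= x)%E) -> (l <= x)%E.
Proof.
move=> H; rewrite -leeN2; apply: ereal_le_real_above => c.
by rewrite lteNl leeNl -EFinN; exact: H.
Qed.

Lemma ereal_lt_real_between l c : (l < c%:E)%E -> exists2 c' : R, (l < c'%:E)%E & c' < c.
Proof.
case: l => [r| |] //.
  rewrite lte_fin => rc; exists ((r + c) / 2); last by lra.
  by rewrite lte_fin; lra.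
by move=> _; exists (c - 1); [rewrite ltNyr|lra].
Qed.

End log_decay_bounds.

(** * Window probabilities and exponential tightness *)

Section theorem_parts.
Context {d} {T : measurableType d} {R : realType}.
Variables (P : probability T R) (xi : R -> {RV P >-> R}).
Hypothesis hxi : levy_from_zero xi.
Variables (psi : R -> \bar R) (mm mp : \bar R).
Hypothesis hpsi : laplace_exponent xi psi.
Hypothesis hdom : dom psi = [set m | (mm < m%:E < mp)%E].
Hypothesis dom0 : dom psi 0.
Hypothesis dpsi0 : 0 < dpsi psi 0.
Variable a : R.
Hypothesis a0 : 0 < a.
Local Notation p := (fine \o psi).
Local Notation v0 := (dpsi psi 0).
Local Notation Z := (clock_ratio xi a).
Local Notation Ms m := (m_zero psi < m%:E < mp)%E.
Local Notation C := (closure (Delta psi mp)).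

Lemma Delta_left x : Delta psi mp x -> 0 < x /\ exists2 m, Ms m & 1 < x * dpsi psi m.
Proof. by move=> /andP[/(tau_plus_lt hpsi hdom dom0 dpsi0)]. Qed.

Lemma Delta_right x : Delta psi mp x -> exists2 m, Ms m & x * dpsi psi m < 1.
Proof.
move=> /[dup] /Delta_left [x0 _] /andP[_].
exact: (tau_zero_gt hpsi hdom dom0 dpsi0).
Qed.

Lemma closure_gt x y : C x -> y < x -> exists2 z, Delta psi mp z & y < z.
Proof.
move=> Cx yx; have [|z [Dz /= yz]] := Cx [set z | y < z].
  by apply: open_nbhs_nbhs; split => //; exact: open_gt.
by exists z.
Qed.

Lemma closure_lt x y : C x -> x < y -> exists2 z, Delta psi mp z & z < y.
Proof.
move=> Cx xy; have [|z [Dz /= zy]] := Cx [set z | z < y].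
  by apply: open_nbhs_nbhs; split => //; exact: open_lt.
by exists z.
Qed.

Lemma closure_ge0 x : C x -> 0 <= x.
Proof.
move=> Cx; rewrite leNgt; apply/negP => x0.
have [z /Delta_left [z0 _] zx] := closure_lt Cx x0.
by move: z0; rewrite ltNge ltW.
Qed.

(** An end of Delta may itself violate the slope condition, but every positive point strictly to its
    left inherits it from a point of Delta further right. *)
Lemma closure_right x y : C x -> 0 < y -> y < x -> exists2 m, Ms m & y * dpsi psi m < 1.
Proof.
move=> Cx y0 yx; have [z /Delta_right [m mM zm] yz] := closure_gt Cx yx.
exists m => //; apply: lt_trans zm; rewrite ltr_pM2r//.
by case: (tilt_dom hpsi hdom mM).
Qed.

Lemma closure_left x y : C x -> x < y -> exists2 m, Ms m & 1 < y * dpsi psi m.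
Proof.
move=> Cx xy; have [z /Delta_left [z0 [m mM zm]] zy] := closure_lt Cx xy.
exists m => //; apply: (lt_trans zm); rewrite ltr_pM2r//.
by case: (tilt_dom hpsi hdom mM).
Qed.

(** To the right of 1/v0 only exponents [m <= 0] matter, and their affine functions have nonnegative
    slope [- p m]; the others contribute at most 0. *)
Lemma rate_nondecreasing y y' : 0 < y -> 1 <= y * v0 -> y <= y' ->
  (rate psi mp y <= rate psi mp y')%E.
Proof.
move=> y0 yv yy; apply: ub_ereal_sup => _ [m mM <-].
have [md d0] := tilt_dom hpsi hdom mM.
have [m0|m0] := leP m 0.
  apply: (le_trans _ (rate_ge y' mM)); rewrite lee_fin.
  have := exponent_sign hpsi hdom dom0 mM m0; rewrite /=.
  by move: (fine (psi m)) => q q0; nra.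
apply: (le_trans _ (rate_ge0 hpsi hdom dom0 dpsi0 y')); rewrite lee_fin subr_le0.
apply: (@le_trans _ _ (y * (v0 * m))); first by rewrite mulrA ler_peMl// ltW.
by rewrite ler_pM2l// (exponent_ge hpsi dom0).
Qed.

Lemma rate_nonincreasing y y' : 0 < y -> y * v0 <= 1 -> y' <= y ->
  (rate psi mp y <= rate psi mp y')%E.
Proof.
move=> y0 yv yy; apply: ub_ereal_sup => _ [m mM <-].
have [md d0] := tilt_dom hpsi hdom mM.
have pm := exponent_ge hpsi dom0 md.
have [m0|m0] := leP 0 m.
  apply: (le_trans _ (rate_ge y' mM)); rewrite lee_fin.
  have : 0 <= p m by apply: le_trans pm; rewrite mulr_ge0// ltW.
  by rewrite /=; move: (fine (psi m)) => q q0; nra.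
apply: (le_trans _ (rate_ge0 hpsi hdom dom0 dpsi0 y')); rewrite lee_fin subr_le0.
apply: (@le_trans _ _ (y * (v0 * m))); last by rewrite ler_pM2l.
by rewrite mulrA ler_niMl// ltW.
Qed.

Lemma rate_center x : x * v0 = 1 -> rate psi mp x = 0%E.
Proof.
move=> xv; have x0 : 0 < x by rewrite -(pmulr_lgt0 _ dpsi0) xv.
apply/eqP; rewrite eq_le (rate_ge0 hpsi hdom dom0 dpsi0) andbT.
apply: ub_ereal_sup => _ [m mM <-]; have [md d0] := tilt_dom hpsi hdom mM.
rewrite lee_fin subr_le0 -[leLHS]mul1r -xv -mulrA ler_pM2l//.
exact: (exponent_ge hpsi dom0).
Qed.

(** Minus the rate at the end of the window nearest to 1/v0, and 0 when 1/v0 is interior to the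
    window. *)
Definition window_rate (x e : R) : \bar R :=
  if 1 <= (x - e) * v0 then (- rate psi mp (x - e))%E
  else if (x + e) * v0 <= 1 then (- rate psi mp (x + e))%E else 0%E.

Lemma pssmp_law_window (x e t : R) : 1 < t ->
  pssmp_law xi a [set X | (x - e <= scaled_clock X t <= x + e)%R] =
  P [set w | (x - e <= Z t w <= x + e)%R].
Proof.
move=> t1; have t0 : 0 <= t by apply: ltW; apply: lt_trans t1.
exact: (pssmp_law_scaled_clock hxi a0 [set y | x - e <= y <= x + e] t0).
Qed.

Lemma window_cvg (x e : R) : C x -> 0 < e ->
  log_decay (ln t) (pssmp_law xi a [set X | (x - e <= scaled_clock X t <= x + e)%R])
    @[t --> +oo] --> window_rate x e.
Proof.
move=> Cx e0.
have mW t y z : 1 < t -> measurable [set w | (y <= Z t w <= z)%R].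
  exact: clock_ratio_cc_measurable.
have up c : (\forall t \near pinfty_nbhs R,
    (P [set w | (x - e <= Z t w <= x + e)%R] <= (expR (ln t * c))%:E)%E) ->
  \forall t \near +oo, (log_decay (ln t) (pssmp_law xi a
    [set X | (x - e <= scaled_clock X t <= x + e)%R]) <= c%:E)%E.
  move=> H; have := @near_gt1 R; apply: filterS2 H => t H t1.
  by rewrite pssmp_law_window//; apply: log_decay_le => //; rewrite ln_gt0.
have lo c : (\forall t \near pinfty_nbhs R,
    ((expR (ln t * c))%:E <= P [set w | (x - e <= Z t w <= x + e)%R])%E) ->
  \forall t \near +oo, (c%:E <= log_decay (ln t) (pssmp_law xi a
    [set X | (x - e <= scaled_clock X t <= x + e)%R]))%E.
  move=> H; have := @near_gt1 R; apply: filterS2 H => t H t1.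
  by rewrite pssmp_law_window//; apply: log_decay_ge => //; rewrite ln_gt0.
rewrite /window_rate; case: ifPn => [xe|]; last rewrite -ltNge => xe.
  have y0 : 0 < x - e by rewrite -(pmulr_lgt0 _ dpsi0) (lt_le_trans _ xe).
  have yx : x - e < x by rewrite ltrBlDr ltrDl.
  apply: ereal_cvg_bounds => c cr.
    apply: lo; have [m1 mM1 ym1] := closure_right Cx y0 yx.
    have yz : x - e < x + e by lra.
    have := clock_rate_lower_right hxi hpsi hdom dom0 dpsi0 a0 y0 xe mM1 ym1 yz cr.
    have := @near_gt1 R; apply: filterS2 => t t1 H; apply: (le_trans H).
    apply: le_measure; rewrite ?inE; [exact: clock_ratio_oo_measurable|exact: mW|].
    by move=> w /= /andP[/ltW -> /ltW ->].
  apply: up.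
  have := clock_rate_upper_right hxi hpsi hdom dom0 a0 y0 xe cr.
  have := @near_gt1 R; apply: filterS2 => t t1 H; apply: le_trans H.
  apply: le_measure; rewrite ?inE; [exact: mW|exact: clock_ratio_ge_measurable|].
  by move=> w /= /andP[].
case: ifPn => [xe'|]; last rewrite -ltNge => xe'.
  have y0 : 0 < x + e by rewrite ltr_wpDl// closure_ge0.
  have yx : x < x + e by rewrite ltrDl.
  apply: ereal_cvg_bounds => c cr.
    apply: lo; have [m2 mM2 ym2] := closure_left Cx yx.
    (* The left end of the window may be nonpositive, while the lower bound needs a positive
       level. *)
    pose z := Num.max (x - e) ((x + e) / 2).
    have z0 : 0 < z by rewrite lt_max divr_gt0 ?orbT.
    have zy : z < x + e by rewrite gt_max; lra.
    have := clock_rate_lower_left hxi hpsi hdom dom0 dpsi0 a0 z0 zy xe' mM2 ym2 cr.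
    have := @near_gt1 R; apply: filterS2 => t t1 H; apply: (le_trans H).
    apply: le_measure; rewrite ?inE; [exact: clock_ratio_oc_measurable|exact: mW|].
    move=> w /= /andP[zw ->]; rewrite andbT; apply: le_trans (ltW zw).
    by rewrite le_max lexx.
  apply: up.
  have := clock_rate_upper_left hxi hpsi hdom dom0 dpsi0 a0 (ltW y0) xe' cr.
  have := @near_gt1 R; apply: filterS2 => t t1 H; apply: le_trans H.
  apply: le_measure; rewrite ?inE; [exact: mW|exact: clock_ratio_le_measurable|].
  by move=> w /= /andP[].
apply: ereal_cvg_bounds => c; rewrite lte_fin => c0.
  by apply: lo; exact: (clock_concentration hxi hpsi dom0 dpsi0 a0 xe xe' c0).
apply: up; have := @near_gt1 R; apply: filterS => t t1.
by apply: probability_le_expR => //; [exact: ltW|exact: mW].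
Qed.

(** The rate at the governing end is at most the rate at [x] by monotonicity. Conversely a supremum
    of affine functions is lower semicontinuous: an [m] nearly optimal at [x] remains so at nearby
    points. The argument also covers an infinite rate at [x]. *)
Lemma window_rate_cvg (x : R) : C x -> window_rate x e @[e --> 0^'+] --> (- rate psi mp x)%E.
Proof.
move=> Cx; have x0 := closure_ge0 Cx.
have e00 : \forall e \near (0 : R)^'+, 0 < e by exact: nbhs_right_gt.
have small k : 0 < k -> \forall e \near (0 : R)^'+, e <= k.
  by move=> k0; near=> e; apply: ltW; near: e; exact: nbhs_right_lt.
have [xv|xv|xv] := ltgtP 1 (x * v0).
- have k0 : 0 < x - v0^-1.
    by rewrite subr_gt0 -div1r ltr_pdivrMr.
  have E e : 0 < e -> e <= x - v0^-1 -> [/\ 0 < x - e, 1 <= (x - e) * v0 &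
      window_rate x e = (- rate psi mp (x - e))%E].
    move=> ep ek; have H : 1 <= (x - e) * v0.
      by rewrite -ler_pdivrMr// div1r; lra.
    split => //; last by rewrite /window_rate H.
    by rewrite -(pmulr_lgt0 _ dpsi0) (lt_le_trans _ H).
  apply: ereal_cvg_bounds => c cr.
    near=> e; have ep : 0 < e by near: e.
    have [ye yv ->] : [/\ 0 < x - e, 1 <= (x - e) * v0 &
      window_rate x e = (- rate psi mp (x - e))%E].
      by apply: E => //; near: e; exact: small.
    apply: (le_trans (ltW cr)); rewrite leeN2; apply: rate_nondecreasing => //.
    by rewrite gerBl ltW.
  move: cr; rewrite lteNl -EFinN => /rate_gtP [m mM mc].
  (* The displacement within which the affine function of slope [- p m] uses up at most its slack
     over [- c]; adding 1 covers [p m = 0]. *)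
  have j0 : 0 < (m - x * p m + c) / (`|p m| + 1).
    apply: divr_gt0; last by rewrite ltr_wpDl.
    by move: mc; move: (x * p m) => q; lra.
  near=> e; have ep : 0 < e by near: e.
  have [ye yv ->] : [/\ 0 < x - e, 1 <= (x - e) * v0 &
      window_rate x e = (- rate psi mp (x - e))%E].
    by apply: E => //; near: e; exact: small.
  rewrite leeNl -EFinN; apply: le_trans (rate_ge _ mM); rewrite lee_fin.
  have : e <= (m - x * p m + c) / (`|p m| + 1) by near: e; exact: small.
  rewrite ler_pdivlMr ?ltr_wpDl//.
  have : e * - `|p m| <= e * p m.
    by rewrite ler_pM2l// lerNl -[leRHS]normrN ler_norm.
  by move: (p m) `|p m| => q q' *; lra.
- have k0 : 0 < v0^-1 - x.
    by rewrite subr_gt0 -div1r ltr_pdivlMr.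
  have E e : 0 < e -> e <= v0^-1 - x -> [/\ 0 < x + e, (x + e) * v0 <= 1 &
      window_rate x e = (- rate psi mp (x + e))%E].
    move=> ep ek; have H : (x + e) * v0 <= 1.
      by rewrite -ler_pdivlMr// div1r; lra.
    have y0 : 0 < x + e by rewrite ltr_wpDl.
    split => //; rewrite /window_rate H ifF//; apply/negbTE; rewrite -ltNge.
    by apply: lt_le_trans H; rewrite ltr_pM2r//; lra.
  apply: ereal_cvg_bounds => c cr.
    near=> e; have ep : 0 < e by near: e.
    have [ye yv ->] : [/\ 0 < x + e, (x + e) * v0 <= 1 &
      window_rate x e = (- rate psi mp (x + e))%E].
      by apply: E => //; near: e; exact: small.
    apply: (le_trans (ltW cr)); rewrite leeN2; apply: rate_nonincreasing => //.
    by rewrite lerDl ltW.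
  move: cr; rewrite lteNl -EFinN => /rate_gtP [m mM mc].
  have j0 : 0 < (m - x * p m + c) / (`|p m| + 1).
    apply: divr_gt0; last by rewrite ltr_wpDl.
    by move: mc; move: (x * p m) => q; lra.
  near=> e; have ep : 0 < e by near: e.
  have [ye yv ->] : [/\ 0 < x + e, (x + e) * v0 <= 1 &
      window_rate x e = (- rate psi mp (x + e))%E].
    by apply: E => //; near: e; exact: small.
  rewrite leeNl -EFinN; apply: le_trans (rate_ge _ mM); rewrite lee_fin.
  have : e <= (m - x * p m + c) / (`|p m| + 1) by near: e; exact: small.
  rewrite ler_pdivlMr ?ltr_wpDl//.
  have : e * p m <= e * `|p m| by rewrite ler_pM2l// ler_norm.
  by move: (p m) `|p m| => q q' *; lra.
- rewrite rate_center// oppe0; apply: cvg_near_cst; near=> e.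
  have ep : 0 < e by near: e.
  rewrite /window_rate ifF; last first.
    by apply/negbTE; rewrite -ltNge xv ltr_pM2r//; lra.
  rewrite ifF//; apply/negbTE; rewrite -ltNge xv ltr_pM2r//; lra.
Unshelve. all: by end_near. Qed.

(** A single [m < 0] with [p m < 0] suffices: the Chernoff exponent [- m + A * p m] tends to [-oo]
    with [A]. *)
Lemma clock_exponentially_tight :
  limsup_pinfty (fun t =>
     log_decay (ln t) (pssmp_law xi a [set X | A < scaled_clock X t]))
     @[A --> +oo] --> -oo%E.
Proof.
have [m m0 [md pm0]] := laplace_exponent_neg hpsi dom0 dpsi0.
apply/cvgeNyPle => c; near=> A.
have A0 : 0 < A by near: A; apply: nbhs_pinfty_gt; exact: num_real.
have Ac : - m + A * p m < c.
  have : (1 - m - c) / - p m <= A by near: A; exact: near_pinfty_ge.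
  rewrite ler_pdivrMr ?oppr_gt0//; rewrite mulrN; move: (A * p m) => q ?; lra.
apply: limsup_pinfty_le.
have := clock_upper_right hxi hpsi dom0 a0 md (ltW m0) (ltW pm0) A0 Ac.
have := @near_gt1 R; apply: filterS2 => t t1 H.
have t0 : 0 <= t by apply: ltW; apply: lt_trans t1.
rewrite (pssmp_law_scaled_clock hxi a0 [set y | A < y] t0).
apply: log_decay_le => //; first by rewrite ln_gt0.
apply: le_trans H; apply: le_measure; rewrite ?inE.
- exact: clock_ratio_gt_measurable.
- exact: clock_ratio_ge_measurable.
- by move=> w /= /ltW.
Unshelve. all: by end_near. Qed.

End theorem_parts.

(** * The large deviation principle *)

Section large_deviation_principle.
Context {d} {T : measurableType d} {R : realType}.
Variables (P : probability T R) (xi : R -> {RV P >-> R}).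
Hypothesis hxi : levy_from_zero xi.
Variables (psi : R -> \bar R) (mm mp : \bar R).
Hypothesis hpsi : laplace_exponent xi psi.
Hypothesis hdom : dom psi = [set m | (mm < m%:E < mp)%E].
Hypothesis dom0 : dom psi 0.
Hypothesis dpsi0 : 0 < dpsi psi 0.
Variable a : R.
Hypothesis a0 : 0 < a.
Local Notation p := (fine \o psi).
Local Notation v0 := (dpsi psi 0).
Local Notation Z := (clock_ratio xi a).
Local Notation Ms m := (m_zero psi < m%:E < mp)%E.
Local Notation C := (closure (Delta psi mp)).

(** The infimum is taken in the extended reals, so that every point is far from an empty Delta. *)
Definition far_from_Delta (e : R) : set R :=
  [set z | (e%:E < ereal_inf [set `|x - z|%:E | x in C])%E].

Lemma far_from_Delta_ge (e r z : R) : e < r -> (forall x, C x -> r <= `|x - z|) ->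
  far_from_Delta e z.
Proof.
move=> er H; apply: (@lt_le_trans _ _ r%:E); first by rewrite lte_fin.
by apply: le_ereal_inf_tmp => _ [x Cx <-]; rewrite lee_fin H.
Qed.

Lemma far_from_Delta_measurable e : measurable (far_from_Delta e).
Proof.
apply: open_measurable; rewrite openE => z; rewrite /far_from_Delta /= => ez.
have [r er rz] : exists2 r : R, e < r & forall x, C x -> r <= `|x - z|.
  have H x : C x -> (ereal_inf [set `|x - z|%:E | x in C] <= `|x - z|%:E)%E.
    by move=> Cx; apply: ereal_inf_lbound; exists x.
  move: ez H; case: (ereal_inf _) => [r| |] //= er H.
    by exists r; rewrite -?lte_fin// => x /H; rewrite lee_fin.
  exists (e + 1); first by rewrite ltrDl.
  by move=> x /H.
have re0 : 0 < (r - e) / 2 by rewrite divr_gt0// subr_gt0.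
exists ((r - e) / 2) => //= z' zz'; apply: (@far_from_Delta_ge _ ((r + e) / 2)).
  by lra.
move=> x /rz rx; have := ler_normD (x - z') (z' - z).
rewrite addrA subrK [`|z' - z|]distrC => H; move: zz' => /= zz'; lra.
Qed.

Lemma exists_neg_tilt : exists2 m : R, m < 0 & Ms m /\ p m < 0.
Proof.
have [u u0 [ud du]] := m_zero_ltP (m_zero_lt0 hpsi hdom dom0 dpsi0).
have mM : Ms (u / 2).
  apply/andP; split; last first.
    have /andP[_] := tilt0 hpsi hdom dom0 dpsi0; apply: lt_trans.
    by rewrite lte_fin; lra.
  by apply: le_lt_trans (m_zero_le ud du) _; rewrite lte_fin; lra.
have [md d0] := tilt_dom hpsi hdom mM.
exists (u / 2); first by lra.
split => //; apply: le_lt_trans (exponent_le hpsi dom0 md) _.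
by rewrite nmulr_rlt0//; lra.
Qed.

Lemma rate_closed (c : R) : closed [set x | (rate psi mp x <= c%:E)%E].
Proof.
rewrite (_ : [set x | _] = \bigcap_(m in [set m | Ms m]) [set x | m - x * p m <= c]).
  apply: closed_bigI => m mM.
  rewrite (_ : [set x | _] = (fun x => m - x * p m) @^-1` [set y | y <= c])//.
  apply: closed_comp; last exact: closed_le.
  move=> x _; apply: cvgB; first exact: cvg_cst.
  by apply: cvgMl; exact: cvg_id.
apply/seteqP; split => x /= H.
  by move=> m mM /=; rewrite -lee_fin; apply: le_trans H; exact: rate_ge.
by apply: ub_ereal_sup => _ [m mM <-]; rewrite lee_fin; exact: (H m mM).
Qed.

Lemma rate_ext_good : good_rate_function [set x | 0 <= x] (rate_ext psi mp).
Proof.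
split => [x _|c].
  by rewrite /rate_ext; case: ifPn => // _; exact: (rate_ge0 hpsi hdom dom0 dpsi0).
have [m m0 [mM pm0]] := exists_neg_tilt.
have E : [set x | 0 <= x] `&` [set x | (rate_ext psi mp x <= c%:E)%E] =
    [set x | 0 <= x] `&` (C `&` [set x | (rate psi mp x <= c%:E)%E]).
  congr (_ `&` _); apply/seteqP; split => x /=; rewrite /rate_ext.
    by case: ifPn => // /set_mem.
  by case=> Cx xc; rewrite mem_set.
(* The affine minorant [m - x * p m] has positive slope, and exceeds [c] beyond this right end. *)
rewrite E; apply: (@subclosed_compact _ _ `[0, (c - m) / - p m]).
- apply: closedI; first exact: closed_ge.
  by apply: closedI; [exact: closed_closure|exact: rate_closed].
- exact: segment_compact.
- move=> x /= [x0 [_ xc]]; rewrite in_itv/= x0/= ler_pdivlMr ?oppr_gt0//.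
  have : ((m - x * p m)%:E <= c%:E)%E by apply: le_trans xc; exact: rate_ge.
  by rewrite lee_fin mulrN; move: (x * p m) => q ?; lra.
Qed.

Lemma closure_interval x y z : C x -> C z -> x < y -> y < z -> C y.
Proof.
move=> Cx Cz xy yz; apply: subset_closure.
have [x' /andP[x1 _] xy'] := closure_lt Cx xy.
have [z' /andP[_ z2] yz'] := closure_gt Cz yz.
apply/andP; split; first by apply: (lt_trans x1); rewrite lte_fin.
by apply: lt_trans z2; rewrite lte_fin.
Qed.

Lemma near_expR_add (c c' : R) (q : R -> \bar R) (q1 q2 : R -> \bar R) : c < c' ->
  (forall t, 1 < t -> (q t <= q1 t + q2 t)%E) ->
  (\forall t \near pinfty_nbhs R, (q1 t <= (expR (ln t * c))%:E)%E) ->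
  (\forall t \near pinfty_nbhs R, (q2 t <= (expR (ln t * c))%:E)%E) ->
  \forall t \near pinfty_nbhs R, (q t <= (expR (ln t * c'))%:E)%E.
Proof.
move=> cc' qq H1 H2; have HS := near_ln (near_expRD_le cc' cc').
apply: filterS3 HS H1 H2 => t [S t1 _] h1 h2; apply: (le_trans (qq t t1)).
apply: (@le_trans _ _ ((expR (ln t * c))%:E + (expR (ln t * c))%:E)%E).
  exact: leeD.
by rewrite -EFinD lee_fin.
Qed.

Hypothesis hD : Delta psi mp = [set x | 0 < x] \/
  (forall e : R, 0 < e ->
     limsup_pinfty (fun t => log_decay (ln t) (pssmp_law xi a
       [set X | far_from_Delta e (scaled_clock X t)])) = -oo%E).

Lemma prob_far_from_Delta (e c : R) : Delta psi mp <> [set x | 0 < x] -> 0 < e ->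
  \forall t \near pinfty_nbhs R,
    (P [set w | far_from_Delta e (Z t w)] <= (expR (ln t * c))%:E)%E.
Proof.
case: hD => // H _ e0.
have : (limsup_pinfty (fun t => log_decay (ln t) (pssmp_law xi a
       [set X | far_from_Delta e (scaled_clock X t)])) < c%:E)%E.
  by rewrite H// ltNyr.
move/limsup_pinfty_lt; have := @near_gt1 R; apply: filterS2 => t t1.
have t0 : 0 <= t by apply: ltW; apply: lt_trans t1.
rewrite (pssmp_law_scaled_clock hxi a0 (far_from_Delta e) t0).
by apply: log_decay_le_inv; rewrite ?ln_gt0.
Qed.

Lemma closure_dist (x : R) : ~ C x -> exists2 e : R, 0 < e & forall y, C y -> e <= `|y - x|.
Proof.
move=> Cx; have : nbhs x (~` C).
  by apply: open_nbhs_nbhs; split => //; apply: closed_openC; exact: closed_closure.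
move=> [e /= e0 H]; exists e => // y Cy; rewrite leNgt; apply/negP => ye.
by apply: (H y) => //=; rewrite distrC.
Qed.

Lemma not_positive_of_notin x : 0 <= x -> ~ C x -> Delta psi mp <> [set x | 0 < x].
Proof.
move=> x0 Cx E; apply: Cx; rewrite E => B [e /= e0 Be].
exists (x + e / 2); split => /=; first by rewrite ltr_wpDl// divr_gt0.
apply: Be => /=; rewrite opprD addNKr normrN gtr0_norm ?divr_gt0//.
by rewrite ltr_pdivrMr// ltr_pMr// ltr1n.
Qed.

(** Otherwise Delta is not (0, oo), so the second alternative of [hD] holds and makes a
    neighbourhood of the typical value negligible, against concentration. This also excludes an
    empty Delta, as for a deterministic drift. *)
Lemma center_in_closure : C v0^-1.
Proof.
apply: contrapT => NC.
have NP := not_positive_of_notin (ltW _) NC; have {}NP := NP _.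
have ND : Delta psi mp <> [set x | 0 < x] by apply: NP; rewrite invr_gt0.
have [e e0 He] := closure_dist NC.
(* A window of radius e/4 stays at distance at least 3e/4 > e/2 from the closure. The decay rates -1
   and -2 used below only need to be negative and in this order. *)
have e4 : 0 < e / 4 by rewrite divr_gt0.
have e2 : 0 < e / 2 by rewrite divr_gt0.
have y1 : (v0^-1 - e / 4) * v0 < 1.
  by rewrite mulrBl mulVf ?gt_eqF// ltrBlDr ltrDl mulr_gt0.
have y2 : 1 < (v0^-1 + e / 4) * v0.
  by rewrite mulrDl mulVf ?gt_eqF// ltrDl mulr_gt0.
have HC := clock_concentration hxi hpsi dom0 dpsi0 a0 y1 y2 (@ltrN10 R).
have HF := prob_far_from_Delta (- 2) ND e2.
have F : \forall t \near pinfty_nbhs R, False.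
  apply: filterS3 (@near_gt1 R) HC HF => t t1 h1 h2.
  have : ((expR (ln t * -1))%:E <= (expR (ln t * -2))%:E)%E.
    apply: (le_trans h1); apply: le_trans h2; apply: le_measure; rewrite ?inE.
    - exact: clock_ratio_cc_measurable.
    - by apply: (clock_ratio_set_measurable hxi a0) => //; exact: far_from_Delta_measurable.
    move=> w /= /andP[w1 w2]; apply: (@far_from_Delta_ge _ (3 * e / 4)); first by lra.
    move=> y /He ey; have := ler_normD (y - Z t w) (Z t w - v0^-1).
    rewrite addrA subrK => H.
    have : `|Z t w - v0^-1| <= e / 4 by rewrite ler_norml; apply/andP; split; lra.
    lra.
  by rewrite lee_fin ler_expR ler_pM2l ?ln_gt0// lerN2 lern1.
by have /filter_ex[] := F.
Qed.

Lemma rate_ext_center : rate_ext psi mp v0^-1 = 0%E.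
Proof.
rewrite /rate_ext mem_set; last exact: center_in_closure.
by apply: (rate_center hpsi hdom dom0 dpsi0); rewrite mulVf// gt_eqF.
Qed.

(** This part of [F] lies to the right of its smallest point [b]. If [b] is in the closure of Delta,
    the tail bound at [b] applies. If not, the closure is an interval containing 1/v0 and hence lies
    entirely to the left of [b], so everything from [b] on is far from it and negligible. *)
Lemma closed_half_right (F : set R) (c : R) : closed F -> ~ F v0^-1 ->
  (forall x, F x -> v0^-1 <= x -> (- rate_ext psi mp x < c%:E)%E) ->
  \forall t \near pinfty_nbhs R,
   (P [set w | (F `&` [set x | (v0^-1 <= x)%R]) (Z t w)] <= (expR (ln t * c))%:E)%E.
Proof.
move=> cF NF Hc; pose G := F `&` [set x | v0^-1 <= x].
have mF : measurable G.
  by apply: closed_measurable; apply: closedI => //; exact: closed_ge.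
have [G0|NG] := pselect (G !=set0); last first.
  apply: nearW => t; rewrite (_ : [set w | _] = set0) ?measure0 ?lee_fin ?expR_ge0//.
  by rewrite -subset0 => w Gw; apply: NG; exists (Z t w).
have lG : has_lbound G by exists v0^-1 => x [].
pose b := inf G.
have bG x : G x -> b <= x by move=> Gx; exact: ge_inf.
have b1 : v0^-1 <= b by apply: lb_le_inf => // x [].
have Fb : F b.
  apply: contrapT => NFb; have : nbhs b (~` F).
    by apply: open_nbhs_nbhs; split => //; exact: closed_openC.
  move=> [e /= e0 H]; have : b + e <= b.
    apply: lb_le_inf => // x Gx; rewrite leNgt; apply/negP => xb.
    apply: (H x); last by case: Gx.
    have := bG x Gx => bx.
    by rewrite /= ler0_norm ?subr_le0// opprB ltrBlDl.
  by rewrite gerDl leNgt e0.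
have b2 : v0^-1 < b.
  by rewrite lt_neqAle b1 andbT; apply/eqP => E; apply: NF; rewrite E.
have b0 : 0 < b by apply: lt_trans b2; rewrite invr_gt0.
have [Cb|NCb] := pselect (C b).
  have bv : 1 <= b * v0 by rewrite -ler_pdivrMr// div1r.
  have := Hc b Fb b1; rewrite /rate_ext mem_set// => cb.
  have := clock_rate_upper_right hxi hpsi hdom dom0 a0 b0 bv cb.
  apply: filterS2 (@near_gt1 R) => t t1; apply: le_trans; apply: le_measure; rewrite ?inE.
  - exact: (clock_ratio_set_measurable hxi a0).
  - exact: clock_ratio_ge_measurable.
  - by move=> w; exact: bG.
have [e e0 He] := closure_dist NCb.
have e2 : 0 < e / 2 by rewrite divr_gt0.
have := prob_far_from_Delta c (not_positive_of_notin (ltW b0) NCb) e2.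
apply: filterS2 (@near_gt1 R) => t t1; apply: le_trans; apply: le_measure; rewrite ?inE.
- exact: (clock_ratio_set_measurable hxi a0).
- by apply: (clock_ratio_set_measurable hxi a0) => //; exact: far_from_Delta_measurable.
move=> w /bG bZ; apply: (@far_from_Delta_ge _ e).
  by rewrite ltr_pdivrMr// ltr_pMr// ltr1n.
move=> y Cy; have yb : y < b.
  rewrite ltNge le_eqVlt; apply/negP => /predU1P[E|yb]; first by apply: NCb; rewrite E.
  exact/NCb/(closure_interval center_in_closure Cy).
have := He y Cy; rewrite !ltr0_norm ?subr_lt0//; last exact: lt_le_trans bZ.
by move=> ?; lra.
Qed.

Lemma closed_half_left (F : set R) (c : R) : closed F -> ~ F v0^-1 ->
  (forall x, F x -> 0 <= x <= v0^-1 -> (- rate_ext psi mp x < c%:E)%E) ->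
  \forall t \near pinfty_nbhs R,
   (P [set w | (F `&` [set x | (0 <= x <= v0^-1)%R]) (Z t w)] <= (expR (ln t * c))%:E)%E.
Proof.
move=> cF NF Hc; pose G := F `&` [set x | 0 <= x <= v0^-1].
have mF : measurable G.
  apply: closed_measurable; apply: closedI => //.
  rewrite (_ : [set x | _] = [set x | 0 <= x] `&` [set x | x <= v0^-1]).
    by apply: closedI; [exact: closed_ge|exact: closed_le].
  by apply/seteqP; split => x /= => [/andP[]|[-> ->]].
have [G0|NG] := pselect (G !=set0); last first.
  apply: nearW => t; rewrite (_ : [set w | _] = set0) ?measure0 ?lee_fin ?expR_ge0//.
  by rewrite -subset0 => w Gw; apply: NG; exists (Z t w).
have uG : has_ubound G by exists v0^-1 => x [_ /andP[]].
pose b := sup G.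
have bG x : G x -> x <= b by move=> Gx; exact: ub_le_sup.
have b1 : b <= v0^-1 by apply: ge_sup => // x [_ /andP[]].
have b0 : 0 <= b.
  by case: G0 => x Gx; apply: le_trans (bG x Gx); case: Gx => _ /andP[].
have Fb : F b.
  apply: contrapT => NFb; have : nbhs b (~` F).
    by apply: open_nbhs_nbhs; split => //; exact: closed_openC.
  move=> [e /= e0 H]; have : b <= b - e.
    apply: ge_sup => // x Gx; rewrite leNgt; apply/negP => xb.
    apply: (H x); last by case: Gx.
    have := bG x Gx => bx.
    by rewrite /= ger0_norm ?subr_ge0// ltrBlDl -ltrBlDr.
  by rewrite lerBrDr gerDl leNgt e0.
have b2 : b < v0^-1.
  by rewrite lt_neqAle b1 andbT; apply/eqP => E; apply: NF; rewrite -E.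
have [Cb|NCb] := pselect (C b).
  have bv : b * v0 <= 1 by rewrite -ler_pdivlMr// div1r.
  have := Hc b Fb; rewrite b0 b1 => /(_ isT); rewrite /rate_ext mem_set// => cb.
  have := clock_rate_upper_left hxi hpsi hdom dom0 dpsi0 a0 b0 bv cb.
  apply: filterS2 (@near_gt1 R) => t t1; apply: le_trans; apply: le_measure; rewrite ?inE.
  - exact: (clock_ratio_set_measurable hxi a0).
  - exact: clock_ratio_le_measurable.
  - by move=> w; exact: bG.
have [e e0 He] := closure_dist NCb.
have e2 : 0 < e / 2 by rewrite divr_gt0.
have := prob_far_from_Delta c (not_positive_of_notin b0 NCb) e2.
apply: filterS2 (@near_gt1 R) => t t1; apply: le_trans; apply: le_measure; rewrite ?inE.
- exact: (clock_ratio_set_measurable hxi a0).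
- by apply: (clock_ratio_set_measurable hxi a0) => //; exact: far_from_Delta_measurable.
move=> w /bG bZ; apply: (@far_from_Delta_ge _ e).
  by rewrite ltr_pdivrMr// ltr_pMr// ltr1n.
move=> y Cy; have yb : b < y.
  rewrite ltNge le_eqVlt; apply/negP => /predU1P[E|yb]; first by apply: NCb; rewrite -E.
  exact/NCb/(closure_interval Cy center_in_closure).
have := He y Cy; rewrite !gtr0_norm ?subr_gt0//; last exact: le_lt_trans bZ _.
by move=> ?; lra.
Qed.

Lemma clock_LDP : LDP_good [set x | 0 <= x] (fun t => ln t)
  (fun t B => pssmp_law xi a [set X | B (scaled_clock X t)]) (rate_ext psi mp).
Proof.
split; first exact: rate_ext_good.
- move=> F cF; apply: ereal_le_real_above => c.
  set I := ereal_inf _ => Ic.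
  have mFE : measurable (F `&` [set x | 0 <= x]).
    by apply: closed_measurable; apply: closedI => //; exact: closed_ge.
  apply: limsup_pinfty_le.
  suff : \forall t \near pinfty_nbhs R,
      (P [set w | (F `&` [set x | (0 <= x)%R]) (Z t w)] <= (expR (ln t * c))%:E)%E.
    apply: filterS2 (@near_gt1 R) => t t1 H.
    have t0 : 0 <= t by apply: ltW; apply: lt_trans t1.
    rewrite (pssmp_law_scaled_clock hxi a0 (F `&` [set x | 0 <= x]) t0).
    by apply: log_decay_le => //; rewrite ln_gt0.
  have [c0|c0] := leP 0 c.
    apply: filterS (@near_gt1 R) => t t1.
    by apply: probability_le_expR => //; exact: (clock_ratio_set_measurable hxi a0).
  have Hr (x c1 : R) : (- I < c1%:E)%E -> F x -> 0 <= x ->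
      (- rate_ext psi mp x < c1%:E)%E.
    move=> Ic1 Fx x0; apply: le_lt_trans Ic1; rewrite leeN2.
    by apply: ereal_inf_lbound; exists x.
  have vi : 0 < v0^-1 by rewrite invr_gt0.
  (* A negative [c] forces the infimum of the rate over [F] to be positive, whereas the rate
     vanishes at the typical value. *)
  have NF : ~ F v0^-1.
    move=> Fv; have := Hr _ _ Ic Fv (ltW vi).
    by rewrite rate_ext_center oppe0 lte_fin ltNge ltW.
  (* The room between [c1] and [c] absorbs the factor 2 from adding the two halves. *)
  have [c1 Ic1 c1c] := ereal_lt_real_between Ic.
  have HR := closed_half_right cF NF (fun x Fx xv => Hr x c1 Ic1 Fx (le_trans (ltW vi) xv)).
  have HL : \forall t \near pinfty_nbhs R,
     (P [set w | (F `&` [set x | (0 <= x <= v0^-1)%R]) (Z t w)] <= (expR (ln t * c1))%:E)%E.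
    apply: closed_half_left => // x Fx /andP[x0 _]; exact: Hr.
  apply: (near_expR_add c1c _ HL HR) => t t1.
  have m1 : measurable [set w | (F `&` [set x | 0 <= x <= v0^-1]) (Z t w)].
    apply: (clock_ratio_set_measurable hxi a0) => //; apply: measurableI.
      exact: closed_measurable.
    suff -> : [set x | 0 <= x <= v0^-1] = `[0, v0^-1]%classic by exact: measurable_itv.
    by apply/seteqP; split => x /=; rewrite in_itv.
  have m2 : measurable [set w | (F `&` [set x | v0^-1 <= x]) (Z t w)].
    apply: (clock_ratio_set_measurable hxi a0) => //; apply: measurableI.
      exact: closed_measurable.
    by apply: closed_measurable; exact: closed_ge.
  have U2 := measureU2 P m1 m2.
  apply: le_trans U2; apply: le_measure; rewrite ?inE.
  - exact: (clock_ratio_set_measurable hxi a0).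
  - exact: measurableU.
  - move=> w /= [Fw w0]; have [wv|vw] := leP (Z t w) v0^-1.
      by left; split => //=; rewrite w0.
    by right; split => //=; rewrite ltW.
- move=> G oG; apply: ereal_ge_real_below => c.
  set I := ereal_inf _ => Ic.
  have : (I < (- c)%:E)%E by rewrite EFinN lteNr.
  move=> /ereal_inf_lt [_ [x [Gx x0] <-]].
  rewrite /rate_ext; case: ifPn => // /set_mem Cx.
  rewrite EFinN lteNr => cr.
  (* The lower bound is local: a single window around [x] inside [G] suffices, its radius being
     fixed before [t] tends to infinity. *)
  have W := window_rate_cvg hpsi hdom dom0 dpsi0 Cx.
  have : nbhs (- rate psi mp x)%E [set y | (c%:E < y)%E].
    by apply: open_nbhs_nbhs; split => //; exact: open_ereal_gt_ereal.
  move=> /W HW.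
  have [e0 /= e00 HG] : nbhs x G by apply: open_nbhs_nbhs.
  have [e [ep ee ce]] : exists e, [/\ 0 < e, e < e0 & (c%:E < window_rate psi mp x e)%E].
    near (0 : R)^'+ => e; exists e; split.
    - by near: e; exact: nbhs_right_gt.
    - by near: e; exact: nbhs_right_lt.
    - by near: e; exact: HW.
  have W2 := window_cvg hxi hpsi hdom dom0 dpsi0 a0 Cx ep.
  have : nbhs (window_rate psi mp x e) [set y | (c%:E < y)%E].
    by apply: open_nbhs_nbhs; split => //; exact: open_ereal_gt_ereal.
  move=> /W2 HW2.
  apply: liminf_pinfty_ge.
  apply: filterS2 (@near_gt1 R) HW2 => t t1 /= H.
  have t0 : 0 <= t by apply: ltW; apply: lt_trans t1.
  rewrite (pssmp_law_scaled_clock hxi a0 (G `&` [set x | 0 <= x]) t0).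
  apply: (le_trans (ltW H)); rewrite pssmp_law_window//.
  apply: log_decay_mono; rewrite ?ln_gt0//; apply: le_measure; rewrite ?inE.
  - exact: clock_ratio_cc_measurable.
  - apply: (clock_ratio_set_measurable hxi a0) => //; apply: measurableI.
      exact: open_measurable.
    by apply: closed_measurable; exact: closed_ge.
  - move=> w /= /andP[w1 w2]; split; last by apply: clock_ratio_ge0 => //; exact: ltW.
    apply: HG => /=; apply: le_lt_trans ee; rewrite ler_norml; apply/andP; split; lra.
Unshelve. all: by end_near. Qed.

End large_deviation_principle.

Theorem theorem2 (d : measure_display) (T : measurableType d) (R : realType)
    (P : probability T R) (xi : R -> {RV P >-> R}) (psi : R -> \bar R)
    (mm mp : \bar R) (a : R)
    (hxi : levy_from_zero xi)
    (hpsi : laplace_exponent xi psi)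
    (hdom : dom psi = [set m | (mm < m%:E < mp)%E])
    (hdom0 : dom psi 0)
    (hpsi0 : 0 < dpsi psi 0)
    (ha : 0 < a) :
  [/\ forall x : R, closure (Delta psi mp) x ->
        exists2 l : R -> \bar R,
          forall e : R, 0 < e ->
            log_decay (ln t)
              (pssmp_law xi a
                 [set X | x - e <= scaled_clock X t <= x + e])
              @[t --> +oo] --> l e
          & l e @[e --> 0^'+] --> (- rate psi mp x)%E,
      limsup_pinfty (fun t =>
          log_decay (ln t) (pssmp_law xi a [set X | A < scaled_clock X t]))
        @[A --> +oo] --> -oo%E
    & Delta psi mp = [set x | 0 < x] \/
      (forall e : R, 0 < e ->
         limsup_pinfty (fun t =>
           log_decay (ln t) (pssmp_law xi a
             [set X | (e%:E < ereal_inf [set `|x - scaled_clock X t|%:E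
                                        | x in closure (Delta psi mp)])%E]))
         = -oo%E) ->
      LDP_good [set x | 0 <= x] (fun t => ln t)
        (fun t B => pssmp_law xi a [set X | B (scaled_clock X t)])
        (rate_ext psi mp)].
Proof.
split.
- move=> x Cx; exists (window_rate psi mp x) => [e e0|].
    exact: (window_cvg hxi hpsi hdom hdom0 hpsi0 ha).
  exact: (window_rate_cvg hpsi hdom hdom0 hpsi0).
- exact: (clock_exponentially_tight hxi hpsi hdom0 hpsi0 ha).
- exact: (clock_LDP hxi hpsi hdom hdom0 hpsi0 ha).
Qed.
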